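(* Let $\lambda\in\mathbb{Z}/2[[X,Y]]$ be a power series with zero constant term such that $T_5^2$, acting on $W$, equals $\lambda(T_7,T_{13})^2$ (such $\lambda$ exists). Let $\mathcal{O}=\mathbb{Z}/2[[X,Y]][\varepsilon]/(\varepsilon^2)$. Then $W$ is an $\mathcal{O}$-module with $X$, $Y$, $\varepsilon$ acting by $T_7$, $T_{13}$ and $\lambda(T_7,T_{13})+T_5$ respectively, and $\mathcal{O}$ acts faithfully on $W$.
   Context: For an odd prime $p$, $T_p:\mathbb{Z}/2[[x]]\to\mathbb{Z}/2[[x]]$ is the map $\sum c_nx^n\mapsto\sum c_{pn}x^n+\sum c_nx^{pn}$; these operators commute. Let $D=\sum_{n>0,\ \gcd(n,6)=1}x^{n^2}\in\mathbb{Z}/2[[x]]$, and let $W$ be the $\mathbb{Z}/2$-span of the $D^k$ with $k>0$, $\gcd(k,6)=1$. The $T_p$ with $p>3$ map $W$ into $W$, and for $n>0$ with $\gcd(n,6)=1$, $T_7(D^n)$ and $T_{13}(D^n)$ are sums of $D^k$ with $k<n$; hence every $u\in\mathbb{Z}/2[[X,Y]]$ acts on $W$ by $u(T_7,T_{13})$. *)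

(* Defs.v *)
From HB Require Import structures.
From mathcomp Require Import all_boot all_order all_algebra.
From mathcomp Require Import boolp classical_sets functions cardinality fsbigop.

Set Implicit Arguments.
Unset Strict Implicit.
Unset Printing Implicit Defensive.

Import GRing.Theory.
Local Open Scope ring_scope.

Record fps (R : Type) := FPS { fcoef : nat -> R }.

HB.instance Definition _ (R : Type) := gen_eqMixin (fps R).
HB.instance Definition _ (R : Type) := gen_choiceMixin (fps R).

Lemma fpsP (R : Type) (f g : fps R) : fcoef f =1 fcoef g -> f = g.
Proof. by case: f g => [f] [g] /= /funext ->. Qed.

Section FpsZmodule.
Variable R : zmodType.
Implicit Types f g h : fps R.

Definition fps_zero : fps R := FPS (fun=> 0).
Definition fps_opp f : fps R := FPS (fun n => - fcoef f n).
Definition fps_add f g : fps R := FPS (fun n => fcoef f n + fcoef g n).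

Lemma fps_addA : associative fps_add.
Proof. by move=> f g h; apply: fpsP => n /=; rewrite addrA. Qed.
Lemma fps_addC : commutative fps_add.
Proof. by move=> f g; apply: fpsP => n /=; rewrite addrC. Qed.
Lemma fps_add0 : left_id fps_zero fps_add.
Proof. by move=> f; apply: fpsP => n /=; rewrite add0r. Qed.
Lemma fps_addN : left_inverse fps_zero fps_opp fps_add.
Proof. by move=> f; apply: fpsP => n /=; rewrite addNr. Qed.

HB.instance Definition _ :=
  GRing.isZmodule.Build (fps R) fps_addA fps_addC fps_add0 fps_addN.

End FpsZmodule.

Section FpsRing.
Variable R : comNzRingType.
Implicit Types (f g h : fps R) (a b : R).

Definition fpsC a : fps R := FPS (fun n => if n == 0 then a else 0).
Definition fpsX : fps R := FPS (fun n => (n == 1)%:R).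
Definition fps_mul f g : fps R :=
  FPS (fun n => \sum_(j < n.+1) fcoef f j * fcoef g (n - j)).

Lemma fps_mulC : commutative fps_mul.
Proof.
move=> f g; apply: fpsP => n /=; rewrite (reindex_inj rev_ord_inj) /=.
by apply: eq_bigr => j _; rewrite subSS subKn 1?mulrC // -ltnS.
Qed.

Lemma fps_mulA : associative fps_mul.
Proof.
pose t n f : {poly R} := \poly_(i < n.+1) fcoef f i.
have tM n m f g : (m <= n)%N -> fcoef (fps_mul f g) m = (t n f * t n g)`_m.
  move=> lemn; rewrite coefM; apply: eq_bigr => j _.
  have lejm : (j <= m)%N by rewrite -ltnS.
  by rewrite !coef_poly !ltnS (leq_trans lejm) ?(leq_trans (leq_subr _ _)).
have coefM_le n (p q p' q' : {poly R}) :
    (forall i, (i <= n)%N -> p`_i = p'`_i) ->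
    (forall i, (i <= n)%N -> q`_i = q'`_i) -> (p * q)`_n = (p' * q')`_n.
  move=> pp' qq'; rewrite !coefM; apply: eq_bigr => j _.
  have lejn : (j <= n)%N by rewrite -ltnS.
  by rewrite pp' // qq' // leq_subr.
move=> f g h; apply: fpsP => n; rewrite !(tM n) //.
transitivity ((t n f * (t n g * t n h))`_n); last rewrite mulrA.
  by apply: coefM_le => // i lein; rewrite coef_poly ltnS lein (tM n).
by apply: coefM_le => // i lein; rewrite coef_poly ltnS lein (tM n).
Qed.

Lemma fps_mul1 : left_id (fpsC 1) fps_mul.
Proof.
move=> f; apply: fpsP => n /=; rewrite big_ord_recl /= mul1r subn0.
by rewrite big1 ?addr0 // => j _; rewrite mul0r.
Qed.

Lemma fps_mulDl : left_distributive fps_mul +%R.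
Proof.
move=> f g h; apply: fpsP => n /=; rewrite -big_split /=.
by apply: eq_bigr => j _; rewrite mulrDl.
Qed.

Lemma fps_1neq0 : fpsC 1 != 0.
Proof.
apply/eqP => /(congr1 (fun f => fcoef f 0)) /= /eqP.
by rewrite oner_eq0.
Qed.

HB.instance Definition _ := GRing.Zmodule_isComNzRing.Build (fps R)
  fps_mulA fps_mulC fps_mul1 fps_mulDl fps_1neq0.

Definition fps_scale a f : fps R := FPS (fun n => a * fcoef f n).

Lemma fps_scaleA a b f : fps_scale a (fps_scale b f) = fps_scale (a * b) f.
Proof. by apply: fpsP => n /=; rewrite mulrA. Qed.
Lemma fps_scale1 : left_id 1 fps_scale.
Proof. by move=> f; apply: fpsP => n /=; rewrite mul1r. Qed.
Lemma fps_scaleDr : right_distributive fps_scale +%R.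
Proof. by move=> a f g; apply: fpsP => n /=; rewrite mulrDr. Qed.
Lemma fps_scaleDl f : {morph fps_scale^~ f : a b / a + b}.
Proof. by move=> a b; apply: fpsP => n /=; rewrite mulrDl. Qed.

HB.instance Definition _ := GRing.Zmodule_isLmodule.Build R (fps R)
  fps_scaleA fps_scale1 fps_scaleDr fps_scaleDl.

End FpsRing.

(* Z/2[[X,Y]] is built as Z/2[[X]][[Y]]. *)
Definition fps2 : comNzRingType := fps (fps 'F_2).
Definition serX : fps2 := fpsC (fpsX 'F_2).
Definition serY : fps2 := fpsX (fps 'F_2).
(* The coefficient of X^i Y^j. *)
Definition coefXY (u : fps2) (i j : nat) : 'F_2 := fcoef (fcoef u j) i.

Definition hecke (p : nat) (f : fps 'F_2) : fps 'F_2 :=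
  FPS (fun n =>
    fcoef f (p * n)%N + (if (p %| n)%N then fcoef f (n %/ p)%N else 0)).

Definition serD : fps 'F_2 :=
  FPS (fun m => [exists n : 'I_m.+1,
                   [&& (0 < n)%N, coprime n 6 & m == (n ^ 2)%N]]%:R).

Definition W_pred : {pred fps 'F_2} := fun f =>
  `[< exists2 s : seq ('F_2 * nat),
        all (fun ck => (0 < ck.2)%N && coprime ck.2 6) s
      & f = \sum_(ck <- s) ck.1 *: serD ^+ ck.2 >].

Lemma W_zmod_closed : zmod_closed W_pred.
Proof.
split=> [|f g].
  by apply/asboolP; exists [::]; rewrite ?big_nil.
move=> /asboolP[s sP ->] /asboolP[t tP ->]; apply/asboolP.
exists (s ++ [seq (- ck.1, ck.2) | ck <- t]).
  by rewrite all_cat sP all_map.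
rewrite big_cat big_map /= -sumrN; congr (_ + _).
by apply: eq_bigr => ck _; rewrite scaleNr.
Qed.

HB.instance Definition _ := GRing.isZmodClosed.Build (fps 'F_2) W_pred
  W_zmod_closed.

Record W : predArgType := MkW { W_val :> fps 'F_2; _ : W_val \in W_pred }.

HB.instance Definition _ := [isSub for W_val].
HB.instance Definition _ := [Choice of W by <:].
HB.instance Definition _ := [SubChoice_isSubZmodule of W by <:].

(* u(T_7, T_13) f = \sum_(i, j) u_ij T_7^i (T_13^j f).  For f in W all but
   finitely many terms vanish, since T_7 and T_13 commute and lower the degree
   in D; the finitely supported sum is 0 by convention when the support is
   infinite, which can only happen outside W. *)
Definition ser_act (u : fps2) (f : fps 'F_2) : fps 'F_2 :=
  \sum_(ij \in [set: nat * nat])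
    coefXY u ij.1 ij.2 *: iter ij.1 (hecke 7) (iter ij.2 (hecke 13) f).

Definition is_lambda (l : fps2) : Prop :=
  coefXY l 0 0 = 0 /\
  forall w : W, hecke 5 (hecke 5 w) = ser_act l (ser_act l w).

(* 'X^2 is monic of size 3, so this is fps2[e]/(e^2) and not the fallback
   quotient by 'X. *)
Definition O : comNzRingType := {poly %/ ('X^2 : {poly fps2})}.
Definition O_of_ser (u : fps2) : O := qpolyC 'X^2 u.
Definition eps : O := qpolyX 'X^2.

Definition W_module : Type := GRing.Zmodule_isLmodule O W.
Definition W_lmod (m : GRing.Zmodule_isLmodule O W) : lmodType O := HB.pack W m.
Definition W_scale (m : W_module) (a : O) (w : W) : W :=
  a *: (w : W_lmod m).

Definition faithful (R : pzRingType) (M : lmodType R) : Prop :=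
  forall a : R, (forall w : M, a *: w = 0) -> a = 0.

(* Main.v *)
Require Import Defs.
From mathcomp Require Import boolp fsbigop.
From mathcomp Require Import all_boot all_order all_algebra.
From mathcomp Require Import zify ring.

(** Let theta be the sum of the x^(n^2) over odd n > 0.  Multiplication by the
    sixth roots of unity pairs off the solutions of m^2 + 3 n^2 = N in odd m, n
    except those with m = n or m = 3n; hence theta theta(x^3) =
    theta^4 + theta(x^3)^4, and D = theta + theta(x^9) satisfies
    D^3 = theta(x^3).  For p = 5, 7, 13 there are a polynomial g and a series
    kappa such that theta g(kappa)^2 = kappa and theta(x^p) g(kappa)^2 = kappa^p:
    the candidate for theta(x^p) satisfies the same relation of level 3, which
    together with the leading term determines the series.  This gives an equation
    between D and D(x^p), so a linear recursion in n for T_p(D^n), whose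
    solution is explicit.

    For p = 7, 13 the coefficient of D^(6t'+1) in T_p(D^(6t+1)) is computed by a
    finite automaton reading the base 4 digits of t and t'.  Label D^(6t+1) by
    (i, j), the numbers formed by the even-indexed and the odd-indexed binary
    digits of t, and order the labels by (i + j, j).  A certificate computed on the
    automaton shows that T_7 and T_13 have leading terms (i - 1, j) and
    (i, j - 1).  Hence T_7^i T_13^j sends D^(6t+1) to D and kills all smaller basis
    vectors, so that the span W_a of the D^(6t+1) is a dual of Z/2[[X,Y]].

    T_5 exchanges W_a with the span W_b of the D^(6t+5), and is unitriangular from
    W_b to W_a.  On W_a the operator T_5^2 is a power series in T_7 and T_13; as
    T_p^2 respects the exponents modulo 24 for p = 5, 7, 13, this series can be
    solved for in X^2 and Y^2, which makes it a square over Z/2.  Finally, if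
    a + b eps kills W, then so does u + b T_5 with u = a + b lambda; the W_a
    component on W_a gives u = 0, and T_5(W_b) = W_a gives b = 0. *)

Set Implicit Arguments.
Unset Strict Implicit.
Unset Printing Implicit Defensive.

Import Order.TTheory GRing.Theory Num.Theory.
Local Open Scope ring_scope.

(** * Power series *)

Section Coefficients.
Variable R : comNzRingType.
Implicit Types (f g : fps R) (n : nat).

Lemma fcoef0 n : fcoef (0 : fps R) n = 0. Proof. by []. Qed.
Lemma fcoefD f g n : fcoef (f + g) n = fcoef f n + fcoef g n. Proof. by []. Qed.
Lemma fcoefB f g n : fcoef (f - g) n = fcoef f n - fcoef g n. Proof. by []. Qed.
Lemma fcoefZ a f n : fcoef (a *: f) n = a * fcoef f n. Proof. by []. Qed.

Lemma fcoef1 n : fcoef (1 : fps R) n = (n == 0)%:R.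
Proof. by rewrite -[fcoef _ _]/(if n == 0 then 1 else 0); case: eqP. Qed.

Lemma fcoefM f g n :
  fcoef (f * g) n = \sum_(j < n.+1) fcoef f j * fcoef g (n - j).
Proof. by []. Qed.

Lemma fcoef0M f g : fcoef (f * g) 0 = fcoef f 0 * fcoef g 0.
Proof. by rewrite fcoefM big_ord_recl big_ord0 addr0. Qed.

Lemma fps_scaleAr a f g : a *: (f * g) = f * (a *: g).
Proof.
apply: fpsP => n; rewrite fcoefZ !fcoefM mulr_sumr; apply: eq_bigr => j _.
by rewrite fcoefZ mulrCA.
Qed.

Lemma fcoef0X f n : fcoef (f ^+ n) 0 = fcoef f 0 ^+ n.
Proof. by elim: n => [|n IH]; rewrite ?fcoef1 // !exprS fcoef0M IH. Qed.

Lemma fcoef_sum I (r : seq I) (P : pred I) (F : I -> fps R) n :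
  fcoef (\sum_(i <- r | P i) F i) n = \sum_(i <- r | P i) fcoef (F i) n.
Proof. by elim/big_rec2: _ => // i x y _ <-. Qed.

Definition eqmod n f g := forall i, (i < n)%N -> fcoef f i = fcoef g i.

Lemma eqmod_refl n f : eqmod n f f. Proof. by []. Qed.

Lemma eqmodD n f g f' g' :
  eqmod n f f' -> eqmod n g g' -> eqmod n (f + g) (f' + g').
Proof. by move=> e e' i lin; rewrite !fcoefD e ?e'. Qed.

Lemma eqmodM n f g f' g' :
  eqmod n f f' -> eqmod n g g' -> eqmod n (f * g) (f' * g').
Proof.
move=> e e' i lin; rewrite !fcoefM; apply: eq_bigr => j _.
have leji : (j <= i)%N by rewrite -ltnS.
by rewrite e ?e' ?(leq_ltn_trans _ lin) ?leq_subr.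
Qed.

Lemma eqmodX n f g k : eqmod n f g -> eqmod n (f ^+ k) (g ^+ k).
Proof. by move=> e; elim: k => // k IH; rewrite !exprS; apply: eqmodM. Qed.

Lemma eqmodMS n f g h : fcoef h 0 = 0 ->
  eqmod n f g -> eqmod n.+1 (h * f) (h * g).
Proof.
move=> h0 e i; rewrite ltnS => lin; rewrite !fcoefM !big_ord_recl h0 !mul0r.
congr (_ + _); apply: eq_bigr => j _; rewrite e // /bump /= subnS.
by have := ltn_ord j; move: lin; lia.
Qed.

(** A contraction for the x-adic topology: the n-th iterate of 0 has settled its first n
    coefficients, and the diagonal of the iterates is the limit. *)
Lemma fps_fixpoint (Psi : fps R -> fps R) :
  (forall n f g, eqmod n f g -> eqmod n.+1 (Psi f) (Psi g)) ->
  exists f, Psi f = f.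
Proof.
move=> ctr; pose it n := iter n Psi 0.
have stable n k : eqmod n (it n) (it (n + k)%N).
  elim: n => // n IH; exact: ctr.
exists (FPS (fun n => fcoef (it n.+1) n)); apply: fpsP => n.
suff e m : eqmod m (FPS (fun n => fcoef (it n.+1) n)) (it m).
  by rewrite (ctr n _ _ (e n) n (ltnSn n)).
by move=> i lim /=; have := stable i.+1 (m - i.+1)%N; rewrite subnKC // => ->.
Qed.

(** The inverse is the fixed point of g = 1 + (1 - f) g. *)
Lemma fps_unit f : fcoef f 0 = 1 -> exists2 g, f * g = 1 & fcoef g 0 = 1.
Proof.
move=> f1; have [n g g' e|g ge] := @fps_fixpoint (fun g => 1 + (1 - f) * g).
  by apply: eqmodD => //; apply: eqmodMS => //; rewrite fcoefB fcoef1 f1 subrr.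
exists g; last by rewrite -ge fcoefD fcoef0M fcoefB f1 fcoef1 subrr mul0r addr0.
by move: ge; rewrite mulrBl mul1r addrCA -[RHS]addr0 => /addrI/eqP;
   rewrite subr_eq0 => /eqP.
Qed.

Lemma fcoefXM f n : fcoef (fpsX R * f) n = if n is n'.+1 then fcoef f n' else 0.
Proof.
case: n => [|n]; first by rewrite fcoef0M mul0r.
rewrite fcoefM 2!big_ord_recl /= mul0r add0r mul1r subSS subn0 big1 ?addr0 //.
by move=> i _; rewrite mul0r.
Qed.

Lemma fps_shift f : fcoef f 0 = 0 -> f = fpsX R * FPS (fun n => fcoef f n.+1).
Proof. by move=> f0; apply: fpsP => -[|n]; rewrite fcoefXM. Qed.

Lemma fps_lead f : f != 0 ->
  exists2 v, fcoef f v != 0 & forall i, (i < v)%N -> fcoef f i = 0.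
Proof.
move=> f_neq0; have ex : exists v, fcoef f v != 0.
  apply: contrapT => nex; case/eqP: f_neq0; apply: fpsP => n.
  by apply: contrapT => /eqP fn; apply: nex; exists n.
case: (ex_minnP ex) => w fw wmin; exists w => // i liw.
by apply/eqP; apply: contraLR liw => /wmin; rewrite -leqNgt.
Qed.

Lemma fcoefM_lead f g v w :
    (forall i, (i < v)%N -> fcoef f i = 0) ->
    (forall i, (i < w)%N -> fcoef g i = 0) ->
  (forall i, (i < v + w)%N -> fcoef (f * g) i = 0) /\
  fcoef (f * g) (v + w) = fcoef f v * fcoef g w.
Proof.
move=> fv gw; split=> [i li|].
  rewrite fcoefM big1 // => j _; case: (ltnP j v) => [/fv->|lvj].
    by rewrite mul0r.
  by rewrite gw ?mulr0 //; have := ltn_ord j; lia.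
have lv : (v < (v + w).+1)%N by lia.
rewrite fcoefM (bigD1 (Ordinal lv)) //= addKn big1 ?addr0 // => j jv.
have {jv} : (j != v :> nat) by [].
case: (ltnP j v) => [/fv->|lvj nev]; first by rewrite mul0r.
by rewrite gw ?mulr0 //; have := ltn_ord j; lia.
Qed.

End Coefficients.

Section Domain.
Variable R : idomainType.
Implicit Types f g h : fps R.

Lemma fps_mulf_eq0 f g : f * g = 0 -> f = 0 \/ g = 0.
Proof.
move=> fg0; case: (eqVneq f 0) => [|/fps_lead[v fv vmin]]; first by left.
case: (eqVneq g 0) => [|/fps_lead[w gw wmin]]; first by right.
have [_] := fcoefM_lead vmin wmin; rewrite fg0 fcoef0 => /esym/eqP.
by rewrite mulf_eq0 (negPf fv) (negPf gw).
Qed.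

Lemma fps_mulI f g h : f != 0 -> f * g = f * h -> g = h.
Proof.
move=> /eqP f0 /eqP; rewrite -subr_eq0 -mulrBr => /eqP/fps_mulf_eq0[//|/eqP].
by rewrite subr_eq0 => /eqP.
Qed.

Lemma fps_mul_neq0 f g : f != 0 -> g != 0 -> f * g != 0.
Proof. by move=> /eqP f0 /eqP g0; apply/eqP => /fps_mulf_eq0[]. Qed.

Lemma fps_exp_neq0 f n : f != 0 -> f ^+ n != 0.
Proof.
by move=> f0; elim: n => [|n IH]; rewrite ?oner_neq0 // exprS fps_mul_neq0.
Qed.

End Domain.

Section Char2.
Variable R : comNzRingType.
Hypothesis R2 : 2%N \in [pchar R].
Implicit Types f g : fps R.

Lemma fps_pchar2 : 2%N \in [pchar fps R].
Proof.
rewrite inE /=; apply/eqP; apply: fpsP => n.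
by rewrite mulr2n fcoefD -mulr2n -mulr_natl (pcharf0 R2) mul0r.
Qed.

(** The n-th coefficient depends only on the truncation at degree n, where the Frobenius morphism of
    polynomials applies. *)
Lemma fcoef_sqr f n :
  fcoef (f ^+ 2) n = if odd n then 0 else fcoef f n./2 ^+ 2.
Proof.
pose p : {poly R} := \poly_(i < n.+1) fcoef f i.
have P2 : 2%N \in [pchar {poly R}] by rewrite pchar_poly.
have -> : fcoef (f ^+ 2) n = (p ^+ 2)`_n.
  rewrite !expr2 fcoefM coefM; apply: eq_bigr => j _.
  by rewrite !coef_poly ltn_ord ltnS leq_subr.
have -> : p ^+ 2 = \sum_(i < n.+1) (fcoef f i ^+ 2) *: 'X^(2 * i).
  rewrite /p poly_def -(pFrobenius_autE P2) rmorph_sum /=; apply: eq_bigr => i _.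
  by rewrite pFrobenius_autE exprZn -exprM mulnC.
rewrite coef_sum; under eq_bigr do rewrite coefZ coefXn.
case: ifP => [odn|/negbT evn].
  apply: big1 => i _; rewrite [n == _](_ : _ = false) ?mulr0 //.
  by apply/negbTE; apply: contraTneq odn => ->; rewrite oddM.
have ln : (n./2 < n.+1)%N by lia.
rewrite (bigD1 (Ordinal ln)) //= big1 ?addr0 => [|i ni].
  by rewrite [_ == _](_ : _ = true) ?mulr1 //; apply/eqP; lia.
rewrite [n == _](_ : _ = false) ?mulr0 //.
apply/negbTE; apply: contraNneq ni => e; apply/eqP/val_inj => /=; lia.
Qed.

End Char2.

Arguments eqmod {R} n f g.

(** * The substitution of x^p for x and the operator U_p *)

Section Substitution.
Variable R : comNzRingType.
Implicit Types (f g : fps R) (p n : nat).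

(** This is f(x^p), and [fsec p] is the operator U_p; T_p is their sum. *)
Definition fsub p f : fps R :=
  FPS (fun n => if (p %| n)%N then fcoef f (n %/ p) else 0).
Definition fsec p f : fps R := FPS (fun n => fcoef f (p * n)).

Lemma sum_dvdn (V : nmodType) p n (G : nat -> V) : (0 < p)%N ->
  \sum_(j < n.+1) (if (p %| j)%N then G (j %/ p)%N else 0) =
  \sum_(i < (n %/ p).+1) G i.
Proof.
move=> p0; elim: n => [|n IH]; first by rewrite div0n !big_ord1 dvdn0 div0n.
rewrite big_ord_recr IH /= divnS //.
case: ifP => dvd; last by rewrite addr0.
by rewrite dvd [RHS]big_ord_recr.
Qed.

Lemma fcoef_fsubM p f g n : (0 < p)%N ->
  fcoef (fsub p g * f) n =
  \sum_(i < (n %/ p).+1) fcoef g i * fcoef f (n - p * i).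
Proof.
move=> p0; rewrite -(sum_dvdn _ (fun i => fcoef g i * fcoef f (n - p * i))) //.
rewrite fcoefM; apply: eq_bigr => j _ /=.
by case: ifP => [/divnK e|_]; rewrite ?mul0r // mulnC e.
Qed.

(** U_p is linear over the series in x^p; this turns an equation between D and D(x^p) into a
    recursion for U_p(D^n). *)
Lemma fsec_fsubM p f g : (0 < p)%N -> fsec p (fsub p g * f) = g * fsec p f.
Proof.
move=> p0; apply: fpsP => n.
rewrite -[LHS]/(fcoef (fsub p g * f) (p * n)) fcoef_fsubM // mulKn //.
by rewrite fcoefM; apply: eq_bigr => i _ /=; rewrite mulnBr.
Qed.

Lemma fsubM p f g : (0 < p)%N -> fsub p (f * g) = fsub p f * fsub p g.
Proof.
move=> p0; apply: fpsP => n; rewrite fcoef_fsubM //=.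
have dvdB (i : 'I_(n %/ p).+1) : (p %| n - p * i)%N = (p %| n)%N.
  rewrite dvdn_subl ?dvdn_mulr //.
  by have := ltn_ord i; rewrite ltnS leq_divRL // mulnC.
under [RHS]eq_bigr do rewrite dvdB.
case: ifP => [/dvdnP[m ->]|_]; last by rewrite big1 // => i _; rewrite mulr0.
rewrite mulnK //; apply: eq_bigr => i _.
by rewrite [(m * p)%N]mulnC -mulnBr mulKn.
Qed.

Lemma fsubD p f g : fsub p (f + g) = fsub p f + fsub p g.
Proof. by apply: fpsP => n /=; case: ifP; rewrite ?addr0. Qed.

Lemma fsub1 p : (0 < p)%N -> fsub p 1 = 1.
Proof.
move=> p0; apply: fpsP => n; rewrite fcoef1.
rewrite -[LHS]/(if (p %| n)%N then fcoef 1 (n %/ p) else 0) fcoef1.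
have [/dvdnP[m ->]|ndvd] := boolP (p %| n)%N.
  by rewrite mulnK // muln_eq0 (gtn_eqF p0) orbF.
by case: eqP ndvd => // ->; rewrite dvdn0.
Qed.

Lemma fsubX p f k : (0 < p)%N -> fsub p (f ^+ k) = fsub p f ^+ k.
Proof.
by move=> p0; elim: k => [|k IH]; rewrite ?fsub1 // !exprS fsubM // IH.
Qed.

Lemma fsub_fsub p q f : (0 < p)%N -> fsub p (fsub q f) = fsub (p * q) f.
Proof.
move=> p0; apply: fpsP => n /=.
have [/dvdnP[m ->]|npn] := boolP (p %| n)%N.
  by rewrite mulnK // [(m * p)%N]mulnC dvdn_pmul2l // divnMl.
by rewrite ifN //; apply: contra npn; apply: dvdn_trans; apply: dvdn_mulr.
Qed.

Lemma fsubC p q f : (0 < p)%N -> (0 < q)%N -> fsub p (fsub q f) = fsub q (fsub p f).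
Proof. by move=> p0 q0; rewrite !fsub_fsub // mulnC. Qed.

Lemma fcoef_fsub0 p f : fcoef (fsub p f) 0 = fcoef f 0.
Proof. by rewrite /= dvdn0 div0n. Qed.

Lemma fcoef_fsub_mul p f n : (0 < p)%N -> fcoef (fsub p f) (p * n) = fcoef f n.
Proof. by move=> p0; rewrite /= dvdn_mulr // mulKn. Qed.

End Substitution.

(** * Power series over Z/2 *)

Notation ser := (fps 'F_2).

Lemma pchar_F2 : 2%N \in [pchar 'F_2]. Proof. exact: pchar_Fp. Qed.

Lemma F2_pchar : 2%N \in [pchar ser].
Proof. exact: fps_pchar2 pchar_F2. Qed.

Lemma F2_cases (a : 'F_2) : a = 0 \/ a = 1.
Proof.
by case: a => [[|[|k]] lk] //; [left|right]; apply: val_inj.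
Qed.

Lemma F2_sqr (a : 'F_2) : a ^+ 2 = a.
Proof. by case: (F2_cases a) => ->; rewrite ?expr0n ?expr1n. Qed.

Lemma serDD (f : ser) : f + f = 0. Proof. exact: addrr_pchar2 F2_pchar f. Qed.
Lemma serN (f : ser) : - f = f. Proof. exact: oppr_pchar2 F2_pchar f. Qed.

Lemma ser_eqD (f g : ser) : f + g = 0 -> f = g.
Proof. by move/eqP; rewrite addr_eq0 serN => /eqP. Qed.

Lemma ser_sqrE (f : ser) : f ^+ 2 = fsub 2 f.
Proof.
apply: fpsP => n; rewrite (fcoef_sqr pchar_F2) /= dvdn2 F2_sqr -divn2.
by case: odd.
Qed.

Lemma ser_sqrD (f g : ser) : (f + g) ^+ 2 = f ^+ 2 + g ^+ 2.
Proof. by rewrite !ser_sqrE fsubD. Qed.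

Lemma ser_exp4E (f : ser) : f ^+ 4 = fsub 4 f.
Proof. by rewrite (exprM f 2 2) !ser_sqrE fsub_fsub. Qed.

Lemma ser_exp4D (f g : ser) : (f + g) ^+ 4 = f ^+ 4 + g ^+ 4.
Proof. by rewrite !ser_exp4E fsubD. Qed.

Lemma char2_cubeD (R : comNzRingType) (x y : R) : 2%N \in [pchar R] ->
  x ^+ 3 = y ^+ 3 -> (x + y) * (x ^+ 2 + x * y + y ^+ 2) = 0.
Proof.
move=> R2 e; have -> : (x + y) * (x ^+ 2 + x * y + y ^+ 2) = x ^+ 3 + y ^+ 3 +
    (x ^+ 2 * y + x ^+ 2 * y) + (x * y ^+ 2 + x * y ^+ 2) by ring.
by rewrite e !(addrr_pchar2 R2) ?addr0.
Qed.

(** Z/2 has no primitive cube root of unity: the form a^2 + a b + b^2 is anisotropic over Z/2, so if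
    it vanishes at (f, g), comparing coefficients of x^(2n) kills the n-th coefficients of f and g
    one after the other. *)
Lemma ser_cube_inj (f g : ser) : f ^+ 3 = g ^+ 3 -> f = g.
Proof.
move=> e; apply: ser_eqD.
have /fps_mulf_eq0[//|e2] := char2_cubeD F2_pchar e.
have e0 n : (forall i, (i < n)%N -> fcoef f i = 0 /\ fcoef g i = 0) ->
    fcoef f n = 0 /\ fcoef g n = 0.
  move=> IH; have f0 i : (i < n)%N -> fcoef f i = 0 by move=> /IH[].
  have g0 i : (i < n)%N -> fcoef g i = 0 by move=> /IH[].
  have : fcoef (f ^+ 2 + f * g + g ^+ 2) (n + n) = 0 by rewrite e2.
  rewrite !expr2 !fcoefD.
  rewrite (fcoefM_lead f0 f0).2 (fcoefM_lead f0 g0).2 (fcoefM_lead g0 g0).2.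
  by case: (F2_cases (fcoef f n)) => ->; case: (F2_cases (fcoef g n)) => ->.
suff z n : fcoef f n = 0 /\ fcoef g n = 0.
  by apply: fpsP => n; rewrite fcoefD fcoef0; case: (z n) => -> ->; rewrite addr0.
by elim/ltn_ind: n => n; apply: e0.
Qed.

Lemma heckeE p (f : ser) : hecke p f = fsec p f + fsub p f.
Proof. by []. Qed.

Lemma heckeD p (f g : ser) : hecke p (f + g) = hecke p f + hecke p g.
Proof.
by apply: fpsP => n /=; case: ifP => _ //=; rewrite ?addr0 // addrACA.
Qed.

Lemma hecke0 p : hecke p 0 = 0.
Proof. by apply: fpsP => n /=; rewrite if_same addr0. Qed.

Lemma hecke_sum p I (r : seq I) (P : pred I) (F : I -> ser) :
  hecke p (\sum_(i <- r | P i) F i) = \sum_(i <- r | P i) hecke p (F i).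
Proof.
by elim/big_rec2: _ => [|i x y _ <-]; rewrite ?hecke0 ?heckeD.
Qed.

Lemma hecke_sqr p (f : ser) : odd p -> hecke p (f ^+ 2) = hecke p f ^+ 2.
Proof.
move=> podd; rewrite !heckeE ser_sqrD; congr (_ + _).
  apply: fpsP => n; rewrite -[LHS]/(fcoef (f ^+ 2) (p * n)).
  rewrite !(fcoef_sqr pchar_F2) oddM podd andTb.
  have [//|evn] := boolP (odd n); congr (fcoef _ _ ^+ 2).
  by move: (odd_double_half n); rewrite (negPf evn) => <-; rewrite -doubleMr !doubleK.
have p0 : (0 < p)%N by case: p podd.
by rewrite fsubX.
Qed.

Lemma heckeC p q (f : ser) : prime p -> prime q -> p != q ->
  hecke p (hecke q f) = hecke q (hecke p f).
Proof.
move=> p_pr q_pr npq; apply: fpsP => n /=.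
have cpq : coprime p q by rewrite prime_coprime // dvdn_prime2.
have p0 := prime_gt0 p_pr; have q0 := prime_gt0 q_pr.
rewrite (Gauss_dvdr n cpq) [(q %| p * n)%N]Gauss_dvdr 1?coprime_sym //.
have dvd_div a b : coprime a b -> (a %| n)%N -> (b %| n %/ a)%N = (b %| n)%N.
  by move=> cab /divnK {2}<-; rewrite Gauss_dvdl // coprime_sym.
have [pn|npn] := boolP (p %| n)%N; have [qn|nqn] := boolP (q %| n)%N.
- rewrite !dvd_div // 1?coprime_sym // pn qn !muln_divA // -!divnMA.
  by rewrite [(q * (p * n))%N]mulnCA [(q * p)%N]mulnC addrACA.
- by rewrite dvd_div // (negPf nqn) !addr0 muln_divA // mulnCA.
- by rewrite dvd_div // 1?coprime_sym // (negPf npn) !addr0 muln_divA // mulnCA.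
- by rewrite !addr0 mulnCA.
Qed.

(** * Theta series *)

Definition sqseries (P : pred nat) : ser := FPS (fun m =>
  [exists n : 'I_m.+1, P n && (m == n ^ 2)%N]%:R).

Definition theta : ser := sqseries odd.

Lemma sum_bool_uniq K (P : pred nat) :
    (forall m n, (m < K)%N -> (n < K)%N -> P m -> P n -> m = n) ->
  \sum_(n < K) (P n)%:R = [exists n : 'I_K, P n]%:R :> 'F_2.
Proof.
move=> uniqP; case: existsP => [[n Pn]|nex]; last first.
  by apply: big1 => n _; rewrite (_ : P n = false) //; apply/negP => Pn; apply: nex; exists n.
rewrite (bigD1 n) //= Pn big1 ?addr0 // => m nemn.
rewrite (_ : P m = false) //; apply/negP => Pm.
case/eqP: nemn; apply: val_inj; exact: uniqP (ltn_ord m) (ltn_ord n) Pm Pn.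
Qed.

(** The range K is free, so that both factors of a product can be summed over one common box of
    pairs. *)
Lemma fcoef_sqseries_sub P k K i : (0 < k)%N -> (i < K)%N ->
  fcoef (fsub k (sqseries P)) i = \sum_(n < K) (P n && (i == k * n ^ 2)%N)%:R.
Proof.
move=> k0 liK; rewrite (@sum_bool_uniq K (fun n => P n && (i == k * n ^ 2)%N)) /=;
  last first.
  move=> m n _ _ /andP[_ /eqP->] /andP[_]; rewrite eqn_pmul2l // eqn_exp2r //.
  by move/eqP.
case: ifP => [/dvdnP[j def_i]|ndvd]; last first.
  case: existsP => // -[n /andP[_ /eqP def_i]].
  by move: ndvd; rewrite def_i dvdn_mulr.
have lji : (j <= i)%N by rewrite def_i leq_pmulr.
rewrite def_i mulnK //; congr (nat_of_bool _)%:R; apply/existsP/existsP.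
  move=> [n /andP[on /eqP def_j]].
  have lnK : (n < K)%N by have := ltn_ord n; lia.
  by exists (Ordinal lnK); rewrite /= on [in (j * _)%N]def_j mulnC eqxx.
move=> [n /andP[on]]; rewrite mulnC eqn_pmul2l // => /eqP def_j.
have lnj : (n < j.+1)%N by rewrite def_j ltnS; have := @leq_pexp2l; nia.
by exists (Ordinal lnj); rewrite /= on def_j eqxx.
Qed.

Lemma sum_involution (T : finType) (P : pred T) (f : T -> T) :
    (forall x, P x -> P (f x)) -> (forall x, P x -> f (f x) = x) ->
  \sum_(x | P x) 1 = \sum_(x | P x && (f x == x)) 1 :> 'F_2.
Proof.
move=> Pf fK; rewrite (bigID (fun x => f x == x)) /= -[RHS]addr0; congr (_ + _).
(* [lo] selects one element of each orbit of size two, so the moved points split into two halves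
   that cancel. *)
pose lo x := (enum_rank x < enum_rank (f x))%N.
rewrite (bigID lo) /=.
rewrite [X in _ + X](reindex_onto f f) => [|x /andP[/andP[/fK]]] //=.
rewrite [X in _ + X](eq_bigl (fun x => (P x && (f x != x)) && lo x)); last first.
  move=> x; apply/idP/idP => [/andP[/andP[/andP[Pfx ne] nlo] /eqP fxK]|].
    have Px : P x by rewrite -fxK Pf.
    have {}ne : f x != x by rewrite eq_sym -[X in X != _]fxK.
    rewrite Px ne; move: nlo; rewrite /lo fxK -leqNgt leq_eqVlt => /orP[|//].
    by move=> /eqP/ord_inj/enum_rank_inj e; rewrite -e eqxx in ne.
  move=> /andP[/andP[Px ne] lox]; rewrite fK // eqxx Pf // eq_sym ne /lo fK //=.
  by rewrite andbT -leqNgt ltnW.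
exact: addrr_pchar2 pchar_F2 _.
Qed.

(* Of (m + n sqrt(-3)) (1 + sqrt(-3)) / 2 and (m + n sqrt(-3)) (1 - sqrt(-3)) / 2
   exactly one has odd components; [rot3] gives their absolute values. *)
Definition rot3 (x : nat * nat) : nat * nat :=
  let: (m, n) := x in
  if (m == n %[mod 4])%N then (((3 * n - m) + (m - 3 * n)) %/ 2, (m + n) %/ 2)%N
  else ((3 * n + m) %/ 2, ((m - n) + (n - m)) %/ 2)%N.

Definition form3 N (x : nat * nat) :=
  [&& odd x.1, odd x.2 & (x.1 ^ 2 + 3 * x.2 ^ 2 == N)%N].

(** Each absolute value becomes a choice between two linear equations, and the congruence modulo 4
    gives the parities; the later lemmas on [rot3] are then linear arithmetic. *)
Lemma rot3P m n a b : odd m -> odd n -> rot3 (m, n) = (a, b) ->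
  [/\ odd a, odd b &
    if (m == n %[mod 4])%N
    then (2 * b = m + n)%N /\ ((2 * a + m = 3 * n)%N \/ (2 * a + 3 * n = m)%N)
    else (2 * a = 3 * n + m)%N /\ ((2 * b + n = m)%N \/ (2 * b + m = n)%N)].
Proof.
rewrite /rot3 => om on; case: ifP => mod4 [<- <-].
  by split; lia.
by split; lia.
Qed.

Lemma rot3_form N x : form3 N x -> form3 N (rot3 x).
Proof.
case: x => m n /and3P[om on /eqP def_N]; rewrite -{}def_N; rewrite /= in om on.
case def_ab: (rot3 (m, n)) => [a b].
have [oa ob abE] := rot3P om on def_ab; rewrite /form3 /= oa ob /=.
(* The norm m^2 + 3 n^2 is invariant under the sixth roots of unity; over the integers one identity
   covers the four sign patterns. *)
have sq (x y z t : int) : x = y + y + y - z - z -> t = y + y - z ->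
  x * x + y * y + y * y + y * y = z * z + t * t + t * t + t * t by move=> -> ->; ring.
rewrite -!mulnn; apply/eqP.
case: ifP abE => _ [e [] e'].
- have := sq a%:Z b%:Z m%:Z n%:Z ltac:(lia) ltac:(lia); lia.
- have := sq (- a%:Z) b%:Z m%:Z n%:Z ltac:(lia) ltac:(lia); lia.
- have := sq (- a%:Z) b%:Z m%:Z (- n%:Z) ltac:(lia) ltac:(lia); lia.
- have := sq a%:Z b%:Z (- m%:Z) n%:Z ltac:(lia) ltac:(lia); lia.
Qed.

Lemma rot3K N x : form3 N x -> rot3 (rot3 x) = x.
Proof.
case: x => m n /and3P[om on _]; rewrite /= in om on.
case def_ab: (rot3 (m, n)) => [a b].
have [oa ob abE] := rot3P om on def_ab.
case def_cd: (rot3 (a, b)) => [c d].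
have [oc od cdE] := rot3P oa ob def_cd.
suff [-> ->] : c = m /\ d = n by [].
by move: abE cdE; case: ifP => mn; case: ifP => ab; lia.
Qed.

Lemma rot3_fix N x : form3 N x ->
  (rot3 x == x) = (x.1 == x.2) || (x.1 == 3 * x.2)%N.
Proof.
case: x => m n /and3P[om on _]; rewrite /= in om on.
case def_ab: (rot3 (m, n)) => [a b].
have [oa ob abE] := rot3P om on def_ab.
apply/eqP/orP => [[ea eb]|[]/eqP /= eq_mn]; move: abE; case: ifP => mn abE;
  try (congr (_, _)); rewrite /=; lia.
Qed.

Lemma fsub_1 (R : comNzRingType) (f : fps R) : fsub 1 f = f.
Proof. by apply: fpsP => n; rewrite /= dvd1n divn1. Qed.

Lemma natrF2_and (a b : bool) : (a && b)%:R = a%:R * b%:R :> 'F_2.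
Proof. by case: a; rewrite ?mul1r ?mul0r. Qed.

Lemma fcoef_theta3 N :
  fcoef (theta * fsub 3 theta) N =
  \sum_(x : 'I_N.+1 * 'I_N.+1 | form3 N (nat_of_ord x.1, nat_of_ord x.2)) 1.
Proof.
rewrite fcoefM -[X in fcoef X]fsub_1.
under eq_bigr => j _.
  rewrite (@fcoef_sqseries_sub odd 1 N.+1) ?ltn_ord //.
  rewrite (@fcoef_sqseries_sub odd 3 N.+1) ?ltnS ?leq_subr //.
  rewrite big_distrlr /= pair_big /=.
  over.
rewrite exchange_big [RHS]big_mkcond /=; apply: eq_bigr => -[m n] _ /=.
under eq_bigr do rewrite -natrF2_and.
pose P m n j := (odd m && (j == 1 * m ^ 2) && (odd n && (N - j == 3 * n ^ 2)))%N.
rewrite (@sum_bool_uniq N.+1 (P m n)) => [|i j _ _]; last first.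
  by move=> /andP[/andP[_ /eqP->] _] /andP[/andP[_ /eqP->]].
rewrite -[RHS]mulrb; congr (nat_of_bool _)%:R; rewrite /P /form3 /=.
apply/existsP/and3P => [[j]|[om on /eqP def_N]].
  have := ltn_ord j; rewrite ltnS mul1n => lej.
  move=> /andP[/andP[-> /eqP def_j] /andP[-> /eqP def_Nj]]; split=> //.
  by rewrite -def_j -def_Nj subnKC.
have lmN : (m ^ 2 < N.+1)%N by rewrite ltnS -[leqRHS]def_N leq_addr.
by exists (Ordinal lmN); rewrite /= om on mul1n -[X in (X - m ^ 2)%N]def_N addKn !eqxx.
Qed.

(** The solutions on the curve m = f(n) are parametrised by the odd n with N = k n^2. *)
Lemma sum_form3_diag k N (f : nat -> nat) :
    (forall n, odd (f n) = odd n) -> (forall n, n <= k * n ^ 2 /\ f n <= k * n ^ 2)%N ->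
    (forall n, f n ^ 2 + 3 * n ^ 2 = k * n ^ 2)%N ->
  \sum_(x : 'I_N.+1 * 'I_N.+1 | form3 N (nat_of_ord x.1, nat_of_ord x.2) &&
      (x.1 == f x.2 :> nat)) 1 = fcoef (fsub k theta) N.
Proof.
move=> odf lef ef; have k0 : (0 < k)%N by have := ef 1%N; lia.
rewrite (fcoef_sqseries_sub _ k0 (ltnSn N)).
rewrite (reindex_onto (fun n : 'I_N.+1 => (inord (f n), n)) snd) /=; last first.
  move=> [m n] /andP[/and3P[_ _ /eqP def_N] /eqP /= e]; congr (_, _).
  by apply: val_inj; rewrite /= -e inordK.
rewrite big_mkcond; apply: eq_bigr => n _ /=; rewrite eqxx andbT -mulrb.
congr (nat_of_bool _)%:R; rewrite /form3 /=.
have [lfN|lfN] := ltnP (f n) N.+1.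
  by rewrite inordK // eqxx andbT odf ef andbA andbb [RHS]andbC andbC eq_sym.
have -> : (N == k * n ^ 2)%N = false by have [_] := lef n; lia.
rewrite andbF; apply/negbTE; apply: contraL (ltn_ord (inord (f n) : 'I_N.+1)).
by move=> /andP[_ /eqP->]; rewrite -leqNgt.
Qed.

(* The solutions fixed by the involution are m = n, where N = 4 n^2, and
   m = 3 n, where N = 12 n^2; they give the two fourth powers. *)
Lemma theta_modular3 :
  theta * fsub 3 theta = theta ^+ 4 + (fsub 3 theta) ^+ 4.
Proof.
apply: fpsP => N; rewrite fcoefD !ser_exp4E fsub_fsub // fcoef_theta3.
(* [inord] is harmless here: the solutions of m^2 + 3 n^2 = N stay in the box. *)
pose f (x : 'I_N.+1 * 'I_N.+1) : 'I_N.+1 * 'I_N.+1 :=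
  let y := rot3 (nat_of_ord x.1, nat_of_ord x.2) in (inord y.1, inord y.2).
have fE x : form3 N (nat_of_ord x.1, nat_of_ord x.2) ->
    (nat_of_ord (f x).1, nat_of_ord (f x).2) =
      rot3 (nat_of_ord x.1, nat_of_ord x.2).
  move=> /rot3_form; rewrite /f; case: rot3 => a b /and3P[_ _ /eqP /= def_N].
  by rewrite !inordK // ltnS; nia.
have pairI (x y : 'I_N.+1 * 'I_N.+1) :
    (nat_of_ord x.1, nat_of_ord x.2) = (nat_of_ord y.1, nat_of_ord y.2) -> x = y.
  by case: x y => [a b] [c d] [] /ord_inj -> /ord_inj ->.
rewrite (@sum_involution _ _ f) => [|x Nx|x Nx]; last 2 first.
- by rewrite fE // rot3_form.
- apply: pairI; rewrite !fE ?(rot3K Nx) //; exact: rot3_form.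
rewrite (eq_bigl (fun x : 'I_N.+1 * 'I_N.+1 =>
    form3 N (nat_of_ord x.1, nat_of_ord x.2) &&
      ((x.1 == x.2 :> nat) || (x.1 == 3 * x.2 :> nat)%N))); last first.
  move=> x; apply: andb_id2l => Nx; rewrite -(rot3_fix Nx) -fE //.
rewrite (bigID (fun x : 'I_N.+1 * 'I_N.+1 => x.1 == x.2 :> nat)); congr (_ + _).
  rewrite -(sum_form3_diag N (k := 4) (f := id)); first last.
  - by move=> n; lia.
  - by move=> n; split; nia.
  - by [].
  by apply: eq_bigl => x; rewrite -andbA [X in _ && X]andbC; case: eqP.
rewrite -(sum_form3_diag N (k := 12) (f := fun n => 3 * n)%N); first last.
- by move=> n; lia.
- by move=> n; split; nia.
- by move=> n; lia.
apply: eq_bigl => -[m n] /=; rewrite -andbA; apply: andb_id2l => /and3P[om on _].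
by rewrite /= in om on *; case: (eqVneq m n) => [->|_] /=; lia.
Qed.

Lemma fsub_sqseries k P : (0 < k)%N ->
  fsub (k ^ 2) (sqseries P) = sqseries (fun n => (k %| n)%N && P (n %/ k)%N).
Proof.
move=> k0; have k20 : (0 < k ^ 2)%N by rewrite expn_gt0 k0.
apply: fpsP => m; rewrite (fcoef_sqseries_sub _ k20 (ltnSn m)).
rewrite (@sum_bool_uniq m.+1 (fun n => P n && (m == k ^ 2 * n ^ 2)%N)); last first.
  move=> i j _ _ /andP[_ /eqP ->] /andP[_].
  by rewrite eqn_pmul2l // eqn_exp2r // => /eqP.
congr (nat_of_bool _)%:R; apply/existsP/existsP => -[n].
  move=> /andP[Pn /eqP def_m]; have lkn : (k * n < m.+1)%N by nia.
  by exists (Ordinal lkn); rewrite /= dvdn_mulr // mulKn // Pn expnMn; apply/eqP.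
move=> /andP[/andP[/dvdnP[j def_n] Pn] /eqP def_m].
have ljm : (j < m.+1)%N by nia.
exists (Ordinal ljm); move: Pn; rewrite def_n mulnK //= => ->.
by apply/eqP; rewrite [LHS]def_m def_n expnMn mulnC.
Qed.

Lemma sqseriesD P Q :
  sqseries P + sqseries Q = sqseries (fun n => P n (+) Q n).
Proof.
apply: fpsP => m; have coefE S : fcoef (sqseries S) m =
    \sum_(n < m.+1) (S n && (m == 1 * n ^ 2)%N)%:R.
  by rewrite -(fcoef_sqseries_sub _ _ (ltnSn m)) // fsub_1.
rewrite fcoefD !coefE -big_split /=; apply: eq_bigr => n _.
by case: (P n); case: (Q n); case: eqP; rewrite /= ?addr0 ?add0r ?(addrr_pchar2 pchar_F2).
Qed.

(** The multiples of 3 among the odd n contribute theta(x^9) to theta, and adding it removes them in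
    characteristic 2. *)
Lemma serD_theta : serD = theta + fsub 9 theta.
Proof.
rewrite (@fsub_sqseries 3) // sqseriesD; apply: fpsP => m.
congr (nat_of_bool _)%:R; apply: eq_existsb => n; rewrite andbA.
congr (_ && _); rewrite (@coprimeMr n 2 3) coprimen2 coprime_sym prime_coprime //.
have [/dvdnP[k ->]|_] := boolP (3 %| n)%N.
  by rewrite mulnK // !andbF oddM andbT addbb.
by rewrite andbT addbF; case: (nat_of_ord n).
Qed.

Lemma fcoef_theta1 : fcoef theta 1 = 1.
Proof.
by rewrite /=; case: existsP => // -[]; exists (Ordinal (isT : 1 < 2)%N).
Qed.

Lemma fcoef_serD1 : fcoef serD 1 = 1.
Proof.
by rewrite /=; case: existsP => // -[]; exists (Ordinal (isT : 1 < 2)%N).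
Qed.

Lemma serD_neq0 : serD != 0.
Proof.
by apply/eqP => /(congr1 (fun f => fcoef f 1)); rewrite fcoef_serD1.
Qed.

Lemma char2_addf4 (R : comNzRingType) (f g h : R) : 2%N \in [pchar R] ->
    f * g = f ^+ 4 + g ^+ 4 -> g * h = g ^+ 4 + h ^+ 4 ->
  (f + h) * g = f ^+ 4 + h ^+ 4.
Proof.
move=> R2 fg gh; rewrite mulrDl fg [h * g]mulrC gh.
by rewrite addrA -[X in X + _]addrA (addrr_pchar2 R2) addr0.
Qed.

(** Add the level 3 relation to its image under x -> x^3: the fourth powers of theta(x^3) cancel,
    leaving D theta(x^3) = D^4, and D can be divided out. *)
Lemma serD_cube : serD ^+ 3 = fsub 3 theta.
Proof.
have e3 : fsub 3 theta * fsub 9 theta = fsub 3 theta ^+ 4 + fsub 9 theta ^+ 4.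
  have -> : fsub 9 theta = fsub 3 (fsub 3 theta) by rewrite fsub_fsub.
  by rewrite -fsubM // theta_modular3 fsubD !fsubX.
apply: (@fps_mulI _ serD); first exact: serD_neq0.
rewrite -exprS serD_theta ser_exp4D.
by rewrite (char2_addf4 F2_pchar theta_modular3 e3).
Qed.

(* Unfolding the product makes unification diverge. *)
Opaque fps_mul.

(** * Modular equations *)

(* Polynomials over Z/2 as lists of coefficients in increasing degree;
   those in x and y as lists in powers of x of polynomials in y. *)
Section BivariatePolynomials.

Implicit Types (s t : seq bool) (l k : seq (seq bool)).

Fixpoint padd s t : seq bool :=
  match s, t with
  | a :: s', b :: t' => (a (+) b) :: padd s' t'
  | [::], _ => t
  | _, [::] => s
  end.

Fixpoint pmul s t : seq bool :=
  if s is a :: s' then padd (if a then t else [::]) (false :: pmul s' t) else [::].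

Fixpoint padd2 l k : seq (seq bool) :=
  match l, k with
  | s :: l', t :: k' => padd s t :: padd2 l' k'
  | [::], _ => k
  | _, [::] => l
  end.

Fixpoint pmul2 l k : seq (seq bool) :=
  if l is s :: l' then padd2 (map (pmul s) k) ([::] :: pmul2 l' k) else [::].

Definition pexp2 l n := iter n (pmul2 l) [:: [:: true]].

Variables (R : comNzRingType) (R2 : 2%N \in [pchar R]).
Implicit Types x y : R.

Definition ev x s : R := foldr (fun (b : bool) a => b%:R + x * a) 0 s.
Definition ev2 x y l : R := foldr (fun s a => ev y s + x * a) 0 l.

Lemma ev_cons x (c : bool) s : ev x (c :: s) = c%:R + x * ev x s.
Proof. by []. Qed.

Lemma ev2_cons x y s l : ev2 x y (s :: l) = ev y s + x * ev2 x y l.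
Proof. by []. Qed.

Lemma ev_padd x s t : ev x (padd s t) = ev x s + ev x t.
Proof.
elim: s t => [|a s IH] [|b t] /=; rewrite ?add0r ?addr0 // IH mulrDr addrACA.
by congr (_ + _); case: a; case: b; rewrite ?addr0 ?add0r ?(addrr_pchar2 R2).
Qed.

Lemma ev_pmul x s t : ev x (pmul s t) = ev x s * ev x t.
Proof.
elim: s => [|a s IH] /=; first by rewrite mul0r.
rewrite ev_padd /= IH add0r mulrDl mulrA.
by case: a; rewrite ?mul1r ?mul0r.
Qed.

Lemma ev2_padd x y l k : ev2 x y (padd2 l k) = ev2 x y l + ev2 x y k.
Proof.
elim: l k => [|s l IH] [|t k] /=; rewrite ?add0r ?addr0 // IH ev_padd mulrDr.
by rewrite addrACA.
Qed.

Lemma ev2_pmul x y l k : ev2 x y (pmul2 l k) = ev2 x y l * ev2 x y k.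
Proof.
elim: l k => [|s l IH] k /=; first by rewrite mul0r.
rewrite ev2_padd /= IH add0r mulrDl mulrA; congr (_ + _).
elim: k {IH} => [|t k IHk] /=; first by rewrite mulr0.
by rewrite ev_pmul IHk mulrDr mulrCA.
Qed.

Lemma ev2_pexp x y l n : ev2 x y (pexp2 l n) = ev2 x y l ^+ n.
Proof.
elim: n => [|n IH]; first by rewrite /= !mulr0 !addr0.
by rewrite /pexp2 iterS ev2_pmul -/(pexp2 l n) IH exprS.
Qed.

Lemma ev2_eq0 x y l : all (all negb) l -> ev2 x y l = 0.
Proof.
elim: l => //= s l IH /andP[s0 /IH ->]; rewrite mulr0 addr0.
by elim: s s0 => //= -[] //= s IHs /IHs ->; rewrite mulr0 addr0.
Qed.

Definition px := [:: [::]; [:: true]].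
Definition py := [:: [:: false; true]].
Definition pconst s := map (fun c : bool => [:: c]) s.
Definition pxyy s := mkseq (fun i => ncons i.*2 false [:: nth false s i]) (size s).

Lemma ev2_px x y : ev2 x y px = x.
Proof. by rewrite /= !mulr0 !addr0 add0r mulr1. Qed.

Lemma ev2_py x y : ev2 x y py = y.
Proof. by rewrite /= !mulr0 !addr0 add0r mulr1. Qed.

Lemma ev2_pconst x y s : ev2 x y (pconst s) = ev x s.
Proof. by elim: s => //= a s ->; rewrite mulr0 addr0. Qed.

Lemma ev_ncons y n s : ev y (ncons n false s) = y ^+ n * ev y s.
Proof.
elim: n => [|n IH]; first by rewrite mul1r.
by rewrite /= -/(ncons n false s) IH add0r exprS mulrA.
Qed.

Lemma ev2_pxyy x y s : ev2 x y (pxyy s) = ev (x * y ^+ 2) s.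
Proof.
rewrite /pxyy /mkseq; pose h m t :=
  ev2 x y [seq ncons i.*2 false [:: nth false t (i - m)] | i <- iota m (size t)].
suff hE m t : h m t = y ^+ m.*2 * ev (x * y ^+ 2) t.
  have := hE 0%N s; rewrite mul1r => <-; rewrite /h; congr ev2.
  by apply: eq_map => i; rewrite subn0.
elim: t m => [|a t IH] m; first by rewrite /= mulr0.
have -> : h m (a :: t) = y ^+ m.*2 * a%:R + x * h m.+1 t.
  rewrite /h [in LHS]/ev2 /= ev_ncons subnn /= mulr0 addr0; congr (_ + x * _).
  rewrite -/(ev2 x y _); congr ev2; apply/eq_in_map => i.
  rewrite mem_iota => /andP[lmi _].
  have: (0 < i - m)%N by rewrite subn_gt0.
  by rewrite subnS; case: (i - m)%N.
rewrite IH /= mulrDr doubleS !exprS; congr (_ + _); ring.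
Qed.

End BivariatePolynomials.

(* Here x stands for kappa and y for the series r with kappa(x^3) = kappa r^2, so
   that [g1] and [g2] are g(kappa) and g(kappa(x^3)).  [R0] is the relation
   satisfied by kappa and r; if [R1] vanishes, then kappa^p / g(kappa)^2 satisfies
   the same relation of level 3 as theta.  Both are multiples of
   y + b(y) x + y^3 x^2, and the cofactor of [R0] has constant term 1. *)
Section ModularPolynomials.
Variables (g b : seq bool).

Definition mpoly := [:: [:: false; true]; b; [:: false; false; false; true]].

(* Division by [mpoly] of a polynomial given by its coefficients in decreasing
   powers of the first variable. *)
Fixpoint mquo n l : seq (seq bool) :=
  if n is n'.+1 then
    if l is s :: t :: u :: l' then
      let q := drop 3 s in
      q :: mquo n' (padd t (pmul q b) :: padd u (false :: q) :: l')
    else [::]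
  else [::].
Definition mdiv l := rev (mquo (size l) (rev l)).

Definition g1 := pconst g.
Definition g2 := pxyy g.

Definition R0 := padd2 (pmul2 py (pmul2 (pexp2 g1 3) (pexp2 g2 3)))
  (pmul2 px (pexp2 (padd2 g2 (pmul2 py g1)) 4)).
Definition R1 p := padd2
  (pmul2 (pexp2 px p./2) (pexp2 (padd2 g2 (pmul2 (pexp2 py p) g1)) 2))
  (pmul2 (pexp2 py p./2) (pexp2 (padd2 g2 (pmul2 py g1)) 2)).

(** The division itself is not proved correct; multiplying back certifies its result, equality being
    a zero sum in characteristic 2. *)
Definition mdvd l := all (all negb) (padd2 l (pmul2 mpoly (mdiv l))).

End ModularPolynomials.

Definition pol1 : seq bool := [:: true; true].
Definition pol2 : seq bool := [:: true; true; true].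
Definition gpol p : seq bool := match p with
  | 5 => pmul pol1 (pmul pol1 pol1)
  | 7 => pmul pol2 pol2
  | _ => pmul (pmul pol1 (pmul pol1 pol1)) (pmul pol2 pol2)
  end.
Definition bpol p : seq bool := match p with
  | 5 => pmul (pmul pol1 pol1) pol2
  | 7 => pmul pol2 pol2
  | _ => [:: true; true; true; true; true]
  end.

Definition modular_check p := [&& mdvd (bpol p) (R0 (gpol p)),
  mdvd (bpol p) (R1 (gpol p) p) & head false (head [::] (mdiv (bpol p) (R0 (gpol p))))].

Lemma modular_checkP : all modular_check [:: 5; 7; 13].
Proof. by vm_compute. Qed.

Section Char2Identities.
Variables (R : comNzRingType) (R2 : 2%N \in [pchar R]).
Implicit Types x y r : R.

Lemma char2_sqrD x y : (x + y) ^+ 2 = x ^+ 2 + y ^+ 2.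
Proof. by rewrite sqrrD mulr2n (addrr_pchar2 R2) addr0. Qed.

Lemma char2_unmix x y z t : (x + y) * t = x * z + y * t + x * (z + t).
Proof.
transitivity ((x + y) * t + (x * z + x * z)); last by ring.
by rewrite (addrr_pchar2 R2) addr0.
Qed.

Lemma char2_param_sqr (f f3 a b : R) : f * f3 = f ^+ 4 + f3 ^+ 4 ->
  ((f + f3) ^+ 2 * (a * b)) ^+ 2 = f * a ^+ 2 * (f3 * b ^+ 2).
Proof.
move=> e; transitivity (((f + f3) ^+ 2) ^+ 2 * (a * b) ^+ 2); first by ring.
by rewrite !char2_sqrD -!exprM -e; ring.
Qed.

(* [f], [f3] stand for theta and theta(x^3), [k] for kappa, [a] and [b] for
   g(kappa) and g(kappa(x^3)). *)
Lemma param_relation (f f3 k r a b : R) :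
    k = f * a ^+ 2 -> k * r ^+ 2 = f3 * b ^+ 2 ->
    k * r = (f + f3) ^+ 2 * (a * b) ->
  k * (k * (b + r * a) ^+ 4) = k * (r * (a * b) ^+ 3).
Proof.
move=> ka kb kr; have e : k * (b + r * a) ^+ 2 = (f + f3) * (a * b) ^+ 2.
  rewrite char2_sqrD mulrDr {1}ka exprMn (mulrA k) kb; ring.
transitivity ((k * (b + r * a) ^+ 2) ^+ 2); first by ring.
by rewrite e mulrA kr; ring.
Qed.

(** [c] and [c3] are the candidates for theta(x^p) and theta(x^(3p)). The power of a b clears
    denominators; both sides become (k r)^(2p) (a b)^6. *)
Lemma param_modular3 (c c3 k r a b : R) p :
    odd p -> c * a ^+ 2 = k ^+ p -> c3 * b ^+ 2 = (k * r ^+ 2) ^+ p ->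
    k * (b + r * a) ^+ 4 = r * (a * b) ^+ 3 ->
    k ^+ p./2 * (b + r ^+ p * a) ^+ 2 = r ^+ p./2 * (b + r * a) ^+ 2 ->
  (a * b) ^+ 8 * (c * c3) = (a * b) ^+ 8 * (c ^+ 4 + c3 ^+ 4).
Proof.
move=> p_odd ca cb e0 e1.
have krp : (k * r ^+ 2) ^+ p = k ^+ p * (r ^+ p) ^+ 2.
  by rewrite exprMn -!exprM mulnC.
have kp (x : R) : x ^+ p = x * (x ^+ p./2) ^+ 2.
  by rewrite -exprM muln2 -exprS -{1}[p]odd_double_half p_odd.
(* Squaring [e1] and inserting [e0] carries the relation between k and r over to k^p and r^p. *)
have ep : k ^+ p * (b + r ^+ p * a) ^+ 4 = r ^+ p * (a * b) ^+ 3.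
  transitivity (k * (k ^+ p./2 * (b + r ^+ p * a) ^+ 2) ^+ 2).
    by rewrite {1}kp; ring.
  rewrite e1; transitivity ((r ^+ p./2) ^+ 2 * (k * (b + r * a) ^+ 4)); first by ring.
  by rewrite e0 [in RHS]kp; ring.
have e2 : (c + c3) * (a * b) ^+ 2 = k ^+ p * (b + r ^+ p * a) ^+ 2.
  rewrite mulrDl char2_sqrD; transitivity (c * a ^+ 2 * b ^+ 2 + c3 * b ^+ 2 * a ^+ 2).
    by ring.
  by rewrite ca cb krp; ring.
have e4 : (c + c3) ^+ 4 * (a * b) ^+ 8 = (k * r) ^+ p ^+ 2 * (a * b) ^+ 6.
  transitivity (((c + c3) * (a * b) ^+ 2) ^+ 4); first by ring.
  rewrite e2; transitivity ((k ^+ p * (k ^+ p * (b + r ^+ p * a) ^+ 4)) ^+ 2).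
    by ring.
  by rewrite ep (exprMn p k r); ring.
have -> : c ^+ 4 + c3 ^+ 4 = (c + c3) ^+ 4.
  by rewrite !(exprM _ 2 2) !char2_sqrD.
rewrite [RHS]mulrC e4; transitivity (c * a ^+ 2 * (c3 * b ^+ 2) * (a * b) ^+ 6).
  by ring.
by rewrite ca cb krp (exprMn p k r); ring.
Qed.

End Char2Identities.

(** If s = f + h had finite order e, then e > p, and subtracting the relations gives s h(x^3) = s^4
    + s(x^3)^4 + f s(x^3). The left side has order e + 3p, while the terms on the right have orders
    at least 4e, 12e and p + 3e, all larger. *)
Lemma theta_modular3_uniq p (f h : ser) : (0 < p)%N ->
    (forall i, (i < p)%N -> fcoef f i = 0) -> fcoef f p = 1 ->
    (forall i, (i < p)%N -> fcoef h i = 0) -> fcoef h p = 1 ->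
    f * fsub 3 f = f ^+ 4 + fsub 3 f ^+ 4 ->
    h * fsub 3 h = h ^+ 4 + fsub 3 h ^+ 4 ->
  f = h.
Proof.
move=> p0 f0 f1 h0 h1 ef eh; apply: ser_eqD; apply: contrapT => /eqP.
move=> /fps_lead[e fe emin].
have fsub0 (u : ser) k v : (0 < k)%N -> (forall i, (i < v)%N -> fcoef u i = 0) ->
    forall i, (i < k * v)%N -> fcoef (fsub k u) i = 0.
  move=> k0 u0 i li /=; case: ifP => // /dvdnP[j def_i]; rewrite def_i mulnK //.
  by apply: u0; move: li; rewrite def_i mulnC ltn_pmul2l.
have lpe : (p < e)%N.
  rewrite ltnNge; apply/negP => lep; case/negP: fe; rewrite fcoefD.
  move: lep; rewrite leq_eqVlt => /orP[/eqP ->|lt]; first by rewrite f1 h1.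
  by rewrite f0 ?h0 ?addr0.
have eE : (f + h) * fsub 3 h =
    (f + h) ^+ 4 + fsub 3 (f + h) ^+ 4 + f * fsub 3 (f + h).
  rewrite ser_exp4D fsubD ser_exp4D addrACA -ef -eh.
  by apply: char2_unmix F2_pchar _ _ _ _.
move: (f + h) eE fe emin => s eE fe emin.
have := congr1 (fun u => fcoef u (e + 3 * p)) eE.
rewrite (fcoefM_lead emin (fsub0 _ _ _ _ h0)).2 // fcoef_fsub_mul // h1 mulr1.
rewrite 2!fcoefD !ser_exp4E fsub_fsub //.
rewrite (fsub0 _ _ _ _ emin) //; last by lia.
rewrite (fsub0 _ _ _ _ emin) //; last by lia.
rewrite (fcoefM_lead f0 (fsub0 _ 3 _ _ emin)).1 //; last by lia.
by rewrite !addr0 => fe0; rewrite fe0 eqxx in fe.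
Qed.

Lemma eqmod_ev n (f h : ser) s : eqmod n f h -> eqmod n (ev f s) (ev h s).
Proof.
move=> e; elim: s => [|c s IH]; first exact: eqmod_refl.
apply: eqmodD; first exact: eqmod_refl.
exact: eqmodM.
Qed.

Lemma fsub_ev k (f : ser) s : (0 < k)%N -> fsub k (ev f s) = ev (fsub k f) s.
Proof.
move=> k0; have fsub0 : fsub k (0 : ser) = 0.
  by apply: fpsP => n /=; rewrite if_same.
elim: s => [|c s IH]; first exact: fsub0.
by rewrite !ev_cons fsubD fsubM // IH; case: c; rewrite ?fsub1 // fsub0.
Qed.

Lemma fcoef0_ev (f : ser) s : fcoef f 0 = 0 ->
  fcoef (ev f s) 0 = (head false s)%:R.
Proof.
case: s => [|c s] f0; first by [].
by rewrite ev_cons fcoefD fcoef0M f0 mul0r addr0; case: c; rewrite ?fcoef1.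
Qed.

Lemma theta_param p : p \in [:: 5; 7; 13] -> exists k : ser,
  [/\ fcoef k 0 = 0, theta * ev k (gpol p) ^+ 2 = k
    & fsub p theta * ev k (gpol p) ^+ 2 = k ^+ p].
Proof.
move=> pP; have p0 : (0 < p)%N by move: (pP); rewrite !inE => /or3P[] /eqP->.
have p_odd : odd p by move: (pP); rewrite !inE => /or3P[] /eqP->.
have g0 : head false (gpol p) by move: (pP); rewrite !inE => /or3P[] /eqP->.
have /and3P[chk0 chk1 chkq] := allP modular_checkP p pP.
set g := gpol p in g0 chk0 chk1 chkq *; set b := bpol p in chk0 chk1 chkq.
have th0 : fcoef theta 0 = 0 by rewrite /=; case: existsP => // -[[[]]].
(* kappa is the solution of an implicit equation, contracting because theta has no constant term. *)
have [n f h e|k kE] := @fps_fixpoint _ (fun f => theta * ev f g ^+ 2).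
  by apply: eqmodMS th0 _; apply: eqmodX; apply: eqmod_ev.
have k0 : fcoef k 0 = 0 by rewrite -kE fcoef0M th0 mul0r.
set a := ev k g in kE *; set k3 := fsub 3 k; set a3 := ev k3 g.
have a0 : fcoef a 0 = 1 by rewrite fcoef0_ev // g0.
have a30 : fcoef a3 0 = 1 by rewrite fcoef0_ev ?g0 // fcoef_fsub0.
have k1 : fcoef k 1 = 1.
  rewrite -kE fcoefM !big_ord_recl big_ord0 th0 mul0r add0r addr0 fcoef_theta1.
  by rewrite fcoef0X a0 expr1n mul1r.
have k3E : fsub 3 theta * a3 ^+ 2 = k3 by rewrite /a3 -fsub_ev // -fsubX // -fsubM ?kE.
have kN0 : k != 0 by apply/eqP => /(congr1 (fun f => fcoef f 1)); rewrite k1.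
have aa3 : a * a3 != 0.
  apply/eqP => /(congr1 (fun f => fcoef f 0)).
  by rewrite fcoef0M a0 a30 mulr1.
(* By the level 3 relation kappa kappa(x^3) is the square of the right-hand side, so the quotient r
   will satisfy r^2 = kappa(x^3) / kappa. Dividing by kappa is possible because it has order 1. *)
have [r kr] : exists r, k * r = (theta + fsub 3 theta) ^+ 2 * (a * a3).
  have s0 : fcoef ((theta + fsub 3 theta) ^+ 2 * (a * a3)) 0 = 0.
    by rewrite fcoef0M fcoef0X fcoefD fcoef_fsub0 th0 addr0 expr0n mul0r.
  have [h hu _] := fps_unit (k1 : fcoef (FPS (fun n => fcoef k n.+1)) 0 = 1).
  exists (h * FPS (fun n => fcoef ((theta + fsub 3 theta) ^+ 2 * (a * a3)) n.+1)).
  by rewrite {1}(fps_shift k0) [RHS](fps_shift s0) mulrA -(mulrA (fpsX _)) hu mulr1.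
have kr2 : k * r ^+ 2 = k3.
  apply: (fps_mulI kN0); rewrite mulrA -expr2 -exprMn kr -{1}kE -k3E.
  exact: (char2_param_sqr F2_pchar _ _ theta_modular3).
have r0 : fcoef r 0 = 0.
  have k_lt1 i : (i < 1)%N -> fcoef k i = 0 by case: i.
  have [_] := @fcoefM_lead _ k (r ^+ 2) 1 0 k_lt1 (fun i => ltac:(by [])).
  by rewrite kr2 k1 mul1r fcoef0X F2_sqr => <-.
have relation : k * (a3 + r * a) ^+ 4 = r * (a * a3) ^+ 3.
  have kr2E : k * r ^+ 2 = fsub 3 theta * a3 ^+ 2 by rewrite kr2 k3E.
  exact: fps_mulI kN0 (param_relation F2_pchar (esym kE) kr2E kr).
have evg2 : ev2 k r (g2 g) = a3 by rewrite ev2_pxyy kr2.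
have ev_mdvd l : mdvd b l -> ev2 k r l = ev2 k r (mpoly b) * ev2 k r (mdiv b l).
  by move/(ev2_eq0 k r); rewrite (ev2_padd F2_pchar) (ev2_pmul F2_pchar) => /ser_eqD.
(* [R0] vanishes at (kappa, r), and there the cofactor is nonzero, having constant term 1. *)
have ev_m : ev2 k r (mpoly b) = 0.
  have e0 : ev2 k r (R0 g) = 0.
    rewrite !(ev2_padd F2_pchar, ev2_pmul F2_pchar, ev2_pexp F2_pchar).
    by rewrite ev2_px ev2_py evg2 ev2_pconst relation exprMn serDD.
  move: e0; rewrite (ev_mdvd _ chk0) => /fps_mulf_eq0[//|].
  move=> /(congr1 (fun f => fcoef f 0)); move: chkq.
  case: mdiv => [//|q l]; rewrite [head _ _]/= => q0.
  by rewrite ev2_cons fcoefD fcoef0M k0 mul0r addr0 fcoef0_ev // q0.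
have relation1 : k ^+ p./2 * (a3 + r ^+ p * a) ^+ 2 = r ^+ p./2 * (a3 + r * a) ^+ 2.
  apply: ser_eqD; have := ev_mdvd _ chk1; rewrite ev_m mul0r.
  rewrite !(ev2_padd F2_pchar, ev2_pmul F2_pchar, ev2_pexp F2_pchar).
  by rewrite ev2_px ev2_py evg2 ev2_pconst => ->.
have [u au u0] : exists2 u, a ^+ 2 * u = 1 & fcoef u 0 = 1.
  by apply: fps_unit; rewrite fcoef0X a0 expr1n.
(* The candidate for theta(x^p), to be identified by [theta_modular3_uniq]. *)
pose c := k ^+ p * u.
have cE : c * a ^+ 2 = k ^+ p by rewrite /c -mulrA [u * _]mulrC au mulr1.
have c3E : fsub 3 c * a3 ^+ 2 = (k * r ^+ 2) ^+ p.
  by rewrite kr2 /a3 -fsub_ev // -!fsubX // -fsubM // cE.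
exists k; split; [exact: k0|exact: kE|rewrite -cE; congr (_ * _)].
have lead (f : ser) : fcoef f 0 = 0 -> fcoef f 1 = 1 ->
    (forall i, (i < p)%N -> fcoef (f ^+ p) i = 0) /\ fcoef (f ^+ p) p = 1.
  move=> f0 f1; elim: (p) => [|n [IH0 IH1]]; first by rewrite fcoef1.
  have f_lt1 i : (i < 1)%N -> fcoef f i = 0 by case: i.
  by have [] := fcoefM_lead f_lt1 IH0; rewrite -exprS f1 IH1 mulr1.
have [kp0 kp1] := lead k k0 k1.
have u_lt0 i : (i < 0)%N -> fcoef u i = 0 by [].
apply: (theta_modular3_uniq p0).
- move=> i li /=; case: ifP => // /dvdnP[[|j]]; first by rewrite mul0n => ->; rewrite div0n.
  by move=> def_i; move: li; rewrite def_i ltnNge leq_pmull.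
- by rewrite -{2}[p]muln1 fcoef_fsub_mul // fcoef_theta1.
- by have [] := fcoefM_lead kp0 u_lt0; rewrite addn0.
- by have [] := fcoefM_lead kp0 u_lt0; rewrite addn0 kp1 u0 mulr1.
- rewrite fsubC // -fsubM // theta_modular3 fsubD fsubX // fsubX // fsubC //.
apply: (@fps_mulI _ ((a * a3) ^+ 8)); first exact: fps_exp_neq0.
exact: (param_modular3 F2_pchar p_odd cE c3E relation relation1).
Qed.

(* The exponents of the polynomial h_p(y) = g_p(y)^2; the modular equation
   between D and D(x^p) is its homogenised form, see serD_modular. *)
Definition hsupp p : seq nat := match p with
  | 5 => [:: 0; 6] | 7 => [:: 0; 4; 8] | _ => [:: 0; 2; 12; 14] end.

(** The exponents are symmetric under c -> p + 1 - c, so the modular equation is symmetric in D and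
    D(x^p). *)
Lemma hsupp_flip (V : nmodType) p (F : nat -> V) : p \in [:: 5; 7; 13] ->
  \sum_(c <- hsupp p) F c = \sum_(c <- hsupp p) F (p.+1 - c)%N.
Proof.
move=> pP; rewrite -[RHS](big_map (fun c => p.+1 - c)%N xpredT); apply: perm_big.
by move: pP; rewrite !inE => /or3P[] /eqP->.
Qed.

Section Char2Identities.
Variables (R : comNzRingType) (R2 : 2%N \in [pchar R]).
Implicit Types x y k : R.

Lemma char2_exp2n x y n : (x + y) ^+ (2 ^ n) = x ^+ (2 ^ n) + y ^+ (2 ^ n).
Proof.
by elim: n => [|n IH]; rewrite ?expr1 // expnS mulnC !exprM IH (char2_sqrD R2).
Qed.

Lemma ev_gpol5 x : ev x (gpol 5) = (1 + x) ^+ 3.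
Proof. by rewrite !(ev_pmul R2) /= mulr0 addr0 mulr1; ring. Qed.

Lemma ev_gpol7 x : ev x (gpol 7) = (1 + x + x ^+ 2) ^+ 2.
Proof. by rewrite !(ev_pmul R2) /= mulr0 addr0 mulr1; ring. Qed.

Lemma ev_gpol13 x : ev x (gpol 13) = (1 + x) ^+ 3 * (1 + x + x ^+ 2) ^+ 2.
Proof. by rewrite !(ev_pmul R2) /= mulr0 addr0 mulr1; ring. Qed.

Lemma sum_hsupp5 x y : \sum_(c <- hsupp 5) x ^+ (6 - c) * y ^+ c = x ^+ 6 + y ^+ 6.
Proof. by rewrite !big_cons big_nil /= !expr0 mul1r mulr1 addr0. Qed.

Lemma sum_hsupp7 x y : \sum_(c <- hsupp 7) x ^+ (8 - c) * y ^+ c =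
  x ^+ 8 + x ^+ 4 * y ^+ 4 + y ^+ 8.
Proof. by rewrite !big_cons big_nil /= !expr0 mul1r mulr1 addr0 addrA. Qed.

Lemma sum_hsupp13 x y : \sum_(c <- hsupp 13) x ^+ (14 - c) * y ^+ c =
  x ^+ 14 + x ^+ 12 * y ^+ 2 + x ^+ 2 * y ^+ 12 + y ^+ 14.
Proof. by rewrite !big_cons big_nil /= !expr0 mul1r mulr1 addr0 !addrA. Qed.

(** Here x and y stand for D and D(x^5), and (y / x)^3 = k^4. As 3 does not divide 4, y / x is not
    read off as a power of k, and only the cube of x^6 + y^6 = x y is reached; the factor (1 + k)^36
    clears denominators. *)
Lemma modular5_param x y k :
    x ^+ 3 * ((1 + k) ^+ 3) ^+ 2 = k -> y ^+ 3 * ((1 + k) ^+ 3) ^+ 2 = k ^+ 5 ->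
  (1 + k) ^+ 36 * (x ^+ 6 + y ^+ 6) ^+ 3 = (1 + k) ^+ 36 * (x * y) ^+ 3.
Proof.
move=> xk yk; have e : (x ^+ 3 + y ^+ 3) * (1 + k) ^+ 6 = k * (1 + k) ^+ 4.
  transitivity (x ^+ 3 * ((1 + k) ^+ 3) ^+ 2 + y ^+ 3 * ((1 + k) ^+ 3) ^+ 2); first by ring.
  by rewrite xk yk (char2_exp2n _ _ 2); ring.
have -> : x ^+ 6 + y ^+ 6 = (x ^+ 3 + y ^+ 3) ^+ 2 by rewrite (char2_sqrD R2); ring.
transitivity (((x ^+ 3 + y ^+ 3) * (1 + k) ^+ 6) ^+ 6); first by ring.
rewrite e; transitivity ((1 + k) ^+ 24 * (x ^+ 3 * ((1 + k) ^+ 3) ^+ 2 *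
    (y ^+ 3 * ((1 + k) ^+ 3) ^+ 2))).
  by rewrite xk yk; ring.
by ring.
Qed.

Lemma modular7_param x k : x ^+ 3 * ((1 + k + k ^+ 2) ^+ 2) ^+ 2 = k ->
  let y := k ^+ 2 * x in x ^+ 8 + x ^+ 4 * y ^+ 4 + y ^+ 8 = x * y.
Proof.
move=> xk y; transitivity (x ^+ 8 * (1 + k + k ^+ 2) ^+ 8).
  by rewrite !(char2_exp2n _ _ 3) /y; ring.
transitivity (x ^+ 2 * (x ^+ 3 * ((1 + k + k ^+ 2) ^+ 2) ^+ 2) ^+ 2); first by ring.
by rewrite xk /y; ring.
Qed.

Lemma modular13_param x k :
    x ^+ 3 * ((1 + k) ^+ 3 * (1 + k + k ^+ 2) ^+ 2) ^+ 2 = k ->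
  let y := k ^+ 4 * x in
  x ^+ 14 + x ^+ 12 * y ^+ 2 + x ^+ 2 * y ^+ 12 + y ^+ 14 = x * y.
Proof.
move=> xk y; have e3 : (1 + k) * (1 + k + k ^+ 2) = 1 + k ^+ 3.
  transitivity (1 + k ^+ 3 + (k + k) + (k ^+ 2 + k ^+ 2)); first by ring.
  by rewrite !(addrr_pchar2 R2) !addr0.
transitivity (x ^+ 14 * ((1 + k) ^+ 8 * ((1 + k) * (1 + k + k ^+ 2)) ^+ 16)).
  by rewrite e3 !(char2_exp2n _ _ 3) !(char2_exp2n _ _ 4) /y; ring.
rewrite /y; transitivity
    (x ^+ 2 * (x ^+ 3 * ((1 + k) ^+ 3 * (1 + k + k ^+ 2) ^+ 2) ^+ 2) ^+ 4).
  by ring.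
by rewrite xk; ring.
Qed.

End Char2Identities.

Lemma serD_modular p : p \in [:: 5; 7; 13] ->
  \sum_(c <- hsupp p) serD ^+ (p.+1 - c) * fsub p serD ^+ c = serD * fsub p serD.
Proof.
move=> pP; have p0 : (0 < p)%N by move: (pP); rewrite !inE => /or3P[] /eqP->.
have [k [k0 kE kpE]] := theta_param pP.
have [k3 [k30 DE DpE]] : exists k3 : ser, [/\ fcoef k3 0 = 0,
    serD ^+ 3 * ev k3 (gpol p) ^+ 2 = k3
    & fsub p serD ^+ 3 * ev k3 (gpol p) ^+ 2 = k3 ^+ p].
  exists (fsub 3 k); rewrite -fsub_ev // -!fsubX // serD_cube fsubC // -!fsubM //.
  by rewrite kE kpE; split=> //; rewrite fcoef_fsub0.
have k3N0 : k3 != 0.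
  apply/eqP => k3_0; move: DE; rewrite k3_0 => /fps_mulf_eq0[] /eqP; apply/negP.
    exact/fps_exp_neq0/serD_neq0.
  apply/fps_exp_neq0/eqP => /(congr1 (fun f => fcoef f 0)).
  by rewrite fcoef0_ev //; move: (pP); rewrite !inE => /or3P[] /eqP->.
have aN0 : ev k3 (gpol p) ^+ 2 != 0.
  by apply/eqP => a0; move: k3N0; rewrite -DE a0 mulr0 eqxx.
(* For p = 1 modulo 3 the ratio of the cubes is k3^(p - 1), itself a cube, and cube roots are
   unique. *)
have DpN (e : nat) : p = (3 * e).+1 -> fsub p serD = k3 ^+ e * serD.
  move=> def_p; apply/ser_cube_inj/(fps_mulI aN0).
  by rewrite mulrC DpE exprMn mulrCA [X in _ * X]mulrC DE -exprM mulnC -exprSr -def_p.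
move: pP DE DpE DpN aN0; rewrite !inE => /or3P[] /eqP-> DE DpE DpN aN0.
- rewrite sum_hsupp5.
  apply: ser_cube_inj; move: DE DpE; rewrite (ev_gpol5 F2_pchar) => DE DpE.
  have /fps_mulI := modular5_param F2_pchar DE DpE; apply.
  apply/fps_exp_neq0/eqP => /(congr1 (fun f => fcoef f 0)).
  by rewrite fcoefD k30 addr0 fcoef1.
- rewrite sum_hsupp7; move: DE; rewrite (ev_gpol7 F2_pchar) (DpN 2%N erefl) => DE.
  exact: (modular7_param F2_pchar DE).
- rewrite sum_hsupp13; move: DE; rewrite (ev_gpol13 F2_pchar) (DpN 4%N erefl) => DE.
  exact: (modular13_param F2_pchar DE).
Qed.

(** * The operators T_p on powers of D *)

Lemma hecke_fsub p k (f : ser) : coprime p k -> (0 < p)%N -> (0 < k)%N ->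
  hecke p (fsub k f) = fsub k (hecke p f).
Proof.
move=> cpk p0 k0; rewrite !heckeE fsubD fsubC //; congr (_ + _).
apply: fpsP => n /=; rewrite Gauss_dvdr 1?coprime_sym //.
by case: ifP => // kn; rewrite muln_divA.
Qed.

(** p n is an odd square exactly when n = p j^2 with j odd, so U_p theta = theta(x^p) and the two
    parts of T_p cancel. *)
Lemma hecke_theta p : prime p -> odd p -> hecke p theta = 0.
Proof.
move=> p_pr p_odd; have p0 := prime_gt0 p_pr.
suff e : fsec p theta = fsub p theta by rewrite heckeE e serDD.
apply: fpsP => n; rewrite (fcoef_sqseries_sub _ p0 (ltnSn n)).
rewrite (@sum_bool_uniq n.+1 (fun m => odd m && (n == p * m ^ 2)%N)); last first.
  move=> i j _ _ /andP[_ /eqP ->] /andP[_].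
  by rewrite eqn_pmul2l // eqn_exp2r // => /eqP.
congr (nat_of_bool _)%:R; apply/existsP/existsP => -[m /andP[om /eqP def_n]].
  have /dvdnP[j def_m] : (p %| m)%N.
    have := @Euclid_dvdX m 2 p p_pr.
    by rewrite andbT -def_n dvdn_mulr.
  have def_n' : n = (p * j ^ 2)%N.
    by apply/eqP; rewrite -(eqn_pmul2l p0) def_n def_m expnMn; apply/eqP; lia.
  have ljn : (j < n.+1)%N by rewrite def_n'; nia.
  exists (Ordinal ljn); rewrite /= (introT eqP def_n') andbT.
  by move: om; rewrite def_m oddM => /andP[].
have lpm : (p * m < (p * n).+1)%N.
  rewrite ltnS leq_pmul2l // [leqRHS]def_n -mulnn mulnCA leq_pmulr // muln_gt0 p0.
  by case: (nat_of_ord m) om.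
exists (Ordinal lpm); rewrite /= oddM p_odd om expnMn /=; apply/eqP; lia.
Qed.

Definition hser p : ser := \sum_(c <- hsupp p) fpsX _ ^+ c.

Lemma hser_inv p : exists g, hser p * g = 1.
Proof.
have [g hg _] : exists2 g, hser p * g = 1 & fcoef g 0 = 1; last by exists g.
apply: fps_unit; rewrite fcoef_sum; under eq_bigr do rewrite fcoef0X expr0n.
by do 14?[case: p => [|p]]; rewrite !big_cons big_nil /= ?addr0.
Qed.

Definition hinv p : ser := sval (cid (hser_inv p)).

Lemma hser_hinv p : hser p * hinv p = 1.
Proof. exact: svalP (cid (hser_inv p)). Qed.

Lemma fcoef_fpsXn (R : comNzRingType) (f : fps R) c n :
  fcoef (fpsX R ^+ c * f) n = if (c <= n)%N then fcoef f (n - c) else 0.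
Proof.
elim: c n => [|c IH] n; first by rewrite mul1r subn0.
by rewrite exprS -mulrA fcoefXM; case: n => [|n]; rewrite ?IH.
Qed.

(* The coefficient of y^n in (y^p / h_p(y))^j. *)
Definition hcoef p j n : 'F_2 := fcoef (fpsX _ ^+ (p * j) * hinv p ^+ j) n.

(** With y = D z, the recursion for T_p(D^n) has generating function with denominator h_p(y) -
    D^(1-p) y^p; this is its expansion as a geometric series in D^(1-p) y^p / h_p(y). The truncated
    exponents are harmless, as [hcoef p j n] vanishes for n < p j. *)
Definition hecke_pow p n : ser :=
  \sum_(1 <= j < n.+1) hcoef p j n *: serD ^+ (n - p.-1 * j).

Lemma hcoef_eq0 p j n : (n < p * j)%N -> hcoef p j n = 0.
Proof. by move=> ln; rewrite /hcoef fcoef_fpsXn leqNgt ln. Qed.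

Lemma hcoef0 p n : hcoef p 0 n = (n == 0)%:R.
Proof. by rewrite /hcoef muln0 !expr0 mul1r fcoef1. Qed.

(** Coefficients of h_p (y^p / h_p)^(j+1) = y^p (y^p / h_p)^j. *)
Lemma hcoef_rec p j n : (p <= n)%N -> all (fun c => c <= n)%N (hsupp p) ->
  \sum_(c <- hsupp p) hcoef p j.+1 (n - c) = hcoef p j (n - p).
Proof.
move=> lpn /allP len; rewrite /hcoef.
set f := fpsX _ ^+ (p * j.+1) * _; set f0 := fpsX _ ^+ (p * j) * _.
transitivity (fcoef (hser p * f) n).
  rewrite /hser mulr_suml fcoef_sum big_seq_cond [RHS]big_seq_cond.
  by apply: eq_bigr => c; rewrite andbT => /len lc; rewrite fcoef_fpsXn lc.
have -> : hser p * f = fpsX _ ^+ p * f0.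
  rewrite /f /f0 mulnS exprD [hinv p ^+ j.+1]exprS.
  have shuffle (R : comNzRingType) (h u a b v : R) :
    h * (a * b * (u * v)) = h * u * (a * (b * v)) by ring.
  by rewrite shuffle hser_hinv mul1r.
by rewrite fcoef_fpsXn lpn.
Qed.

Lemma hecke_pow_bound p n K : (1 < p)%N -> (n < K)%N -> hecke_pow p n =
  \sum_(1 <= j < K) hcoef p j n *: serD ^+ (n - p.-1 * j).
Proof.
move=> p1 lnK; rewrite [RHS](big_cat_nat (n := n.+1)) //= [X in _ + X]big_nat.
rewrite [X in _ + X]big1 ?addr0 // => j /andP[lnj _].
by rewrite hcoef_eq0 ?scale0r //; nia.
Qed.

Lemma hecke_pow_rec p n : p \in [:: 5; 7; 13] -> (p < n)%N ->
  \sum_(c <- hsupp p) serD ^+ c * hecke_pow p (n - c) = serD * hecke_pow p (n - p).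
Proof.
move=> pP lpn.
have [p1 hs] : (1 < p)%N /\ {in hsupp p, forall c, c <= n}%N.
  by move: pP lpn; rewrite !inE => /or3P[] /eqP-> lpn; split=> // c;
     rewrite !inE; lia.
under eq_big_seq => c /hs len.
  rewrite (@hecke_pow_bound _ _ n.+1) // ?ltnS ?leq_subr // mulr_sumr.
  under eq_bigr => j _.
    rewrite -fps_scaleAr -exprD.
    rewrite (_ : _ *: _ = hcoef p j (n - c) *: serD ^+ (n - p.-1 * j)); last first.
      have [l|l] := ltnP (n - c) (p * j); first by rewrite hcoef_eq0 ?scale0r.
      by rewrite (_ : c + (n - c - p.-1 * j) = n - p.-1 * j)%N //; nia.
    over.
  over.
rewrite exchange_big /=.
transitivity (\sum_(1 <= j < n.+1) hcoef p j.-1 (n - p) *: serD ^+ (n - p.-1 * j)).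
  apply: eq_big_nat => -[//|j] _; rewrite -scaler_suml hcoef_rec ?(ltnW lpn) //.
  exact/allP.
rewrite big_add1 /= (@hecke_pow_bound _ _ n) ?mulr_sumr //; last by lia.
rewrite [LHS]big_ltn /=; last by lia.
rewrite hcoef0 subn_eq0 leqNgt lpn scale0r add0r; apply: eq_bigr => j _.
rewrite -fps_scaleAr -exprS.
have [l|l] := ltnP (n - p) (p * j); first by rewrite hcoef_eq0 ?scale0r.
by rewrite (_ : (n - p - p.-1 * j).+1 = n - p.-1 * j.+1)%N //; nia.
Qed.

(** The modular equation times D(x^p)^(n-p-1) gives the recursion for D(x^p)^n; times D^(n-p-1),
    followed by U_p, it gives the same recursion for U_p(D^n). Add the two. *)
Lemma hecke_serD_rec p n : p \in [:: 5; 7; 13] -> (p < n)%N ->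
  \sum_(c <- hsupp p) serD ^+ c * hecke p (serD ^+ (n - c)) =
  serD * hecke p (serD ^+ (n - p)).
Proof.
move=> pP lpn; have p0 : (0 < p)%N by move: (pP); rewrite !inE => /or3P[] /eqP->.
have hs : {in hsupp p, forall c, c <= p.+1}%N.
  by move: pP; rewrite !inE => /or3P[] /eqP-> c; rewrite !inE; lia.
pose B := fsub p serD; have := serD_modular pP; rewrite -/B => modE.
have VE : \sum_(c <- hsupp p) serD ^+ c * fsub p (serD ^+ (n - c)) =
    serD * fsub p (serD ^+ (n - p)).
  transitivity ((\sum_(c <- hsupp p) serD ^+ c * B ^+ (p.+1 - c)) * B ^+ (n - p.+1)).
    rewrite mulr_suml; apply: eq_big_seq => c /hs lc.
    by rewrite fsubX // -mulrA -exprD; congr (_ * _ ^+ _); lia.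
  rewrite hsupp_flip //; under eq_big_seq => c /hs lc do rewrite subKn //.
  by rewrite modE -mulrA -exprS fsubX //; congr (_ * _ ^+ _); lia.
have UE : \sum_(c <- hsupp p) serD ^+ c * fsec p (serD ^+ (n - c)) =
    serD * fsec p (serD ^+ (n - p)).
  have fsec_sum (r : seq nat) (F : nat -> ser) :
      fsec p (\sum_(c <- r) F c) = \sum_(c <- r) fsec p (F c).
    by apply: fpsP => i; rewrite fcoef_sum /= fcoef_sum.
  rewrite -fsec_fsubM // -/B.
  transitivity (fsec p ((\sum_(c <- hsupp p) serD ^+ (p.+1 - c) * B ^+ c) *
      serD ^+ (n - p.+1))).
    rewrite mulr_suml fsec_sum; apply: eq_big_seq => c /hs lc.
    rewrite -fsec_fsubM // fsubX // -/B mulrAC -exprD mulrC; congr (fsec _ (_ * _ ^+ _)).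
    by congr (_ ^+ _); lia.
  rewrite modE; congr (fsec _ _); rewrite [serD * B]mulrC -mulrA -exprS.
  by congr (_ * _ ^+ _); lia.
rewrite heckeE mulrDr -UE -VE -big_split /=; apply: eq_bigr => c _.
by rewrite heckeE mulrDr.
Qed.

Section SupportModulo.
Variables (R : comNzRingType) (m : nat).
Implicit Types (f g : fps R) (s t : nat).

Definition supp_mod s f := forall i, (i != s %[mod m])%N -> fcoef f i = 0.

Lemma supp_modM s t f g :
  supp_mod s f -> supp_mod t g -> supp_mod (s + t) (f * g).
Proof.
move=> fs gt i ni; rewrite fcoefM big1 // => j _.
have [/eqP js|/fs ->] := boolP (j == s %[mod m])%N; last by rewrite mul0r.
have [/eqP ijt|/gt ->] := boolP (i - j == t %[mod m])%N; last by rewrite mulr0.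
case/negP: ni; apply/eqP; have := ltn_ord j; rewrite ltnS => lji.
by rewrite -(subnKC lji) -modnDm js ijt modnDm.
Qed.

Lemma supp_modX s f k : supp_mod s f -> supp_mod (k * s) (f ^+ k).
Proof.
move=> fs; elim: k => [|k IH].
  by move=> [|i]; rewrite ?fcoef1 // mul0n eqxx.
by rewrite exprS mulSn; apply: supp_modM.
Qed.

Lemma supp_mod_eqmod s t f : (s = t %[mod m])%N -> supp_mod s f -> supp_mod t f.
Proof. by move=> e fs i ni; apply: fs; rewrite e. Qed.

End SupportModulo.

Lemma supp_mod_dvd (R : comNzRingType) m m' s (f : fps R) : (m %| m')%N ->
  supp_mod m' s f -> supp_mod m s f.
Proof.
move=> dvd fs i ni; apply: fs; apply: contra ni => /eqP e.
by rewrite -(modn_dvdm i dvd) e modn_dvdm.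
Qed.

(** p is its own inverse modulo m, so U_p and the substitution x -> x^p move the class s to the same
    class p s. *)
Lemma supp_mod_hecke m p s f : (0 < p)%N -> (p * p = 1 %[mod m])%N ->
  supp_mod m s f -> supp_mod m (p * s) (hecke p f).
Proof.
move=> p0 pp fs n nn; rewrite /= fs ?add0r; last first.
  apply: contra nn => /eqP e; rewrite -modnMmr -e modnMmr mulnA.
  by rewrite -modnMml pp modnMml mul1n.
case: ifP => // /divnK def_n; apply: fs; apply: contra nn => /eqP e.
by rewrite -def_n -modnMml e modnMml mulnC.
Qed.

(** The square of a unit modulo 24 is 1. *)
Lemma serD_supp24 : supp_mod 24 1 serD.
Proof.
move=> m nm; rewrite /=; case: existsP => // -[n /and3P[_ cn /eqP def_m]].
case/negP: nm; rewrite def_m -modnXm.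
have : coprime (n %% 24) 24.
  by rewrite coprime_modl; apply: (@coprime_dvdr _ (6 ^ 3)); rewrite ?coprimeXr.
have := @ltn_pmod n 24 isT; move: (n %% 24)%N.
by do 24![case=> [//|]].
Qed.

Lemma serD_exp_supp24 n : supp_mod 24 n (serD ^+ n).
Proof. by rewrite -[X in supp_mod _ X]muln1; apply: supp_modX serD_supp24. Qed.

Lemma serD_exp_lead n :
  (forall i, (i < n)%N -> fcoef (serD ^+ n) i = 0) /\ fcoef (serD ^+ n) n = 1.
Proof.
have D0 i : (i < 1)%N -> fcoef serD i = 0.
  by case: i => // _; apply: serD_supp24.
elim: n => [|n [IH0 IH1]]; first by rewrite fcoef1.
by have [] := fcoefM_lead D0 IH0; rewrite -exprS fcoef_serD1 IH1 mulr1.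
Qed.

(** * Initial values: T_p(D^n) for n at most p *)

Section SmallPowers.
Variable p : nat.
Hypothesis pP : p \in [:: 5; 7; 13].
Let P n := hecke p (serD ^+ n).

Let p_gt0 : (0 < p)%N.
Proof. by move: pP; rewrite !inE => /or3P[] /eqP->. Qed.

Let p_odd : odd p.
Proof. by move: pP; rewrite !inE => /or3P[] /eqP->. Qed.

Let Pdouble n : P n.*2 = P n ^+ 2.
Proof. by rewrite /P -muln2 exprM hecke_sqr. Qed.

Let P0 : P 0 = 0.
Proof.
rewrite /P heckeE expr0 fsub1 // (_ : fsec p 1 = 1) ?serDD //.
apply: fpsP => n; rewrite -[LHS]/(fcoef 1 (p * n)) !fcoef1 muln_eq0.
by rewrite (gtn_eqF p_gt0).
Qed.

Let P_theta : hecke p theta = 0.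
Proof. by apply: hecke_theta => //; move: pP; rewrite !inE => /or3P[] /eqP->. Qed.

Let coprime_p3 : coprime p 3.
Proof. by move: pP; rewrite !inE => /or3P[] /eqP->. Qed.

Let P1 : P 1 = 0.
Proof.
have fsub0 : fsub 9 (0 : ser) = 0 by apply: fpsP => n /=; rewrite if_same.
rewrite /P expr1 serD_theta heckeD hecke_fsub // ?P_theta ?fsub0 ?addr0 //.
by rewrite (@coprimeMr p 3 3) coprime_p3.
Qed.

Let P3 : P 3 = 0.
Proof.
have fsub0 : fsub 3 (0 : ser) = 0 by apply: fpsP => n /=; rewrite if_same.
by rewrite /P serD_cube hecke_fsub // P_theta fsub0.
Qed.

Lemma hecke_serD_facts :
  [/\ forall n, P n.*2 = P n ^+ 2, P 0 = 0, P 1 = 0 & P 3 = 0].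
Proof. by split. Qed.

(** The quadratic equation leaves 0 and D; the coefficient of x, which is that of x^p in D^p,
    excludes 0. *)
Lemma hecke_serD_eigen : P p ^+ 2 = serD * P p -> P p = serD.
Proof.
move=> e; apply: ser_eqD.
have /fps_mulf_eq0[Pp0|//] : P p * (P p + serD) = 0.
  by rewrite mulrDr -expr2 e mulrC serDD.
have := congr1 (fun f => fcoef f 1) Pp0.
rewrite fcoef0 /P /= muln1 (serD_exp_lead p).2 ifN ?addr0 //.
by move: pP; rewrite !inE => /or3P[] /eqP->.
Qed.

End SmallPowers.

Section PowerSums.
Variables (D : ser) (P : nat -> ser).
Hypothesis D_neq0 : D != 0.
Hypothesis P_facts : [/\ forall n, P n.*2 = P n ^+ 2, P 0 = 0, P 1 = 0 & P 3 = 0].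

Let P2n n : P n = 0 -> P n.*2 = 0.
Proof. by case: P_facts => -> _ _ _ ->; rewrite expr0n. Qed.

Let sqr_eq0 (f : ser) : f ^+ 2 = 0 -> f = 0.
Proof. by rewrite expr2 => /fps_mulf_eq0[]. Qed.

Let mulD_eq0 (f : ser) : 0 = D * f -> f = 0.
Proof. by move/esym/fps_mulf_eq0 => [D0|//]; move: D_neq0; rewrite D0 eqxx. Qed.

(** Squaring yields the even powers from the known ones. At n = 2p the recursion contains
    T_p(D^(2p)) = T_p(D^p)^2, whence a quadratic equation for T_p(D^p). *)
Lemma power_sums5 :
    (forall n, (5 < n)%N ->
      \sum_(c <- hsupp 5) D ^+ c * P (n - c) = D * P (n - 5)) ->
  (forall n, (n < 5)%N -> P n = 0) /\ P 5 ^+ 2 = D * P 5.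
Proof.
case: P_facts => Pdouble P0 P1 P3 Prec.
have P2 := P2n P1; have P4 := P2n P2.
split; first by do 5![case=> [//|]].
have := Prec 10 isT; rewrite /= !big_cons big_nil expr0 mul1r.
by rewrite -[(10 - 0)%N]/(5.*2) Pdouble [P (10 - 6)]P4 mulr0 !addr0.
Qed.

Lemma power_sums7 :
    (forall n, (7 < n)%N ->
      \sum_(c <- hsupp 7) D ^+ c * P (n - c) = D * P (n - 7)) ->
  (forall n, (n < 7)%N -> P n = 0) /\ P 7 ^+ 2 = D * P 7.
Proof.
case: P_facts => Pdouble P0 P1 P3 Prec.
have P2 := P2n P1; have P4 := P2n P2; have P8 := P2n P4; have P6 := P2n P3.
have P12 := P2n P6.
have P5 : P 5 = 0.
  have := Prec 12 isT; rewrite /= !big_cons big_nil expr0 mul1r.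
  rewrite [P (12 - 0)]P12 [P (12 - 4)]P8 [P (12 - 8)]P4 !mulr0 !addr0.
  exact: mulD_eq0.
split; first by do 7![case=> [//|]].
have := Prec 14 isT; rewrite /= !big_cons big_nil expr0 mul1r.
rewrite -[(14 - 0)%N]/(7.*2) Pdouble [P (14 - 4)](P2n P5) [P (14 - 8)]P6.
by rewrite !mulr0 !addr0.
Qed.

(** Computing P 20 both as a fourth power and by the recursion gives P5^4 = D^3 P5, so P5 is 0 or D;
    the hypothesis rules out D. For T_13 it holds by the exponents modulo 24. *)
Lemma power_sums13 : P 5 <> D ->
    (forall n, (13 < n)%N ->
      \sum_(c <- hsupp 13) D ^+ c * P (n - c) = D * P (n - 13)) ->
  (forall n, (n < 13)%N -> P n = 0) /\ P 13 ^+ 2 = D * P 13.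
Proof.
case: P_facts => Pdouble P0 P1 P3 P5_neqD Prec.
have {}Prec n : (13 < n)%N -> P n + (D ^+ 2 * P (n - 2) + (D ^+ 12 * P (n - 12) +
    D ^+ 14 * P (n - 14))) = D * P (n - 13).
  by move/Prec <-; rewrite !big_cons big_nil expr0 mul1r subn0 addr0.
have P2 := P2n P1; have P4 := P2n P2; have P8 := P2n P4; have P6 := P2n P3.
have P12 := P2n P6; have P16 := P2n P8; have P24 := P2n P12.
have P7 : P 7 = 0.
  apply: sqr_eq0; rewrite -Pdouble; have := Prec 14 isT.
  by rewrite [P (14 - 2)]P12 [P (14 - 12)]P2 [P (14 - 14)]P0 [P (14 - 13)]P1
    !mulr0 !addr0.
have P14 := P2n P7.
have P18 : P 18 = D * P 5.
  have := Prec 18 isT.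
  by rewrite [P (18 - 2)]P16 [P (18 - 12)]P6 [P (18 - 14)]P4 !mulr0 !addr0.
have P20 : P 20 = D ^+ 3 * P 5.
  have := Prec 20 isT.
  rewrite [P (20 - 2)]P18 [P (20 - 12)]P8 [P (20 - 14)]P6 [P (20 - 13)]P7.
  by rewrite !mulr0 !addr0 => /ser_eqD ->; rewrite mulrA -exprSr.
have P5 : P 5 = 0.
  have : P 5 * (P 5 ^+ 3 + D ^+ 3) = 0.
    rewrite mulrDr [P 5 * D ^+ 3]mulrC -P20 -exprS (Pdouble 10) (Pdouble 5).
    by rewrite -exprM serDD.
  by move/fps_mulf_eq0 => [//|/ser_eqD/ser_cube_inj].
have P10 := P2n P5.
have P9 : P 9 = 0 by apply: sqr_eq0; rewrite -Pdouble P18 P5 mulr0.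
have P11 : P 11 = 0.
  apply: sqr_eq0; rewrite -Pdouble; have := Prec 22 isT.
  rewrite [P (22 - 2)]P20 P5 [P (22 - 12)]P10 [P (22 - 14)]P8 [P (22 - 13)]P9.
  by rewrite !mulr0 !addr0.
split; first by do 13![case=> [//|]].
have := Prec 26 isT; rewrite -Pdouble.
by rewrite [P (26 - 2)]P24 [P (26 - 12)]P14 [P (26 - 14)]P12 !mulr0 !addr0.
Qed.

End PowerSums.

Lemma hecke_serD_small p : p \in [:: 5; 7; 13] ->
  (forall n, (n < p)%N -> hecke p (serD ^+ n) = 0) /\ hecke p (serD ^+ p) = serD.
Proof.
move=> pP; have facts := hecke_serD_facts pP; have eigen := hecke_serD_eigen pP.
suff [z e] : (forall n, (n < p)%N -> hecke p (serD ^+ n) = 0) /\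
    hecke p (serD ^+ p) ^+ 2 = serD * hecke p (serD ^+ p).
  by split; [exact: z|exact: eigen].
have rec n := @hecke_serD_rec p n pP; clear eigen.
have serD0 := serD_neq0.
move: (pP) facts rec; rewrite !inE => /or3P[] /eqP-> facts rec.
- exact: (power_sums5 facts rec).
- exact: (power_sums7 serD0 facts rec).
- apply: (power_sums13 facts _ rec) => /(congr1 (fun f => fcoef f 1)).
  rewrite fcoef_serD1 /= (serD_exp_supp24 _) //.
Qed.

Lemma hecke_serD p n : p \in [:: 5; 7; 13] ->
  hecke p (serD ^+ n) = hecke_pow p n.
Proof.
move=> pP; have [z e] := hecke_serD_small pP.
have p1 : (1 < p)%N by move: (pP); rewrite !inE => /or3P[] /eqP->.
elim/ltn_ind: n => n IH; case: (ltngtP n p) => [lnp|lpn|->].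
- rewrite z // /hecke_pow big_nat big1 // => j /andP[j0 _].
  by rewrite hcoef_eq0 ?scale0r //; nia.
- have [r [hE r0]] : exists r, hsupp p = 0 :: r /\ {in r, forall c, 0 < c}%N.
    exists (behead (hsupp p)).
    by move: pP; rewrite !inE => /or3P[] /eqP->; split=> // c; rewrite !inE; lia.
  have := hecke_serD_rec pP lpn; have := hecke_pow_rec pP lpn.
  rewrite hE !big_cons expr0 !mul1r subn0 -(IH (n - p)%N); last by lia.
  move=> <-; rewrite [X in _ + X = _](_ : _ = \sum_(c <- r) serD ^+ c * hecke_pow p (n - c)).
    exact: addIr.
  by apply: eq_big_seq => c /r0 c0; rewrite IH //; lia.
- rewrite e /hecke_pow big_ltn ?ltnS ?(ltnW p1) // big_nat big1 ?addr0.
    have h0 : fcoef (hinv p) 0 = 1.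
      have := congr1 (fun f => fcoef f 0) (hser_hinv p); rewrite fcoef0M fcoef1.
      by case: (F2_cases (fcoef (hinv p) 0)) => -> //; rewrite mulr0.
    rewrite /hcoef !muln1 fcoef_fpsXn leqnn subnn expr1 h0 scale1r.
    by rewrite (_ : p - p.-1 = 1)%N ?expr1 //; lia.
  by move=> j /andP[j0 _]; rewrite hcoef_eq0 ?scale0r //; nia.
Qed.

(** * The automaton of T_7 and T_13 *)

(* [cz p j m] is the coefficient of y^m in h_p(y)^-j, and 0 if j <= 0. *)
Section Coefficients.
Variable p : nat.
Implicit Types (j m : int).

Definition cz j m : 'F_2 :=
  if (0 < j) && (0 <= m) then fcoef (hinv p ^+ `|j|%N) `|m|%N else 0.

Lemma cz_pos (j m : nat) : cz j.+1 m = fcoef (hinv p ^+ j.+1) m.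
Proof. by []. Qed.

Lemma cz_even j m : cz (j + j) (m + m) = cz j m.
Proof.
rewrite /cz; have [j0|j0] := ltP 0 j; last by rewrite ltNge (_ : j + j <= 0) //; lia.
have -> : 0 < j + j by lia.
have [m0|m0] := leP 0 m; last by rewrite leNgt (_ : m + m < 0) //; lia.
have -> /= : 0 <= m + m by lia.
have -> : `|(j + j)%R|%N = (`|j| * 2)%N by lia.
have -> : `|(m + m)%R|%N = `|m|.*2%N by lia.
by rewrite exprM (fcoef_sqr pchar_F2) odd_double doubleK F2_sqr.
Qed.

Lemma cz_even_odd j m : cz (j + j) (m + m + 1) = 0.
Proof.
rewrite /cz; case: ifP => // /andP[j0 m0].
have -> : `|(j + j)%R|%N = (`|j| * 2)%N by lia.
have -> : `|(m + m + 1)%R|%N = (`|m|.*2.+1)%N by lia.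
by rewrite exprM (fcoef_sqr pchar_F2) /= odd_double.
Qed.

(** By Frobenius this is [cz (j + j) m], expressed through the halved index. *)
Definition czhalf j m : 'F_2 := if (m %% 2)%Z == 0 then cz j (m %/ 2)%Z else 0.

(** h^-(2j+1) = h (h^-(j+1))^2. *)
Lemma cz_odd j m : cz (j + j + 1) m = \sum_(c <- hsupp p) czhalf (j + 1) (m - c%:Z).
Proof.
have [j0|j0] := ltP j 0.
  rewrite {1}/cz ltNge (_ : j + j + 1 <= 0) ?andbF //=; last by lia.
  rewrite big1 // => c _; rewrite /czhalf /cz ltNge (_ : j + 1 <= 0) ?if_same //.
  by lia.
have [m0|m0] := ltP m 0.
  rewrite {1}/cz leNgt m0 andbF big1 // => c _; rewrite /czhalf /cz.
  have neg : ((m - c%:Z) %/ 2)%Z < 0 by lia.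
  by rewrite [0 <= _]leNgt neg andbF if_same.
case: j j0 => // j _; case: m m0 => // m _.
rewrite [LHS](_ : _ = cz (j + j).+1 m); last by congr (cz _ _); lia.
rewrite cz_pos; have -> : hinv p ^+ (j + j).+1 = hser p * (hinv p ^+ j.+1) ^+ 2.
  have shuffle (R : comNzRingType) (h u v : R) : h * (u * v) ^+ 2 = h * u * (u * v * v) by ring.
  by rewrite [hinv p ^+ j.+1]exprS shuffle hser_hinv mul1r -mulrA -exprD -exprS.
rewrite /hser mulr_suml fcoef_sum; apply: eq_bigr => c _.
rewrite fcoef_fpsXn /czhalf; case: leqP => [lcm|lmc].
  rewrite (fcoef_sqr pchar_F2) F2_sqr.
  have -> : ((m%:Z - c%:Z) %% 2)%Z == 0 = ~~ odd (m - c) by lia.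
  case: ifP => odd_mc //=.
  have -> : ((m%:Z - c%:Z) %/ 2)%Z = ((m - c)./2)%:Z by lia.
  by rewrite [(_ + 1)%R](_ : _ = j.+1%:Z) ?cz_pos //; lia.
have neg : ((m%:Z - c%:Z) %/ 2)%Z < 0 by lia.
by rewrite /cz [0 <= _]leNgt neg andbF if_same.
Qed.

End Coefficients.

Section Windows.
Implicit Types (phi : int -> 'F_2) (m : int) (s t : seq bool).

Fixpoint window phi m s : 'F_2 :=
  if s is b :: s' then b%:R * phi m + window phi (m + 1) s' else 0.

Fixpoint decim (a : bool) s : seq bool :=
  match s with
  | x :: y :: s' => (if a then y else x) :: decim a s'
  | [:: x] => if a then [::] else [:: x]
  | [::] => [::]
  end.

(** Dropping trailing zeros identifies states with the same polynomial, which keeps the set of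
    reachable states small. *)
Fixpoint trim s : seq bool :=
  if s is b :: s' then
    if trim s' is c :: t then b :: c :: t else if b then [:: true] else [::]
  else [::].

Definition hmul p s := foldr padd [::] [seq ncons c false s | c <- hsupp p].

Lemma eq_window phi psi m s : phi =1 psi -> window phi m s = window psi m s.
Proof. by move=> e; elim: s m => //= b s IH m; rewrite e IH. Qed.

Lemma window_sum I (r : seq I) (F : I -> int -> 'F_2) m s :
  window (fun n => \sum_(i <- r) F i n) m s = \sum_(i <- r) window (F i) m s.
Proof.
elim: s m => [|b s IH] m /=; first by rewrite big1.
by rewrite IH mulr_sumr -big_split.
Qed.

Lemma window_shift phi m c s : window (fun n => phi (n + c)) m s = window phi (m + c) s.
Proof. by elim: s m => //= b s IH m; rewrite IH addrAC. Qed.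

Lemma natrF2_addb (a b : bool) : (a (+) b)%:R = a%:R + b%:R :> 'F_2.
Proof. by case: a; case: b; apply/eqP. Qed.

Lemma window_padd phi m s t : window phi m (padd s t) = window phi m s + window phi m t.
Proof.
elim: s t m => [|a s IH] [|b t] m /=; rewrite ?add0r ?addr0 //.
by rewrite IH natrF2_addb mulrDl addrACA.
Qed.

Lemma window_ncons phi m k s : window phi m (ncons k false s) = window phi (m + k%:Z) s.
Proof.
elim: k m => [|k IH] m; first by rewrite addr0.
by rewrite /= mul0r add0r -/(ncons k false s) IH -addrA -intS.
Qed.

Lemma window_trim phi m s : window phi m (trim s) = window phi m s.
Proof.
elim: s m => //= b s IH m; rewrite -IH.
by case: (trim s) => //=; case: b; rewrite /= ?mul0r ?addr0.
Qed.

Lemma window_decim p j m a s :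
  window (czhalf p j) (m + m - (nat_of_bool a)%:Z) s = window (cz p j) m (decim a s).
Proof.
have czh0 n : czhalf p j (n + n) = cz p j n.
  have e0 : ((n + n) %% 2)%Z = 0 by lia.
  have e1 : ((n + n) %/ 2)%Z = n by lia.
  by rewrite /czhalf e0 e1 eqxx.
have czh1 n : czhalf p j (n + n - 1) = 0.
  have e1 : ((n + n - 1) %% 2)%Z = 1 by lia.
  by rewrite /czhalf e1.
have subz0 (n : int) : n - 0%N%:Z = n by lia.
have [k] := ubnP (size s); elim: k s m => // k IH [|x [|y s]] m lsk //=.
  by case: a {IH}; rewrite /= ?czh1 ?mulr0 ?addr0 ?subz0 ?czh0.
have e : m + m - (nat_of_bool a)%:Z + 1 + 1 = (m + 1) + (m + 1) - (nat_of_bool a)%:Z by lia.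
rewrite e IH; last by move: lsk => /=; lia.
rewrite addrA; congr (_ + _); case: a {IH e} => /=.
  by rewrite czh1 mulr0 add0r subrK czh0.
have e1 : m + m + 1 = (m + 1) + (m + 1) - 1 by lia.
by rewrite !subz0 czh0 e1 czh1 mulr0 addr0.
Qed.

Lemma window_cz_even p j m s :
  window (cz p (j + j)) m s = window (czhalf p j) (m - p.+1%:Z) (ncons p.+1 false s).
Proof.
rewrite window_ncons subrK; apply: eq_window => n; rewrite /czhalf.
have [n0|n1] := boolP ((n %% 2)%Z == 0).
  have e : n = (n %/ 2)%Z + (n %/ 2)%Z by lia.
  by rewrite [in LHS]e cz_even.
have e : n = (n %/ 2)%Z + (n %/ 2)%Z + 1 by lia.
by rewrite [in LHS]e cz_even_odd.
Qed.

(** Write m - c = (m - (p + 1)) + (p + 1 - c): by the symmetry of the exponents, the nonnegative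
    shifts p + 1 - c amount to multiplication by h_p. *)
Lemma window_cz_odd p j m s : p \in [:: 5; 7; 13] ->
  window (cz p (j + j + 1)) m s = window (czhalf p (j + 1)) (m - p.+1%:Z) (hmul p s).
Proof.
move=> pP; rewrite (eq_window _ _ (cz_odd p j)) window_sum hsupp_flip //.
have hs : {in hsupp p, forall c, c <= p.+1}%N.
  by move: pP; rewrite !inE => /or3P[] /eqP-> c; rewrite !inE; lia.
rewrite /hmul; elim: (hsupp p) hs => [|c r IH] hs /=; first by rewrite big_nil.
rewrite big_cons window_padd -IH => [|d dr]; last by rewrite hs // inE dr orbT.
congr (_ + _); rewrite window_ncons.
have /hs lc : c \in c :: r by rewrite mem_head.
rewrite (window_shift _ _ (- (p.+1 - c)%N%:Z)); congr window; lia.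
Qed.

End Windows.

(* The state (a, s) stands for the function of (t, t') that sums the
   coefficients of y^(p t' - t - (p + 1) + n) in h_p(y)^-(t - t' + a) over the
   positions n at which s is true. *)
Definition state : Type := bool * seq bool.

Definition state_val p (t t' : nat) (s : state) : 'F_2 :=
  window (cz p (t%:Z - t'%:Z + (nat_of_bool s.1)%:Z))
    (p%:Z * t'%:Z - t%:Z - p.+1%:Z) s.2.

(** [a] and [b] are the lowest bits of t and t'. The exponent t - t' + [s.1] is halved and rounded
    up, an odd one costing a factor h_p; the new carry records the rounding. A bit [b] moves the
    window by p, and [a] selects the parity of the surviving positions. *)
Definition step p (a b : bool) (s : state) : state :=
  let f := ncons (if b then p else 0) false s.2 in
  if a (+) b (+) s.1 then (a || s.1, trim (decim a (hmul p f)))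
  else (a && s.1, trim (decim a (ncons p.+1 false f))).

Lemma state_val_step p t t' (a b : bool) s : p \in [:: 5; 7; 13] ->
  state_val p (t.*2 + a) (t'.*2 + b) s = state_val p t t' (step p a b s).
Proof.
move=> pP; rewrite /state_val /step; case: s => c s; cbn [fst snd].
set f := ncons _ _ _; set v := p%:Z * t'%:Z - t%:Z.
have -> : window (cz p ((t.*2 + a)%N%:Z - (t'.*2 + b)%N%:Z + (nat_of_bool c)%:Z))
      (p%:Z * (t'.*2 + b)%N%:Z - (t.*2 + a)%N%:Z - p.+1%:Z) s =
    window (cz p ((t.*2 + a)%N%:Z - (t'.*2 + b)%N%:Z + (nat_of_bool c)%:Z))
      (v + v - (nat_of_bool a)%:Z - p.+1%:Z) f.
  by rewrite /f window_ncons; congr window; rewrite /v; case: (b); lia.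
have mE : v + v - (nat_of_bool a)%:Z - p.+1%:Z - p.+1%:Z =
    (v - p.+1%:Z) + (v - p.+1%:Z) - (nat_of_bool a)%:Z by lia.
case: ifP => odd_j; cbn [fst snd]; rewrite window_trim -window_decim -mE.
  pose j := t%:Z - t'%:Z + (nat_of_bool (a || c))%:Z - 1.
  have -> : t%:Z - t'%:Z + (nat_of_bool (a || c))%:Z = j + 1 by rewrite /j; lia.
  rewrite -window_cz_odd //; congr (window (cz _ _) _ _).
  by rewrite /j; case: (a) (b) (c) odd_j => [] [] [] //= _; lia.
rewrite -window_cz_even; congr (window (cz _ _) _ _).
by case: (a) (b) (c) odd_j => [] [] [] //= _; lia.
Qed.

(* The first n coefficients of 1 / h_p, the last one at the head. *)
Fixpoint hseq p n : seq bool :=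
  if n is n'.+1 then
    let r := hseq p n' in
    foldr addb (n' == 0) [seq nth false r c.-1 | c <- behead (hsupp p)] :: r
  else [::].

Lemma size_hseq p n : size (hseq p n) = n.
Proof. by elim: n => //= n ->. Qed.

Lemma hsupp_behead p :
  hsupp p = 0 :: behead (hsupp p) /\ {in behead (hsupp p), forall c, 0 < c}%N.
Proof. by do 14?[case: p => [|p]]; split=> // c; rewrite !inE; lia. Qed.

Lemma fcoef_hinv_rec p n : fcoef (hinv p) n =
  (n == 0)%:R + \sum_(c <- behead (hsupp p) | (c <= n)%N) fcoef (hinv p) (n - c).
Proof.
have := congr1 (fun f => fcoef f n) (hser_hinv p).
rewrite fcoef1 /hser (hsupp_behead p).1 big_cons expr0 mulrDl mul1r => <-.
have -> : \sum_(c <- behead (hsupp p) | (c <= n)%N) fcoef (hinv p) (n - c) =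
    fcoef ((\sum_(c <- behead (hsupp p)) fpsX _ ^+ c) * hinv p) n.
  rewrite mulr_suml fcoef_sum big_mkcond; apply: eq_bigr => c _.
  by rewrite fcoef_fpsXn.
by rewrite fcoefD -addrA (addrr_pchar2 pchar_F2) addr0.
Qed.

Lemma nth_hseq p n i : (i < n)%N -> (nth false (hseq p n) i)%:R = fcoef (hinv p) (n - i.+1).
Proof.
elim: n i => // n IH [|i] /= lin; last by rewrite IH.
rewrite subn1 /= fcoef_hinv_rec; have := (hsupp_behead p).2.
elim: (behead _) => [|c r IHr] c0 /=; first by rewrite big_nil addr0.
rewrite natrF2_addb IHr => [|d dr]; last by rewrite c0 // inE dr orbT.
rewrite big_cons addrCA; have {}c0 : (0 < c)%N by rewrite c0 ?mem_head.
case: leqP => [lcn|lnc]; first by rewrite IH ?prednK.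
by rewrite nth_default ?add0r // size_hseq; lia.
Qed.

Lemma head_hseq p n : (head false (hseq p n.+1))%:R = fcoef (hinv p) n.
Proof. by have := @nth_hseq p n.+1 0 isT; rewrite subn1. Qed.

Fixpoint hdot p i (s : seq bool) : bool :=
  if s is b :: s' then (b && head false (hseq p i.+1)) (+) hdot p i.+1 s' else false.

(** At t = t' = 0 the exponent is the carry, so a value needs carry 1; the first p + 1 positions
    have negative index. *)
Definition state0 p (s : state) : bool := s.1 && hdot p 0 (drop p.+1 s.2).

Lemma window_cz1_drop p k s :
  window (cz p 1) (- k%:Z) s = window (cz p 1) 0 (drop k s).
Proof.
elim: k s => [|k IH] [|b s] //=; rewrite -IH /cz.
have -> : (0 <= - k.+1%:Z) = false by lia.
by rewrite andbF mulr0 add0r; congr window; lia.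
Qed.

Lemma window_hdot p i s : window (cz p 1) i%:Z s = (hdot p i s)%:R.
Proof.
elim: s i => [|b s IH] i; first by [].
rewrite -[LHS]/(b%:R * cz p 1 i%:Z + window (cz p 1) (i%:Z + 1) s).
rewrite -[hdot p i _]/((b && head false (hseq p i.+1)) (+) hdot p i.+1 s).
rewrite natrF2_addb natrF2_and head_hseq -IH cz_pos expr1.
by congr (_ + window _ _ _); lia.
Qed.

Lemma state0E p s : state_val p 0 0 s = (state0 p s)%:R.
Proof.
rewrite /state_val /state0 mulr0 !sub0r add0r; case: s => a s; cbn [fst snd].
case: a; first by rewrite window_cz1_drop window_hdot.
rewrite (@eq_window _ (fun=> 0)) //.
by elim: s (- _) => //= b s IH m; rewrite IH mulr0 addr0.
Qed.

(** * Base 4 digits and the labels (i, j) *)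

Definition digit : Type := bool * bool.

Definition push (t : nat) (a : digit) : nat := ((t.*2 + a.2).*2 + a.1)%N.

Definition step4 p (a b : digit) s := step p a.2 b.2 (step p a.1 b.1 s).

Lemma state_val_step4 p t t' a b s : p \in [:: 5; 7; 13] ->
  state_val p (push t a) (push t' b) s = state_val p t t' (step4 p a b s).
Proof. by move=> pP; rewrite !state_val_step. Qed.

Lemma push_digits t : t = push (t %/ 4)%N (odd t, odd t./2).
Proof. rewrite /push /=; lia. Qed.

Lemma push_ind2 (P : nat -> nat -> Prop) :
    P 0 0 -> (forall t t' a b, P t t' -> P (push t a) (push t' b)) ->
  forall t t', P t t'.
Proof.
move=> P00 PS t t'; have [n] := ubnP (t + t')%N.
elim: n t t' => // n IH t t' lttn.
have [/eqP t0|tt0] := boolP (t + t' == 0)%N.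
  by have [-> ->] : t = 0%N /\ t' = 0%N by lia.
by rewrite (push_digits t) (push_digits t'); apply/PS/IH; lia.
Qed.

Fixpoint unzip_bits n (t : nat) : nat * nat :=
  if n is n'.+1 then
    let ij := unzip_bits n' (t %/ 4)%N in (ij.1.*2 + odd t, ij.2.*2 + odd t./2)%N
  else (0, 0)%N.

(* The even-indexed and the odd-indexed binary digits of [t]. *)
Definition code t := unzip_bits t t.

Lemma code_push t a : code (push t a) = ((code t).1.*2 + a.1, (code t).2.*2 + a.2)%N.
Proof.
have stable m n u : (u <= m)%N -> (u <= n)%N -> unzip_bits m u = unzip_bits n u.
  have unz0 k : unzip_bits k 0 = (0, 0)%N by elim: k => //= k ->.
  elim: m n u => [|m IH] [|n] u lum lun //.
  - by move: lum; rewrite leqn0 => /eqP->; rewrite !unz0.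
  - by move: lun; rewrite leqn0 => /eqP->; rewrite !unz0.
  - by rewrite /= (IH n) //; lia.
rewrite /code (stable _ (push t a).+1) //=.
have -> : (push t a %/ 4)%N = t by rewrite /push; case: a => [[] []]; lia.
rewrite (stable _ t) ?leqnn //; last by rewrite /push; lia.
by congr (_ + nat_of_bool _, _ + nat_of_bool _)%N; rewrite /push; case: a => [[] []]; lia.
Qed.

Lemma code_inj : injective code.
Proof.
apply: push_ind2 => // t t' a b IH; rewrite !code_push => -[e1 e2].
have [ea eb] : a.1 = b.1 /\ a.2 = b.2.
  by case: a b e1 e2 => [[] []] [[] []] /=; lia.
rewrite (surjective_pairing a) (surjective_pairing b) ea eb; congr push; apply: IH.
by rewrite (surjective_pairing (code t)) (surjective_pairing (code t')); congr (_, _); lia.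
Qed.

Lemma code_surj i j : exists t, code t = (i, j).
Proof.
move: i j; apply: push_ind2 => [|i j a b [t def_t]]; first by exists 0%N.
exists (push (push t (a.2, b.2)) (a.1, b.1)).
by rewrite !code_push def_t /push.
Qed.

Definition digits : seq digit := [seq (x, y) | x <- [:: false; true], y <- [:: false; true]].

Lemma mem_digits a : a \in digits. Proof. by case: a => [[] []]. Qed.

Inductive trie : Type := Leaf | Node of option (nat * nat) & trie & trie.

Fixpoint tget (T : trie) (k : seq bool) : option (nat * nat) :=
  if T is Node v T0 T1 then
    if k is b :: k' then if b then tget T1 k' else tget T0 k' else v
  else None.

Fixpoint tset (T : trie) (k : seq bool) (v : nat * nat) : trie :=
  let: (w, T0, T1) := if T is Node w T0 T1 then (w, T0, T1) else (None, Leaf, Leaf) in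
  if k is b :: k' then
    if b then Node w T0 (tset T1 k' v) else Node w (tset T0 k' v) T1
  else Node (Some v) T0 T1.

Lemma tget_set T k v k' : k' != k -> tget (tset T k v) k' = tget T k'.
Proof.
elim: k T k' => [|b k IH] [|w T0 T1] [|b' k'] //=.
- by case: b'.
- by case: b.
- by case: b; case: b' => //= ne; rewrite IH.
- by case: b.
by case: b; case: b' => //= ne; rewrite IH.
Qed.

Definition key (s : state) : seq bool := s.1 :: s.2.

Definition tbuild (f : state -> nat * nat) (l : seq state) : trie :=
  foldr (fun s T => tset T (key s) (f s)) Leaf l.

Lemma tget_build f l s v : tget (tbuild f l) (key s) = Some v -> s \in l.
Proof.
elim: l => [//|s0 l IH]; rewrite inE.
rewrite -[tbuild _ _]/(tset (tbuild f l) (key s0) (f s0)).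
have [e|ne] := eqVneq (key s) (key s0).
  by case: s s0 e {IH} => [a s] [a0 s0] [-> ->]; rewrite eqxx.
by rewrite tget_set // => /IH ->; rewrite orbT.
Qed.

(* Neither [closure] nor [potential] below needs a correctness proof: they only
   propose the state sets and the potentials that the certificates check. *)
Fixpoint closure (succ : state -> seq state) n (T : trie) (seen todo : seq state) :=
  if n is n'.+1 then
    if todo is s :: todo' then
      if tget T (key s) is Some _ then closure succ n' T seen todo'
      else closure succ n' (tset T (key s) (0, 0)%N) (s :: seen) (succ s ++ todo')
    else seen
  else seen.

(** The position p + 1 cancels the offset in [state_val], and p %/ 6 is (p - 1) / 6: multiplying 6 t
    + 1 - p j by it, with t - t' = j (p - 1) / 6, gives p t' - t + (p - 1) / 6. *)
Definition init p : state := (false, ncons (p.+1 + p %/ 6)%N false [:: true]).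

Definition digit_pairs : seq (digit * digit) := [seq (a, b) | a <- digits, b <- digits].

Definition successors p s := [seq step4 p ab.1 ab.2 s | ab <- digit_pairs].

Definition states p : seq state := closure (successors p) 5000 Leaf [::] [:: init p].

(* Digit [a] contributes a.1 + 2 a.2 base-4-wise to the pair (i + j, j) of the
   code (i, j), compared lexicographically. *)
Definition wt (x : nat * nat) : nat * nat := (x.1 + x.2, x.2)%N.
Definition digit_wt (a : digit) := wt (nat_of_bool a.1, nat_of_bool a.2).

Definition lexle (x y : nat * nat) := (x.1 < y.1)%N || (x.1 == y.1) && (x.2 <= y.2)%N.
Definition lift (x : nat * nat) a := (x.1.*2 + (digit_wt a).1, x.2.*2 + (digit_wt a).2)%N.
Definition addp (x y : nat * nat) := (x.1 + y.1, x.2 + y.2)%N.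
Definition subp (x y : nat * nat) := (x.1 - y.1, x.2 - y.2)%N.

Definition infty : nat * nat := (50, 50)%N.

(** A Bellman-Ford round towards the largest d with d + [cw t'] at most [cw t] wherever the state is
    nonzero at (t, t'); [infty] is only a large starting value. *)
Definition relax p (T : trie) (s : state) : nat * nat :=
  foldr (fun ab v => let s' := step4 p ab.1 ab.2 s in
      if tget T (key s') is Some d' then
        let x := subp (lift d' ab.1) (digit_wt ab.2) in if lexle x v then x else v
      else v)
    (if state0 p s then (0, 0)%N else infty) digit_pairs.

Definition potential p (l : seq state) : trie :=
  iter 3 (fun T => tbuild (relax p T) l)
    (tbuild (fun s => if state0 p s then (0, 0)%N else infty) l).

Definition potential_check p l (T : trie) := all (fun s =>
  if tget T (key s) is Some d then
    (state0 p s ==> (d == (0, 0)%N)) &&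
    all (fun ab => if tget T (key (step4 p ab.1 ab.2 s)) is Some d'
      then lexle (addp d (digit_wt ab.2)) (lift d' ab.1) else false) digit_pairs
  else false) l.

Definition certificate p l T (d : nat * nat) :=
  (tget T (key (init p)) == Some d) && potential_check p l T.

Lemma certificate7 : exists l, certificate 7 l (potential 7 l) (1, 0)%N.
Proof. by exists (states 7); vm_compute. Qed.
Lemma certificate13 : exists l, certificate 13 l (potential 13 l) (1, 1)%N.
Proof. by exists (states 13); vm_compute. Qed.

Definition cw t := wt (code t).

Lemma cw_push t a : cw (push t a) = lift (cw t) a.
Proof. by rewrite /cw code_push /wt /lift /=; congr (_, _); lia. Qed.

(** Induction on the digits: appending a digit doubles the weights and adds the digit weight, and
    the lexicographic order respects both operations, so the local inequalities of the certificate
    add up. *)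
Lemma state_val_potential p l d t t' : p \in [:: 5; 7; 13] ->
    certificate p l (potential p l) d ->
  state_val p t t' (init p) != 0 -> lexle (addp d (cw t')) (cw t).
Proof.
move=> pP /andP[/eqP get_init /allP chk].
set T := potential p l in get_init chk.
have Tl s v : tget T (key s) = Some v -> s \in l.
  by rewrite /T /potential iterS; apply: tget_build.
move: (init p) d get_init.
move: t t'; apply: push_ind2 => [|t t' a b IH] s d get_s.
  have := chk _ (Tl _ _ get_s); rewrite get_s => /andP[/implyP s0 _].
  by rewrite state0E; case: (state0 p s) s0 => [/(_ isT)/eqP-> //|]; rewrite eqxx.
have := chk _ (Tl _ _ get_s); rewrite get_s => /andP[_ /allP/(_ (a, b))].
rewrite state_val_step4 // !cw_push => chk_ab.
have /chk_ab : (a, b) \in digit_pairs by apply: allpairs_f; exact: mem_digits.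
case get_s' : (tget T _) => [d'|] //= {chk_ab} + /(IH _ _ get_s').
by rewrite /lexle /addp /lift /=; lia.
Qed.

(* Following the borrow of the subtraction of 1 from one of the two components
   of the code of [t]. *)
Definition mkdigit (dir u x : bool) : digit := if dir then (x, u) else (u, x).

Definition borrow_succ p dir s :=
  [seq step4 p (mkdigit dir false x) (mkdigit dir true x) s | x <- [:: false; true]].
Definition stop_succ p dir s :=
  [seq step4 p (mkdigit dir true x) (mkdigit dir false x) s | x <- [:: false; true]].
Definition diag_succ p s := [seq step4 p a a s | a <- digits].

Definition borrow_check p dir l1 l2 :=
  [&& init p \in l1,
    all (fun s => all (mem l1) (borrow_succ p dir s) && all (mem l2) (stop_succ p dir s)) l1
    & all (fun s => all (mem l2) (diag_succ p s) && state0 p s) l2].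

Definition borrow_states p dir := closure (borrow_succ p dir) 100 Leaf [::] [:: init p].
Definition diag_states p dir := closure (diag_succ p) 500 Leaf [::]
  (flatten (map (stop_succ p dir) (borrow_states p dir))).

Lemma borrow_check7 : exists l1 l2, borrow_check 7 false l1 l2.
Proof. by exists (borrow_states 7 false), (diag_states 7 false); vm_compute. Qed.

Lemma borrow_check13 : exists l1 l2, borrow_check 13 true l1 l2.
Proof. by exists (borrow_states 13 true), (diag_states 13 true); vm_compute. Qed.

Definition dcode (dir : bool) t := if dir then ((code t).2, (code t).1) else code t.

(** From the lowest digit up, the chosen component reads 0 against 1 while a borrow is pending, once
    1 against 0, and then t and t' agree. [l1] holds the states of the first phase and [l2] those of
    the last, all with value 1 at the origin. *)
Lemma state_val_borrow p dir l1 l2 t t' : p \in [:: 5; 7; 13] ->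
    borrow_check p dir l1 l2 ->
    dcode dir t = ((dcode dir t').1.+1, (dcode dir t').2) ->
  state_val p t t' (init p) = 1.
Proof.
move=> pP /and3P[init_l1 /allP chk1 /allP chk2].
have diag s u : s \in l2 -> state_val p u u s = 1.
  suff: forall u u', u = u' -> forall s, s \in l2 -> state_val p u u' s = 1.
    by move=> diag /(diag u u); apply.
  apply: push_ind2 => [_|v v' a b IH e] {}s /chk2/andP[/allP ds s0].
    by rewrite state0E s0.
  have [ea ev] : a = b /\ v = v'.
    by move: e; rewrite /push; case: a b => [[] []] [[] []] /= e; split=> //; lia.
  rewrite -ea state_val_step4 //; apply: (IH ev); apply: ds.
  exact: (map_f (fun d => step4 p d d s) (mem_digits a)).
have dcode_push v a : exists u x, a = mkdigit dir u x /\
    dcode dir (push v a) = ((dcode dir v).1.*2 + u, (dcode dir v).2.*2 + x)%N.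
  by exists (if dir then a.2 else a.1), (if dir then a.1 else a.2);
     rewrite /dcode code_push /mkdigit; case: (dir); case: a.
move: (init p) init_l1; move: t t'; apply: push_ind2 => [s|t t' a b IH s] sl1.
  by rewrite /dcode; case: (dir).
have [u [x [-> ->]]] := dcode_push t a; have [v [y [-> ->]]] := dcode_push t' b.
rewrite state_val_step4 //=; have /andP[/allP s1 /allP s2] := chk1 _ sl1.
move=> [e1 e2]; have [exy e2'] : x = y /\ (dcode dir t).2 = (dcode dir t').2.
  by case: x y e2 => [] [] /= e2; split=> //; lia.
have mem2 (z : bool) : z \in [:: false; true] by case: z.
rewrite -exy; case: u v e1 => [] [] /= e1; try by lia.
  have ett : t = t'.
    apply: code_inj; move: e1 e2'; rewrite /dcode.
    rewrite (surjective_pairing (code t)) (surjective_pairing (code t')).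
    by case: (dir) => /= *; congr (_, _); lia.
  rewrite -ett; apply: diag; apply: s2.
  exact: (map_f (fun x => step4 p (mkdigit dir true x) (mkdigit dir false x) s)).
apply: IH; last by rewrite (surjective_pairing (dcode dir t)) e2'; congr (_, _); lia.
apply: s1.
exact: (map_f (fun x => step4 p (mkdigit dir false x) (mkdigit dir true x) s)).
Qed.

Lemma state_val_init p t t' : state_val p t t' (init p) =
  cz p (t%:Z - t'%:Z) (p%:Z * t'%:Z - t%:Z + (p %/ 6)%:Z).
Proof.
rewrite /state_val /init; cbn [fst snd]; rewrite window_ncons /= mul1r !addr0.
by congr (cz _ _ _); lia.
Qed.

Lemma hcoef_cz p j n : (0 < j)%N -> hcoef p j n = cz p j (n%:Z - p%:Z * j%:Z).
Proof.
case: j => // j _; rewrite /hcoef fcoef_fpsXn.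
case: leqP => [le|lt].
  by rewrite (_ : n%:Z - p%:Z * j.+1%:Z = (n - p * j.+1)%N%:Z) ?cz_pos //; lia.
by rewrite /cz (_ : (0 <= _) = false) ?andbF //; lia.
Qed.

(** All exponents of h_13 are even. *)
Lemma cz13_odd (j m : int) : cz 13 (j + j + 1) (m + m + 1) = 0.
Proof.
rewrite cz_odd big_seq big1 // => c; rewrite !inE => cP; rewrite /czhalf.
by rewrite (_ : (_ == 0) = false) //; lia.
Qed.

Definition ebase t : ser := serD ^+ (6 * t).+1.
Definition tcoef p t t' : 'F_2 := state_val p t t' (init p).

(** The exponent 6 t + 1 - (p - 1) j equals 6 t' + 1 for t' = t - d j, with d = (p - 1) / 6. For p =
    13 the remaining t' get coefficient 0 by [cz13_odd]. *)
Lemma hecke_ebase p t : p \in [:: 7; 13] ->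
  hecke p (ebase t) = \sum_(t' < t) tcoef p t t' *: ebase t'.
Proof.
move=> pP; have pP' : p \in [:: 5; 7; 13] by rewrite inE pP orbT.
have [d0 pE] : (0 < p %/ 6)%N /\ p = (6 * (p %/ 6)).+1.
  by move: pP; rewrite !inE => /orP[] /eqP->.
set d := (p %/ 6)%N in d0 pE.
rewrite /ebase hecke_serD // /hecke_pow.
pose A j := hcoef p j (6 * t).+1 *: serD ^+ ((6 * t).+1 - p.-1 * j).
have A0 : A 0 = 0 by rewrite /A hcoef0 scale0r.
have -> : \sum_(1 <= j < (6 * t).+2) A j = \sum_(j < (t %/ d).+1) A j.
  rewrite -(big_mkord xpredT A) (big_ltn (ltn0Sn _)) A0 add0r.
  have td : ((t %/ d).+1 <= (6 * t).+2)%N by have := leq_div t d; lia.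
  rewrite (big_cat_nat (n := (t %/ d).+1)) //= [X in _ + X]big_nat.
  rewrite [X in _ + X]big1 ?addr0 // => j /andP[ltj _].
  rewrite /A hcoef_eq0 ?scale0r //.
  have : (t < j * d)%N by rewrite -ltn_divLR.
  by rewrite pE; nia.
rewrite -sum_dvdn // big_ord_recl dvdn0 div0n A0 add0r.
rewrite [RHS](reindex_inj rev_ord_inj) /=; apply: eq_bigr => i _.
rewrite /bump /= add1n; have lit : (i.+1 <= t)%N := ltn_ord i.
rewrite /tcoef state_val_init -/d.
have -> : t%:Z - (t - i.+1)%N%:Z = i.+1%:Z by lia.
case: ifP => [/dvdnP[j def_i]|ndvd].
  have j0 : (0 < j)%N by case: j def_i.
  rewrite def_i mulnK // /A hcoef_cz //; congr (_ *: serD ^+ _); last by lia.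
  (* For p = 13 Frobenius replaces h^-j by h^-(2j) at the doubled position, so that the exponent is
     t - t' for both primes. *)
  have [[dE p7]|[dE p13]] : (d = 1 /\ p = 7)%N \/ (d = 2 /\ p = 13)%N.
    by move: pP; rewrite /d !inE => /orP[] /eqP->; [left|right].
    by rewrite dE; congr cz; lia.
  by rewrite -cz_even dE; congr cz; lia.
have [p13 i_odd] : p = 13%N /\ ~~ odd i.
  move: pP ndvd; rewrite /d !inE => /orP[] /eqP->; first by rewrite dvd1n.
  by rewrite dvdn2 /= => /negbFE.
rewrite /d p13 (_ : i.+1%:Z = i./2%:Z + i./2%:Z + 1); last by lia.
pose m : int := (6 * t)%N%:Z - (13 * i./2)%N%:Z - 6%N%:Z.
have -> : 13%:Z * (t - i.+1)%N%:Z - t%:Z + (13 %/ 6)%N%:Z = m + m + 1 by rewrite /m; lia.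
by rewrite cz13_odd scale0r.
Qed.

(** * Spans of powers of D *)

Section Spans.
Implicit Types (b : nat -> ser) (P Q : pred nat) (f g : ser).

(** Over Z/2 a linear combination is the sum of a list, repetitions cancelling in pairs. *)
Definition spans b P f := exists2 s : seq nat, all P s & f = \sum_(k <- s) b k.

Lemma spans0 b P : spans b P 0.
Proof. by exists [::]; rewrite ?big_nil. Qed.

Lemma spans_base b P k : P k -> spans b P (b k).
Proof. by move=> Pk; exists [:: k]; rewrite ?big_seq1 //= Pk. Qed.

Lemma spansD b P f g : spans b P f -> spans b P g -> spans b P (f + g).
Proof.
by move=> [r rP ->] [s sP ->]; exists (r ++ s); rewrite ?all_cat ?rP ?big_cat.
Qed.

Lemma spansZ b P (a : 'F_2) f : spans b P f -> spans b P (a *: f).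
Proof.
by case: (F2_cases a) => -> fP; rewrite ?scale0r ?scale1r //; apply: spans0.
Qed.

Lemma spans_sum b P (I : eqType) (r : seq I) (S : pred I) (F : I -> ser) :
    (forall i, i \in r -> S i -> spans b P (F i)) ->
  spans b P (\sum_(i <- r | S i) F i).
Proof.
move=> FP; rewrite big_seq_cond; elim/big_rec: _ => [|i f /andP[ri Si] fP].
  exact: spans0.
by apply: spansD => //; apply: FP.
Qed.

Lemma spansW b P Q f : (forall k, P k -> Q k) -> spans b P f -> spans b Q f.
Proof. by move=> PQ [s sP ->]; exists s => //; apply: sub_all sP. Qed.

Lemma spans_pred0 b P f : (forall k, ~~ P k) -> spans b P f -> f = 0.
Proof.
move=> P0 [[|k s]]; first by rewrite big_nil.
by rewrite /= (negPf (P0 k)).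
Qed.

Lemma spans_uniq b P f : spans b P f ->
  exists2 s : seq nat, uniq s && all P s & f = \sum_(k <- s) b k.
Proof.
move=> [s sP ->]; elim: s sP => [_|k s IH /= /andP[Pk /IH[r /andP[ur rP] rE]]].
  by exists [::].
rewrite big_cons rE; have [kr|kr] := boolP (k \in r).
  exists (rem k r); first by rewrite rem_uniq //; apply/allP => x /mem_rem; exact: (allP rP).
  by rewrite (big_rem k kr) /= addrA serDD add0r.
by exists (k :: r); rewrite /= ?kr ?ur ?Pk // big_cons.
Qed.

Lemma spans_additive b b' P P' (T : ser -> ser) f :
    T 0 = 0 -> {morph T : f g / f + g} -> (forall k, P k -> spans b' P' (T (b k))) ->
  spans b P f -> spans b' P' (T f).
Proof.
move=> T0 TD Tb [s sP ->]; elim: s sP => [_|k s IH /= /andP[Pk /IH sP]].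
  by rewrite big_nil T0; apply: spans0.
by rewrite big_cons TD; apply: spansD; first exact: Tb.
Qed.

Lemma spans_hecke b b' P P' p f :
    (forall k, P k -> spans b' P' (hecke p (b k))) ->
  spans b P f -> spans b' P' (hecke p f).
Proof. exact: spans_additive (hecke0 p) (@heckeD p). Qed.

End Spans.

Lemma hinv5_supp : supp_mod 6 0 (hinv 5).
Proof.
elim/ltn_ind => n IH nn; rewrite fcoef_hinv_rec big_cons big_nil.
case: n IH nn => [//|n] IH nn; rewrite add0r.
case: ifP => [l|_]; last by [].
rewrite addr0; apply: IH; first by lia.
by apply: contra nn; lia.
Qed.

Definition Dpow k : ser := serD ^+ k.

Lemma spans_hecke_Dpow p n : p \in [:: 5; 7; 13] ->
  spans Dpow (fun k => [&& 0 < k, k < n & k == p * n %[mod 6]])%N (hecke p (Dpow n)).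
Proof.
move=> pP; rewrite /Dpow hecke_serD // /hecke_pow; apply: spans_sum => j.
rewrite mem_index_iota => /andP[j0 _] _.
have [lnj|ljn] := ltnP n (p * j); first by rewrite hcoef_eq0 // scale0r; apply: spans0.
have [-> |hj] := eqVneq (hcoef p j n) 0; first by rewrite scale0r; apply: spans0.
apply: spansZ; apply: (@spans_base Dpow).
(* For p = 7 and 13 the exponent drops by multiples of 6. For p = 5 the series h_5^-j lives in
   degrees divisible by 6, which forces n = 5 j modulo 6. *)
move: pP ljn hj; rewrite !inE => /or3P[] /eqP-> ljn hj; try lia.
suff : (n - 5 * j == 0 %[mod 6])%N by lia.
apply: contraR hj => nj; rewrite /hcoef fcoef_fpsXn ljn.
by have := supp_modX (k := j) hinv5_supp; rewrite muln0 => ->.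
Qed.

Definition wexp k := (0 < k)%N && coprime k 6.

Lemma wexpE k : wexp k = (k %% 6 == 1)%N || (k %% 6 == 5)%N.
Proof.
rewrite /wexp -coprime_modl; case: k => [|k] //; rewrite andTb.
by have := @ltn_pmod k.+1 6 isT; move: (k.+1 %% 6)%N; do 6![case=> [//|]].
Qed.

Lemma W_predP f : f \in W_pred <-> spans Dpow wexp f.
Proof.
split=> [/asboolP[s sP ->]|[s sP ->]].
  by apply: spans_sum => ck cks _; apply/spansZ/spans_base/(allP sP).
apply/asboolP; exists [seq (1, k) | k <- s]; first by rewrite all_map.
by rewrite big_map; apply: eq_bigr => k _; rewrite scale1r.
Qed.

Lemma hecke_W p f : p \in [:: 5; 7; 13] -> f \in W_pred -> hecke p f \in W_pred.
Proof.
move=> pP /W_predP fW; apply/W_predP; apply: spans_hecke fW => k.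
rewrite wexpE => kP; apply: spansW (spans_hecke_Dpow k pP) => i /and3P[_ _ ik].
by rewrite wexpE; move: pP ik kP; rewrite !inE => /or3P[] /eqP->; lia.
Qed.

(** T_5, T_7 and T_13 lower this filtration, so a power series acts on each step through finitely
    many terms. *)
Definition below N := spans Dpow (fun k => k < N)%N.

Lemma hecke_below p N f : p \in [:: 5; 7; 13] -> below N f -> below N.-1 (hecke p f).
Proof.
move=> pP; apply: spans_hecke => k lkN.
by apply: spansW (spans_hecke_Dpow k pP) => i; lia.
Qed.

Lemma below0 f : below 0 f -> f = 0. Proof. exact: spans_pred0. Qed.

Lemma belowW M N f : (M <= N)%N -> below M f -> below N f.
Proof. by move=> leMN; apply: spansW => k; lia. Qed.

Lemma spans_below P f : spans Dpow P f -> exists N, below N f.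
Proof.
move=> [s _ ->]; exists (\max_(k <- s) k).+1; exists s => //.
by apply/allP => k ks; rewrite ltnS; apply: leq_bigmax_seq.
Qed.

(** * The action of power series *)

Definition mono i j (f : ser) : ser := iter i (hecke 7) (iter j (hecke 13) f).

Lemma iter0 (T : Type) (f : T -> T) x : iter 0 f x = x. Proof. by []. Qed.

Lemma heckeZ p (a : 'F_2) (f : ser) : hecke p (a *: f) = a *: hecke p f.
Proof. by case: (F2_cases a) => ->; rewrite ?scale0r ?scale1r ?hecke0. Qed.

Lemma monoD i j : {morph mono i j : f g / f + g}.
Proof.
move=> f g; rewrite /mono; elim: i => [|i IH]; last by rewrite !iterS IH heckeD.
by rewrite !iter0; elim: j => // j IH; rewrite !iterS IH heckeD.
Qed.

Lemma mono0 i j : mono i j 0 = 0.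
Proof. by have := monoD i j 0 0; rewrite addr0 => /esym/eqP; rewrite -subr_eq0 addrK => /eqP. Qed.

Lemma mono_sum i j I (r : seq I) (P : pred I) (F : I -> ser) :
  mono i j (\sum_(k <- r | P k) F k) = \sum_(k <- r | P k) mono i j (F k).
Proof. by elim/big_rec2: _ => [|k x y _ <-]; rewrite ?mono0 ?monoD. Qed.

Lemma monoZ i j (a : 'F_2) f : mono i j (a *: f) = a *: mono i j f.
Proof. by case: (F2_cases a) => ->; rewrite ?scale0r ?scale1r ?mono0. Qed.

Lemma mono_hecke p i j f : prime p -> p \notin [:: 7; 13] ->
  mono i j (hecke p f) = hecke p (mono i j f).
Proof.
move=> p_pr; rewrite !inE negb_or => /andP[n7 n13]; rewrite /mono.
elim: i => [|i IH]; last by rewrite !iterS IH heckeC // eq_sym.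
by rewrite !iter0; elim: j => // j IH; rewrite !iterS IH heckeC // eq_sym.
Qed.

Lemma mono_mono i j k l f : mono i j (mono k l f) = mono (i + k) (j + l) f.
Proof.
rewrite /mono !iterD; congr (iter i _ _).
elim: j => // j IH; rewrite iterS IH iterS; elim: k {IH} => // k IH.
by rewrite !iterS heckeC // IH.
Qed.

Lemma mono_below i j N f : below N f -> below (N - (i + j)) (mono i j f).
Proof.
move=> fN; rewrite /mono; elim: i => [|i IH]; last first.
  by rewrite addSn subnS iterS; apply: hecke_below.
by elim: j => [|j IH]; rewrite ?subn0 // iterS add0n subnS; apply: hecke_below.
Qed.

Lemma mono_eq0 i j N f : below N f -> (N <= i + j)%N -> mono i j f = 0.
Proof. by move=> /(mono_below i j) fN; rewrite -subn_eq0 => /eqP e; apply: below0; rewrite -e. Qed.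

Lemma ser_actE N u f : below N f ->
  ser_act u f = \sum_(i < N) \sum_(j < N) coefXY u i j *: mono i j f.
Proof.
move=> fN; rewrite /ser_act.
rewrite (fsbigE [seq (i, j) | i <- iota 0 N, j <- iota 0 N]) /=; first last.
- move=> [i j] _ nij /=; rewrite -/(mono i j f) (mono_eq0 fN) ?scaler0 //.
  rewrite leqNgt; apply: contra nij => lij.
  by apply/allpairsP; exists (i, j); split=> //=; rewrite mem_iota; lia.
- by [].
- by apply: allpairs_uniq => [||[? ?] [? ?]]; rewrite ?iota_uniq.
under eq_bigl do rewrite classical_sets.in_setT.
have iotaE : iota 0 N = index_iota 0 N by rewrite /index_iota subn0.
by rewrite big_allpairs_dep iotaE big_mkord; apply: eq_bigr => i _; rewrite big_mkord.
Qed.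

(** Summation along antidiagonals, needed to compare the product of series with the composite of
    their actions. *)
Lemma sum_cauchy (V : nmodType) N (H : nat -> nat -> V) :
    (forall a k, (N <= a + k)%N -> H a k = 0) ->
  \sum_(a < N) \sum_(k < N) H a k = \sum_(i < N) \sum_(a < i.+1) H a (i - a)%N.
Proof.
move=> H0.
under [RHS]eq_bigr => i _ do
  rewrite (big_ord_widen N (fun a => H a (i - a)%N)) ?ltn_ord //.
rewrite [RHS](exchange_big_dep xpredT) //=; apply: eq_bigr => a _.
have laN : (a <= N)%N by apply: ltnW.
rewrite -(big_mkord xpredT (H a)) -(big_mkord (fun i => a < i.+1)%N (fun i => H a (i - a)%N)).
rewrite [RHS](big_cat_nat (n := a)) //= [X in _ = X + _]big_nat_cond.
rewrite [X in _ = X + _]big1 ?add0r => [|i]; last by lia.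
rewrite -{2}[nat_of_ord a]add0n big_addn [RHS]big_mkcond.
under [RHS]eq_bigr do rewrite addnK ltnS leq_addl.
rewrite [LHS](big_cat_nat (n := (N - a)%N)) ?leq_subr //= [X in _ + X]big_nat.
by rewrite [X in _ + X]big1 ?addr0 // => k /andP[lk _]; apply: H0; lia.
Qed.

Lemma ser_act_below N u f : below N f -> below N (ser_act u f).
Proof.
move=> fN; rewrite (ser_actE _ fN); apply: spans_sum => i _ _.
apply: spans_sum => j _ _; apply: spansZ.
by apply: belowW (mono_below i j fN); apply: leq_subr.
Qed.

Lemma coefXYM u v i j : coefXY (u * v) i j =
  \sum_(b < j.+1) \sum_(a < i.+1) coefXY u a b * coefXY v (i - a) (j - b).
Proof.
rewrite /coefXY fcoefM fcoef_sum; apply: eq_bigr => b _.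
by rewrite fcoefM.
Qed.

Lemma ser_actM N u v f : below N f -> ser_act (u * v) f = ser_act u (ser_act v f).
Proof.
move=> fN; rewrite (ser_actE _ (ser_act_below v fN)) !(ser_actE _ fN).
pose H a b k l := (coefXY u a b * coefXY v k l) *: mono (a + k) (b + l) f.
transitivity (\sum_(a < N) \sum_(k < N) \sum_(b < N) \sum_(l < N) H a b k l).
  rewrite (@sum_cauchy _ N (fun a k => \sum_(b < N) \sum_(l < N) H a b k l)) => [|a k lak];
    last first.
    by apply: big1 => b _; apply: big1 => l _; rewrite /H (mono_eq0 fN) ?scaler0 //; lia.
  apply: eq_bigr => i _.
  rewrite [RHS](eq_bigr (fun a : 'I_i.+1 =>
    \sum_(j < N) \sum_(b < j.+1) H a b (i - a)%N (j - b)%N));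
    last first.
    move=> a _; apply: (@sum_cauchy _ N (fun b l => H a b (i - a)%N l)) => b l lbl.
    by rewrite /H (mono_eq0 fN) ?scaler0 //; lia.
  rewrite [RHS]exchange_big; apply: eq_bigr => j _.
  rewrite coefXYM scaler_suml [RHS]exchange_big; apply: eq_bigr => b _.
  rewrite scaler_suml; apply: eq_bigr => a _; rewrite /H.
  by rewrite !subnKC // -ltnS ltn_ord.
apply: eq_bigr => a _; rewrite exchange_big; apply: eq_bigr => b _.
rewrite mono_sum scaler_sumr; apply: eq_bigr => k _.
rewrite mono_sum scaler_sumr; apply: eq_bigr => l _.
by rewrite monoZ mono_mono scalerA.
Qed.

Lemma ser_actDl N u v f : below N f -> ser_act (u + v) f = ser_act u f + ser_act v f.
Proof.
move=> fN; rewrite !(ser_actE _ fN) -big_split; apply: eq_bigr => i _.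
by rewrite -big_split; apply: eq_bigr => j _; exact: scalerDl.
Qed.

Lemma ser_actDr N u f g : below N f -> below N g ->
  ser_act u (f + g) = ser_act u f + ser_act u g.
Proof.
move=> fN gN; rewrite (ser_actE _ (spansD fN gN)) !(ser_actE _ fN, ser_actE _ gN).
rewrite -big_split; apply: eq_bigr => i _.
by rewrite -big_split; apply: eq_bigr => j _; rewrite monoD; exact: scalerDr.
Qed.

Lemma ser_act0l N f : below N f -> ser_act 0 f = 0.
Proof.
move=> fN; rewrite (ser_actE _ fN) big1 // => i _; rewrite big1 // => j _.
by rewrite [coefXY _ _ _](_ : _ = 0) ?scale0r.
Qed.

Lemma ser_act_delta N u a b f : below N f ->
    (forall i j, coefXY u i j = ((i == a) && (j == b))%:R) ->
  ser_act u f = mono a b f.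
Proof.
move=> fN uE; have fM : below (maxn N (maxn a b).+1) f by apply: belowW fN; apply: leq_maxl.
have la : (a < maxn N (maxn a b).+1)%N by lia.
have lb : (b < maxn N (maxn a b).+1)%N by lia.
rewrite (ser_actE _ fM) (bigD1 (Ordinal la)) //= (bigD1 (Ordinal lb)) //=.
rewrite uE !eqxx scale1r big1 => [|j jb]; last first.
  by rewrite uE eqxx (_ : _ == _ = false) ?scale0r //; apply/negbTE.
rewrite addr0 big1 ?addr0 // => i ia; apply: big1 => j _.
by rewrite uE (_ : _ == a = false) ?scale0r //; apply/negbTE.
Qed.

Lemma coefXY1 i j : coefXY 1 i j = ((i == 0) && (j == 0))%:R.
Proof.
rewrite /coefXY (@fcoef1 (fps _)); case: (j == 0); rewrite ?andbT ?andbF //.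
exact: fcoef1.
Qed.

Lemma coefXY_serX i j : coefXY serX i j = ((i == 1) && (j == 0))%:R.
Proof. by rewrite /coefXY /=; case: (j == 0); rewrite ?andbT ?andbF. Qed.

Lemma coefXY_serY i j : coefXY serY i j = ((i == 0) && (j == 1))%:R.
Proof.
rewrite /coefXY /=; case: (j == 1); rewrite ?andbT ?andbF //.
exact: fcoef1.
Qed.

Lemma ser_act_W u f : f \in W_pred -> ser_act u f \in W_pred.
Proof.
move=> fW; have [N fN] := spans_below ((W_predP f).1 fW).
rewrite (ser_actE _ fN); apply: rpred_sum => i _; apply: rpred_sum => j _.
have monoW : mono i j f \in W_pred.
  rewrite /mono; elim: (nat_of_ord i) => [|k IH]; last by rewrite iterS hecke_W.
  by rewrite iter0; elim: (nat_of_ord j) => // l IH; rewrite iterS hecke_W.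
by case: (F2_cases (coefXY u i j)) => ->; rewrite ?scale0r ?scale1r ?rpred0.
Qed.

Lemma ser_act_hecke p N u f : p \in [:: 5; 7; 13] -> prime p -> p \notin [:: 7; 13] ->
  below N f -> ser_act u (hecke p f) = hecke p (ser_act u f).
Proof.
move=> pP p_pr pn fN.
have pfN : below N (hecke p f) by apply: belowW (hecke_below pP fN); apply: leq_pred.
rewrite (ser_actE _ pfN) (ser_actE _ fN) hecke_sum; apply: eq_bigr => i _.
by rewrite hecke_sum; apply: eq_bigr => j _; rewrite heckeZ mono_hecke.
Qed.

(** * Leading terms *)

Definition lexlt (x y : nat * nat) := (x.1 < y.1)%N || (x.1 == y.1) && (x.2 < y.2)%N.

Lemma cwE t i j : code t = (i, j) -> cw t = (i + j, j)%N.
Proof. by rewrite /cw => ->. Qed.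

Lemma cw_inj : injective cw.
Proof.
move=> t t'; rewrite /cw /wt => -[e1 e2]; apply: code_inj.
by rewrite (surjective_pairing (code t)) (surjective_pairing (code t')) e2;
   congr (_, _); lia.
Qed.

(* The lexicographic drop of the weight (i + j, j) under T_7, resp. T_13. *)
Definition drop_wt (p : nat) : nat * nat := if p == 7 then (1, 0)%N else (1, 1)%N.

Lemma tcoef_wt p t t' : p \in [:: 7; 13] -> tcoef p t t' != 0 ->
  lexle (addp (drop_wt p) (cw t')) (cw t).
Proof.
rewrite !inE => /orP[] /eqP->.
  by have [l cert] := certificate7; apply: state_val_potential cert.
by have [l cert] := certificate13; apply: state_val_potential cert.
Qed.

Lemma tcoef_lead p t t' : p \in [:: 7; 13] ->
  addp (drop_wt p) (cw t') = cw t -> tcoef p t t' = 1.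
Proof.
rewrite !inE => pP; rewrite /addp /cw /wt => -[]; move: pP.
move=> /orP[] /eqP->; cbn [drop_wt fst snd eqn] => e1 e2.
  have [l1 [l2 chk]] := borrow_check7; apply: state_val_borrow chk _ => //.
  by rewrite /dcode (surjective_pairing (code t)); congr (_, _); move: e1 e2; rewrite /drop_wt /=; lia.
have [l1 [l2 chk]] := borrow_check13; apply: state_val_borrow chk _ => //.
by rewrite /dcode /=; congr (_, _); move: e1 e2; rewrite /drop_wt /=; lia.
Qed.

Lemma tcoef_ge p t t' : (t <= t')%N -> tcoef p t t' = 0.
Proof.
move=> le_tt'; rewrite /tcoef state_val_init /cz (_ : 0 < _ = false) //.
by apply/negbTE; lia.
Qed.

Section WeightFiltration.
Variables (lex : rel (nat * nat)).
Hypothesis lex_add : forall p d t t' c, p \in [:: 7; 13] ->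
  lexle (addp (drop_wt p) (cw t')) (cw t) -> lex (addp d (cw t)) c ->
  lex (addp (addp d (drop_wt p)) (cw t')) c.

Lemma hecke_spans_wt p d c f : p \in [:: 7; 13] ->
    spans ebase (fun t => lex (addp d (cw t)) c) f ->
  spans ebase (fun t => lex (addp (addp d (drop_wt p)) (cw t)) c) (hecke p f).
Proof.
move=> pP; apply: spans_hecke => t tc; rewrite hecke_ebase //.
apply: spans_sum => t' _ _; have [->|ntt'] := eqVneq (tcoef p t t') 0.
  by rewrite scale0r; apply: spans0.
apply: spansZ; apply: (@spans_base ebase).
by apply: lex_add tc => //; apply: tcoef_wt.
Qed.

End WeightFiltration.

Lemma lexle_add p d t t' c : p \in [:: 7; 13] ->
  lexle (addp (drop_wt p) (cw t')) (cw t) -> lexle (addp d (cw t)) c ->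
  lexle (addp (addp d (drop_wt p)) (cw t')) c.
Proof. by rewrite /lexle /addp /= => _; lia. Qed.

Lemma lexlt_add p d t t' c : p \in [:: 7; 13] ->
  lexle (addp (drop_wt p) (cw t')) (cw t) -> lexlt (addp d (cw t)) c ->
  lexlt (addp (addp d (drop_wt p)) (cw t')) c.
Proof. by rewrite /lexle /lexlt /addp /= => _; lia. Qed.

Lemma mono_ebase_wt a b t :
  spans ebase (fun t' => lexle (addp (a + b, b)%N (cw t')) (cw t)) (mono a b (ebase t)).
Proof.
rewrite /mono; elim: a => [|a IH].
  rewrite iter0; elim: b => [|b IH].
    by apply: (@spans_base ebase); rewrite /lexle /addp /=; lia.
  rewrite iterS; apply: spansW (hecke_spans_wt lexle_add (p := 13) isT IH) => t'.
  by rewrite /lexle /addp /=; lia.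
rewrite iterS; apply: spansW (hecke_spans_wt lexle_add (p := 7) isT IH) => t'.
by rewrite /lexle /addp /=; lia.
Qed.

Lemma mono_ebase_eq0 a b t : lexlt (cw t) (a + b, b)%N -> mono a b (ebase t) = 0.
Proof.
move=> lt; apply: spans_pred0 (mono_ebase_wt a b t) => t'.
by move: lt; rewrite /lexlt /lexle /addp /=; lia.
Qed.

Lemma hecke_ebase_lead p t t' : p \in [:: 7; 13] ->
    addp (drop_wt p) (cw t') = cw t ->
  spans ebase (fun u => lexlt (addp (drop_wt p) (cw u)) (cw t))
    (hecke p (ebase t) + ebase t').
Proof.
move=> pP e; have c1 := tcoef_lead pP e.
have ltt : (t' < t)%N by rewrite ltnNge; apply/negP => /(tcoef_ge p) c0; move: c1; rewrite c0.
rewrite hecke_ebase // (bigD1 (Ordinal ltt)) //= c1 scale1r addrAC serDD add0r.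
apply: spans_sum => u _ ut; have [->|ntt] := eqVneq (tcoef p t u) 0.
  by rewrite scale0r; apply: spans0.
apply: spansZ; apply: (@spans_base ebase); have := tcoef_wt pP ntt.
have : cw u != cw t' by rewrite (inj_eq cw_inj).
move: (congr1 fst e) (congr1 snd e).
by rewrite /lexle /lexlt /addp -pair_eqE /pair_eq negb_and /=; lia.
Qed.

Lemma mono_ebase_lead a b t : code t = (a, b) -> mono a b (ebase t) = serD.
Proof.
move=> def_t.
(* Each T_13 takes 1 from j; the error stays strictly smaller than the leading term, measured by the
   weight it had at the start. [lead7] then does the same with T_7 for i. *)
have lead13 b' i j u u' : code u = (i, j + b')%N -> code u' = (i, j) ->
    spans ebase (fun v => lexlt (addp (b', b')%N (cw v)) (cw u))
      (iter b' (hecke 13) (ebase u) + ebase u').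
  elim: b' j u' => [|b' IH] j u' def_u def_u'.
    have -> : u = u' by apply: code_inj; rewrite def_u def_u' addn0.
    by rewrite iter0 serDD; apply: spans0.
  have [v def_v] := code_surj i j.+1.
  have cvu : addp (drop_wt 13) (cw u') = cw v.
    by rewrite (cwE def_u') (cwE def_v) /addp /=; congr (_, _); lia.
  have {}IH := IH j.+1 v _ def_v; rewrite addSnnS in IH.
  rewrite iterS -[hecke 13 _]addr0 -(serDD (hecke 13 (ebase v))) addrA -heckeD -addrA.
  apply: spansD.
    apply: spansW (hecke_spans_wt lexlt_add (p := 13) isT (IH def_u)) => w.
    by rewrite /lexlt /addp /=; lia.
  apply: spansW (hecke_ebase_lead (p := 13) isT cvu) => w.
  by rewrite (cwE def_v) (cwE def_u) /lexlt /addp /=; lia.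
have lead7 a' u' : (a' <= a)%N -> code u' = (a - a', 0)%N ->
    spans ebase (fun v => lexlt (addp (a' + b, b)%N (cw v)) (cw t))
      (mono a' b (ebase t) + ebase u').
  elim: a' u' => [|a' IH] u' laa def_u'.
    by rewrite subn0 in def_u'; apply: lead13 def_u'; rewrite def_t.
  have [v def_v] := code_surj (a - a') 0.
  have cvu : addp (drop_wt 7) (cw u') = cw v.
    by rewrite (cwE def_u') (cwE def_v) /addp /=; congr (_, _); lia.
  have {}IH := IH v (ltnW laa) def_v.
  rewrite /mono iterS -/(mono a' b _) -[hecke 7 _]addr0 -(serDD (hecke 7 (ebase v))).
  rewrite addrA -heckeD -addrA; apply: spansD.
    apply: spansW (hecke_spans_wt lexlt_add (p := 7) isT IH) => w.
    by rewrite /lexlt /addp /=; lia.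
  apply: spansW (hecke_ebase_lead (p := 7) isT cvu) => w.
  by rewrite (cwE def_v) (cwE def_t) /lexlt /addp /=; lia.
have c0 : code 0 = (a - a, 0)%N by rewrite subnn.
(* The error is empty: it would need a weight below (0, 0). *)
have := lead7 a 0 (leqnn a) c0; rewrite (cwE def_t) => /spans_pred0 e.
by apply: ser_eqD; rewrite -[X in _ + X](_ : ebase 0 = _) ?e // => v; rewrite /lexlt /addp /=; lia.
Qed.

(** * The operator T_5 *)

Definition fbase t : ser := serD ^+ (6 * t).+4.+1.

Lemma spans_trans b b' (P P' : pred nat) f :
  (forall k, P k -> spans b' P' (b k)) -> spans b P f -> spans b' P' f.
Proof. exact: (@spans_additive b b' P P' id). Qed.

Lemma Dpow_ebase k : (k %% 6 == 1)%N -> Dpow k = ebase (k %/ 6).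
Proof. by move=> k1; rewrite /Dpow /ebase; congr (_ ^+ _); lia. Qed.

Lemma Dpow_fbase k : (k %% 6 == 5)%N -> Dpow k = fbase (k %/ 6).
Proof. by move=> k5; rewrite /Dpow /fbase; congr (_ ^+ _); lia. Qed.

Lemma hecke5_ebase t : spans fbase xpredT (hecke 5 (ebase t)).
Proof.
have := @spans_hecke_Dpow 5 (6 * t).+1 isT; apply: spans_trans => k.
move=> /and3P[_ _ k5]; rewrite Dpow_fbase; last by lia.
exact: spans_base.
Qed.

Lemma fcoef_hinv5 t : fcoef (hinv 5) (6 * t) = 1.
Proof.
elim: t => [|t IH]; rewrite fcoef_hinv_rec big_cons big_nil.
  by rewrite addr0.
have -> : (6 <= 6 * t.+1)%N by lia.
by rewrite (_ : 6 * t.+1 - 6 = 6 * t)%N ?IH ?add0r ?addr0 //; lia.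
Qed.

(** T_5 is unitriangular from W_b to W_a: the term j = 1 of [hecke_pow] is D^(6t+1), and j > 1 gives
    smaller powers. *)
Lemma hecke5_fbase t : spans ebase (fun t' => t' < t)%N (hecke 5 (fbase t) + ebase t).
Proof.
rewrite /fbase hecke_serD // /hecke_pow big_ltn //.
have -> : hcoef 5 1 (6 * t).+4.+1 = 1.
  by rewrite /hcoef fcoef_fpsXn (_ : (5 * 1 <= _)%N) // expr1 -(fcoef_hinv5 t);
     congr fcoef; lia.
have -> : ((6 * t).+4.+1 - 5.-1 * 1 = (6 * t).+1)%N by lia.
rewrite scale1r addrAC serDD add0r; apply: spans_sum => j.
rewrite mem_index_iota => /andP[j1 _] _.
have [->|hj] := eqVneq (hcoef 5 j (6 * t).+4.+1) 0; first by rewrite scale0r; apply: spans0.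
have [ltj|lej] := ltnP (6 * t).+4.+1 (5 * j); first by rewrite hcoef_eq0 ?eqxx in hj.
have j6 : ((6 * t).+4.+1 - 5 * j == 0 %[mod 6])%N.
  apply: contraR hj => nj; rewrite /hcoef fcoef_fpsXn lej.
  by have := supp_modX (k := j) hinv5_supp; rewrite muln0 => ->.
apply: spansZ; rewrite -[_ ^+ _]/(Dpow _) Dpow_ebase; last by lia.
by apply: (@spans_base ebase); lia.
Qed.

Lemma hecke5_fbaseT t : spans ebase xpredT (hecke 5 (fbase t)).
Proof.
rewrite -[hecke 5 _]addr0 -(serDD (ebase t)) addrA; apply: spansD.
  exact: spansW (hecke5_fbase t).
exact: spans_base.
Qed.

Lemma seq_max (T : eqType) (le : rel T) x s : total le -> transitive le ->
  exists2 m, m \in x :: s & {in x :: s, forall i, le i m}.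
Proof.
move=> le_total le_trans; have le_refl y : le y y by case/orP: (le_total y y).
elim: s => [|y s [m ms mmax]].
  by exists x => [|i]; rewrite ?mem_head // inE => /eqP->.
have mem_ycons i : i \in [:: x, y & s] = (i == y) || (i \in x :: s).
  by rewrite !inE orbCA.
case/orP: (le_total m y) => [my|ym]; [exists y | exists m]; rewrite ?mem_ycons ?eqxx ?ms ?orbT //.
  by move=> i; rewrite mem_ycons => /orP[/eqP->//|/mmax /le_trans]; apply.
by move=> i; rewrite mem_ycons => /orP[/eqP->//|/mmax].
Qed.

Lemma Dpow_free s : uniq s -> \sum_(k <- s) Dpow k = 0 -> s = [::].
Proof.
case: s => // k0 s us e.
have [k ks kmin] := @seq_max _ geq k0 s (fun m n => leq_total n m)
  (fun m n k mn mk => leq_trans mk mn).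
have := congr1 (fun f => fcoef f k) e; rewrite fcoef_sum (bigD1_seq k) //.
rewrite /Dpow (serD_exp_lead k).2 big_seq_cond big1 ?addr0 // => i /andP[is_ ik].
by apply: (serD_exp_lead i).1; rewrite ltn_neqAle eq_sym ik; apply: kmin.
Qed.

Lemma hecke5_inj f : spans fbase xpredT f -> hecke 5 f = 0 -> f = 0.
Proof.
move=> /spans_uniq[s /andP[us _] ->].
case: s us => [|t0 s] us; first by rewrite big_nil.
have [t ts tmax] := seq_max t0 s leq_total leq_trans.
rewrite (bigD1_seq t) // heckeD => e.
have rest : spans ebase (fun t' => t' < t)%N
    (hecke 5 (\sum_(i <- t0 :: s | i != t) fbase i) + (hecke 5 (fbase t) + ebase t)).
  apply: spansD; last exact: hecke5_fbase.
  rewrite hecke_sum; apply: spans_sum => i /tmax lit nit.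
  have {}lit : (i < t)%N by rewrite ltn_neqAle nit.
  rewrite -[hecke 5 _]addr0 -(serDD (ebase i)) addrA; apply: spansD.
    by apply: spansW (hecke5_fbase i) => k; lia.
  exact: spans_base.
(* The largest index t would make D^(6t+1) a sum of smaller powers of D. *)
have et : spans ebase (fun t' => t' < t)%N (ebase t).
  by rewrite -[ebase t]add0r -e -addrA addrCA.
have [r /andP[ur rt] rE] := spans_uniq et.
suff : [seq (6 * i).+1 | i <- t :: r]%N = [::] by [].
apply: Dpow_free; last by rewrite big_map big_cons -rE; apply: serDD.
rewrite map_inj_uniq => [|i j]; last by lia.
by rewrite /= ur andbT; apply/negP => /(allP rt); rewrite ltnn.
Qed.

Lemma hecke5_surj f : spans ebase xpredT f ->
  exists2 g, spans fbase xpredT g & hecke 5 g = f.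
Proof.
have sum_pre (P : pred nat) h :
    (forall t, P t -> exists2 g, spans fbase xpredT g & hecke 5 g = ebase t) ->
    spans ebase P h -> exists2 g, spans fbase xpredT g & hecke 5 g = h.
  move=> preP [s sP ->]; elim: s sP => [_|t s IH /= /andP[/preP[g gf gE] /IH[k kf kE]]].
    by exists 0; rewrite ?hecke0 ?big_nil //; apply: spans0.
  by exists (g + k); rewrite ?heckeD ?gE ?kE ?big_cons //; apply: spansD.
apply: (sum_pre xpredT) => t _; elim/ltn_ind: t => t IH.
have [g gf gE] := sum_pre _ _ IH (hecke5_fbase t).
exists (fbase t + g); first by apply: spansD => //; apply: spans_base.
by rewrite heckeD gE addrA serDD add0r.
Qed.

Lemma spans_ebase_mono a b f : spans ebase xpredT f -> spans ebase xpredT (mono a b f).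
Proof.
apply: spans_additive (mono0 a b) (monoD a b) _ => t _.
exact: spansW (mono_ebase_wt a b t).
Qed.

Lemma lexle_total : total lexle.
Proof. by move=> x y; rewrite /lexle; lia. Qed.

Lemma lexle_trans : transitive lexle.
Proof. by move=> x y z; rewrite /lexle; lia. Qed.

(** For the largest label (a, b) occurring in f, T_7^a T_13^b sends that basis vector to D and kills
    the others. *)
Lemma mono_socle f : spans ebase xpredT f -> f != 0 ->
  exists a b, mono a b f = serD.
Proof.
move=> /spans_uniq[s /andP[us _] ->].
case: s us => [|t0 s] us; first by rewrite big_nil eqxx.
move=> _; have [t ts tmax] := @seq_max _ (fun u v => lexle (cw u) (cw v)) t0 s
  (fun u v => lexle_total (cw u) (cw v)) (fun u v w => @lexle_trans (cw u) (cw v) (cw w)).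
exists (code t).1, (code t).2; rewrite mono_sum (bigD1_seq t) //=.
rewrite mono_ebase_lead -?surjective_pairing // big_seq_cond.
rewrite big1 ?addr0 // => u /andP[/tmax le_ut ne_ut]; apply: mono_ebase_eq0.
rewrite -[X in lexlt _ X]/(cw t).
have : cw u != cw t by rewrite (inj_eq cw_inj).
by move: le_ut; rewrite -pair_eqE /pair_eq negb_and /lexle /lexlt /=; lia.
Qed.

Lemma spans_ebase_below f : spans ebase xpredT f -> exists N, below N f.
Proof.
move=> [s _ ->]; apply: (@spans_below xpredT).
by exists [seq (6 * t).+1 | t <- s]%N; rewrite ?all_predT // big_map.
Qed.

Lemma ser_act_mono N u a b f : below N f ->
  ser_act u (mono a b f) = mono a b (ser_act u f).
Proof.
move=> fN; have mN : below N (mono a b f).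
  by apply: belowW (mono_below a b fN); apply: leq_subr.
rewrite (ser_actE _ mN) (ser_actE _ fN) mono_sum; apply: eq_bigr => i _.
rewrite mono_sum; apply: eq_bigr => j _.
by rewrite monoZ !mono_mono [(i + a)%N]addnC [(j + b)%N]addnC.
Qed.

Lemma spans_ebase_act u f : spans ebase xpredT f -> spans ebase xpredT (ser_act u f).
Proof.
move=> fE; have [N fN] := spans_ebase_below fE; rewrite (ser_actE _ fN).
apply: spans_sum => i _ _; apply: spans_sum => j _ _; apply: spansZ.
exact: spans_ebase_mono.
Qed.

Lemma spans_hecke55 f : spans ebase xpredT f -> spans ebase xpredT (hecke 5 (hecke 5 f)).
Proof.
move=> fE; apply: spans_hecke (spans_hecke _ fE) => t _.
  exact: hecke5_fbaseT.
exact: hecke5_ebase.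
Qed.

Lemma ebase_supp24 t : supp_mod 24 (6 * t).+1 (ebase t).
Proof. exact: serD_exp_supp24. Qed.

Lemma mono_supp24 a b s f : supp_mod 24 s f -> supp_mod 24 s (mono a.*2 b.*2 f).
Proof.
have twice p g : p \in [:: 5; 7; 13] -> supp_mod 24 s g ->
    supp_mod 24 s (hecke p (hecke p g)).
  move=> pP gs; have [p0 pp] : (0 < p)%N /\ (p * p = 1 %[mod 24])%N.
    by move: pP; rewrite !inE => /or3P[] /eqP->.
  apply: supp_mod_eqmod (supp_mod_hecke p0 pp (supp_mod_hecke p0 pp gs)).
  by rewrite mulnA -modnMml pp modnMml mul1n.
rewrite /mono => fs; elim: a => [|a IH]; last by rewrite doubleS !iterS; apply: twice.
by rewrite iter0; elim: b => [//|b IH]; rewrite doubleS !iterS; apply: twice.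
Qed.

Lemma hecke55_supp24 s f : supp_mod 24 s f -> supp_mod 24 s (hecke 5 (hecke 5 f)).
Proof.
move=> fs; apply: supp_mod_eqmod (@supp_mod_hecke 24 5 _ _ isT erefl
  (@supp_mod_hecke 24 5 _ _ isT erefl fs)).
by lia.
Qed.

(** * Existence of lambda *)

Definition enc i j : nat := sval (cid (code_surj i j)).

Lemma code_enc i j : code (enc i j) = (i, j).
Proof. exact: svalP (cid (code_surj i j)). Qed.

Lemma sum_truncate (V : nmodType) m K (g : nat -> V) : (m <= K)%N ->
  (forall i, (m <= i)%N -> g i = 0) -> \sum_(i < K) g i = \sum_(i < m) g i.
Proof.
move=> lmK g0; rewrite (big_ord_widen K g lmK) [RHS]big_mkcond.
by apply: eq_bigr => i _; case: ltnP => // /g0.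
Qed.

Section TriangularSystem.
Variables (phi : nat -> nat -> 'F_2) (M : nat -> nat -> nat -> nat -> 'F_2).
Hypothesis M0 : forall i j a b, lexlt (a + b, b)%N (i + j, j)%N -> M i j a b = 0.
Hypothesis M1 : forall a b, M a b a b = 1.

Fixpoint triangular_sol n a b : 'F_2 :=
  if n is n'.+1 then
    phi a b - \sum_(i < (a + b).+1) \sum_(j < (a + b).+1)
      if lexlt (i + j, nat_of_ord j)%N (a + b, b)%N
      then triangular_sol n' i j * M i j a b else 0
  else 0.

Lemma triangular_system : exists c : nat -> nat -> 'F_2,
  forall K a b, (a + b < K)%N ->
    \sum_(i < K) \sum_(j < K) c i j * M i j a b = phi a b.
Proof.
(* This numbering increases strictly along the lexicographic order, since j is at most i + j; it
   measures the recursion depth needed. *)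
pose rk a b := ((a + b) ^ 2 + b)%N.
have rk_lt i j a b : lexlt (i + j, j)%N (a + b, b)%N -> (rk i j < rk a b)%N.
  by rewrite /lexlt /rk /= => /orP[l|/andP[/eqP-> l]]; [nia | rewrite ltn_add2l].
have stable n m a b : (rk a b < n)%N -> (rk a b < m)%N ->
    triangular_sol n a b = triangular_sol m a b.
  elim: n m a b => [//|n IH] [//|m] a b ln lm /=; congr (_ - _).
  apply: eq_bigr => i _; apply: eq_bigr => j _.
  by case: ifP => // /rk_lt l; rewrite (IH m) //; lia.
exists (fun a b => triangular_sol (rk a b).+1 a b) => K a b lK.
pose c a b := triangular_sol (rk a b).+1 a b.
pose G i j := if lexlt (i + j, j)%N (a + b, b)%N then c i j * M i j a b else 0.
have cE : c a b = phi a b - \sum_(i < K) \sum_(j < K) G i j.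
  rewrite (@sum_truncate _ (a + b).+1 K (fun i => \sum_(j < K) G i j)) //; last first.
    move=> i li; apply: big1 => j _; rewrite /G ifN // /lexlt /=; lia.
  rewrite {1}/c /=; congr (_ - _); apply: eq_bigr => i _.
  rewrite (@sum_truncate _ (a + b).+1 K) //; last first.
    by move=> j lj; rewrite /G ifN // /lexlt /=; lia.
  apply: eq_bigr => j _; rewrite /G; case: ifP => // /rk_lt l.
  by rewrite /c (stable _ (rk i j).+1).
have la : (a < K)%N by lia.
have lb : (b < K)%N by lia.
transitivity (\sum_(i < K) \sum_(j < K) (G i j + if (i == a :> nat) && (j == b :> nat)
    then c a b else 0)).
  apply: eq_bigr => i _; apply: eq_bigr => j _; rewrite -/(c i j) /G.
  case: ifP => [l|nl].
    by rewrite ifN ?addr0 //; apply/negP => /andP[/eqP ia /eqP jb]; move: l;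
       rewrite ia jb /lexlt /= !ltnn eqxx.
  rewrite add0r; case: ifP => [/andP[/eqP-> /eqP->]|ne]; first by rewrite M1 mulr1.
  rewrite M0 ?mulr0 //; move: nl ne; rewrite /lexlt /=; lia.
under eq_bigr do rewrite big_split.
rewrite big_split /= [X in _ + X](bigD1 (Ordinal la)) //=.
rewrite [X in _ + (X + _)](bigD1 (Ordinal lb)) //= !eqxx /=.
rewrite [X in _ + (_ + X + _)]big1 => [|j jb]; last first.
  by rewrite ifN //; apply: contra jb.
rewrite [X in _ + (_ + X)]big1 => [|i ia]; last first.
  by apply: big1 => j _; rewrite ifN // negb_and; apply/orP; left; apply: contra ia.
by rewrite !addr0 cE addrC subrK.
Qed.

End TriangularSystem.

Lemma coefXY_sqr l i j : coefXY (l ^+ 2) i j =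
  if odd i || odd j then 0 else coefXY l i./2 j./2.
Proof.
rewrite /coefXY (fcoef_sqr F2_pchar); case: (odd j); first by rewrite orbT.
by rewrite (fcoef_sqr pchar_F2) orbF F2_sqr.
Qed.

Lemma sum_double (V : nmodType) K (F : nat -> V) : (forall i, odd i -> F i = 0) ->
  \sum_(i < K.*2) F i = \sum_(i < K) F i.*2.
Proof.
move=> F0; elim: K => [|K IH]; first by rewrite !big_ord0.
by rewrite doubleS !big_ord_recr /= IH (F0 K.*2.+1) ?addr0 //= odd_double.
Qed.

(* Every nonzero submodule of W_a contains D, whose coefficient of x is 1; so an
   identity between operators commuting with T_7 and T_13 can be tested on that
   coefficient. *)
Lemma lambda_exists_ebase : exists l : fps2, coefXY l 0 0 = 0 /\
  forall f, spans ebase xpredT f -> ser_act (l ^+ 2) f = hecke 5 (hecke 5 f).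
Proof.
pose M i j a b := fcoef (mono i.*2 j.*2 (ebase (enc a.*2 b.*2))) 1.
pose phi a b := fcoef (hecke 5 (hecke 5 (ebase (enc a.*2 b.*2)))) 1.
have M0 i j a b : lexlt (a + b, b)%N (i + j, j)%N -> M i j a b = 0.
  move=> lt; rewrite /M mono_ebase_eq0 // (cwE (code_enc _ _)).
  by move: lt; rewrite /lexlt /=; lia.
have M1 a b : M a b a b = 1.
  by rewrite /M mono_ebase_lead ?code_enc // fcoef_serD1.
have [c cE] := triangular_system phi M0 M1.
pose l : fps2 := FPS (fun j => FPS (fun i => c i j)).
have lE i j : coefXY l i j = c i j by [].
exists l; split.
  have := cE 1%N 0%N 0%N isT; rewrite !big_ord1 M1 mulr1 lE => ->.
  have e0 : enc 0 0 = 0%N by apply: code_inj; rewrite code_enc.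
  rewrite -[phi 0%N 0%N]/(fcoef (hecke 5 (hecke 5 (ebase (enc 0 0)))) 1) e0 /ebase.
  have [z _] := @hecke_serD_small 5 isT.
  by rewrite muln0 (z 1%N) // hecke0.
have act1 t : fcoef (ser_act (l ^+ 2) (ebase t)) 1 =
    fcoef (hecke 5 (hecke 5 (ebase t))) 1.
  have [N tN] : exists N, below N (ebase t).
    by apply: spans_ebase_below; apply: spans_base.
  (* If 4 does not divide t, then 6 t + 1 is not 1 modulo 24 and both coefficients of x vanish.
     Otherwise both parts of the label are even, and the triangular system applies. *)
  have [t4|t4] := boolP (t %% 4 == 0)%N; last first.
    have n1 : (1 != (6 * t).+1 %[mod 24])%N by move: t4; lia.
    rewrite (hecke55_supp24 (@ebase_supp24 t)) // (ser_actE _ tN) fcoef_sum big1 // => i _.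
    rewrite fcoef_sum big1 // => j _; rewrite fcoefZ coefXY_sqr.
    case: ifP => [|/negbT]; first by rewrite mul0r.
    rewrite negb_or => /andP[oi oj].
    rewrite -[nat_of_ord i]odd_double_half -[nat_of_ord j]odd_double_half.
    by rewrite (negPf oi) (negPf oj) (mono_supp24 _ _ (@ebase_supp24 t)) ?mulr0.
  have [a [b def_t]] : exists a b, t = enc a.*2 b.*2.
    exists (code (t %/ 4)).1, (code (t %/ 4)).2; apply: code_inj.
    rewrite code_enc [t in LHS]push_digits code_push /=.
    have -> : odd t = false by lia.
    have -> : odd t./2 = false by lia.
    by rewrite !addn0.
  pose K := (N + a + b).+1.
  have tK : below K.*2 (ebase t) by apply: belowW tN; rewrite /K; lia.
  rewrite (ser_actE _ tK) fcoef_sum.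
  transitivity (phi a b); last by rewrite /phi -def_t.
  have lK : (a + b < K)%N by rewrite /K; lia.
  rewrite -(cE K a b lK).
  rewrite (@sum_double _ K (fun i => fcoef (\sum_(j < K.*2) coefXY (l ^+ 2) i j *:
     mono i j (ebase t)) 1)) => [|i oi]; last first.
    rewrite fcoef_sum big1 // => j _.
    by rewrite coefXY_sqr oi scale0r fcoef0.
  apply: eq_bigr => i _; rewrite fcoef_sum.
  rewrite (@sum_double _ K (fun j => fcoef (coefXY (l ^+ 2) i.*2 j *:
     mono i.*2 j (ebase t)) 1)) => [|j oj]; last first.
    by rewrite coefXY_sqr oj orbT scale0r fcoef0.
  apply: eq_bigr => j _; rewrite fcoefZ coefXY_sqr !odd_double !doubleK lE.
  by rewrite /M -def_t.
have act_coef f : spans ebase xpredT f ->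
    fcoef (ser_act (l ^+ 2) f) 1 = fcoef (hecke 5 (hecke 5 f)) 1.
  move=> [s _ ->]; elim: s => [|t s IH].
    by rewrite big_nil !hecke0 (ser_actE _ (spans0 _ _ : below 0 0)) big_ord0.
  have [N tN] : exists N, below N (ebase t).
    by apply: spans_ebase_below; apply: spans_base.
  have [N' sN'] : exists N, below N (\sum_(k <- s) ebase k).
    by apply: spans_ebase_below; exists s; rewrite ?all_predT.
  rewrite big_cons (ser_actDr _ (belowW (leq_maxl N N') tN) (belowW (leq_maxr N N') sN')).
  by rewrite !heckeD !fcoefD act1 IH.
(* A nonzero difference would be sent to D by some T_7^a T_13^b; these commute with both operators,
   so the coefficient of x is 0 by [act_coef], a contradiction. *)
move=> f fE; apply: ser_eqD; apply: contrapT => /eqP ne.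
set d := _ + _ in ne.
have dE : spans ebase xpredT d.
  by apply: spansD; [apply: spans_ebase_act | apply: spans_hecke55].
have [a [b]] := mono_socle dE ne; rewrite /d monoD.
have [N fN] := spans_ebase_below fE.
rewrite -(ser_act_mono _ _ _ fN) !(@mono_hecke 5) // => /(congr1 (fun g => fcoef g 1)).
rewrite fcoefD act_coef; last exact: spans_ebase_mono.
by rewrite (addrr_pchar2 pchar_F2) fcoef_serD1.
Qed.

(** Take the smallest monomial of u and the basis vector with its label: that monomial gives D, and
    all larger ones give 0. *)
Lemma ser_act_ebase u : u != 0 -> exists t, ser_act u (ebase t) = serD.
Proof.
move=> u0; pose rk i j := ((i + j) ^ 2 + j)%N.
have ex : exists n, `[< exists i j, coefXY u i j != 0 /\ rk i j = n >].
  apply: contrapT => nex; case/eqP: u0; apply: fpsP => j; apply: fpsP => i.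
  apply: contrapT => /eqP uij; apply: nex; exists (rk i j); apply/asboolP.
  by exists i, j.
case: (ex_minnP ex) => n /asboolP[a [b [uab rk_ab]]] nmin.
exists (enc a b); have [N tN] : exists N, below N (ebase (enc a b)).
  by apply: spans_ebase_below; apply: spans_base.
pose K := (N + a + b).+1.
have tK : below K (ebase (enc a b)) by apply: belowW tN; rewrite /K; lia.
have la : (a < K)%N by rewrite /K; lia.
have lb : (b < K)%N by rewrite /K; lia.
have other i j : (i != a) || (j != b) -> coefXY u i j *: mono i j (ebase (enc a b)) = 0.
  move=> ne; have [lt|nlt] := boolP (lexlt (i + j, j) (a + b, b))%N.
    have [->|uij] := eqVneq (coefXY u i j) 0; first by rewrite scale0r.
    have := nmin (rk i j); rewrite -rk_ab => le; have {le} : (rk a b <= rk i j)%N.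
      by apply: le; apply/asboolP; exists i, j.
    move: lt; rewrite /lexlt /rk /= => /orP[l|/andP[/eqP-> l]]; first by nia.
    by rewrite leq_add2l leqNgt l.
  rewrite mono_ebase_eq0 ?scaler0 // (cwE (code_enc _ _)).
  by move: ne nlt; rewrite /lexlt /=; lia.
rewrite (ser_actE _ tK) (bigD1 (Ordinal la)) //= (bigD1 (Ordinal lb)) //=.
rewrite (mono_ebase_lead (code_enc a b)).
have -> : coefXY u a b = 1 by case: (F2_cases (coefXY u a b)) uab => ->; rewrite ?eqxx.
rewrite scale1r big1 => [|j jb]; last by apply: other; apply/orP; right.
rewrite addr0 big1 ?addr0 // => i ia; apply: big1 => j _.
by apply: other; apply/orP; left.
Qed.

Lemma spans_fbase_act N u f : below N f -> spans fbase xpredT f ->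
  spans fbase xpredT (ser_act u f).
Proof.
move=> fN fb; rewrite (ser_actE _ fN).
have stab p g : p \in [:: 7; 13] -> spans fbase xpredT g -> spans fbase xpredT (hecke p g).
  move=> pP; apply: spans_hecke => t _; have pP' : p \in [:: 5; 7; 13] by rewrite inE pP orbT.
  have := @spans_hecke_Dpow p (6 * t).+4.+1 pP'; apply: spans_trans => k /and3P[_ _ kp].
  rewrite Dpow_fbase; first exact: spans_base.
  by move: pP kp; rewrite !inE => /orP[] /eqP->; lia.
apply: spans_sum => i _ _; apply: spans_sum => j _ _; apply: spansZ; rewrite /mono.
elim: (nat_of_ord i) => [|k IH]; last by rewrite iterS; apply: stab.
by rewrite iter0; elim: (nat_of_ord j) => [//|k IH]; rewrite iterS; apply: stab.
Qed.

Lemma W_split f : f \in W_pred -> exists fa fb,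
  [/\ spans ebase xpredT fa, spans fbase xpredT fb & f = fa + fb].
Proof.
move=> /W_predP[s sP ->]; elim: s sP => [_|k s IH /= /andP[kP /IH[fa [fb [faE fbE e]]]]].
  by exists 0, 0; rewrite big_nil addr0; split; try exact: spans0.
rewrite big_cons e; move: kP; rewrite wexpE => /orP[k1|k5].
  exists (Dpow k + fa), fb; rewrite addrA; split=> //.
  by apply: spansD => //; rewrite Dpow_ebase //; apply: spans_base.
exists fa, (Dpow k + fb); rewrite addrCA; split=> //.
by apply: spansD => //; rewrite Dpow_fbase //; apply: spans_base.
Qed.

Lemma W_below f : f \in W_pred -> exists N, below N f.
Proof. by move/W_predP; apply: spans_below. Qed.

Lemma hecke5_act N u f : below N f -> ser_act u (hecke 5 f) = hecke 5 (ser_act u f).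
Proof. exact: ser_act_hecke. Qed.

Lemma lambda_exists : exists l : fps2, is_lambda l.
Proof.
have [l [l00 lE]] := lambda_exists_ebase; exists l; split=> // -[f fW] /=.
have [N fN] := W_below fW.
rewrite -(ser_actM _ _ fN) -expr2.
have [fa [fb [faE fbE def_f]]] := W_split fW.
have common g : spans ebase xpredT g \/ spans fbase xpredT g -> exists N, below N g.
  case=> -[s _ ->]; apply: (@spans_below xpredT).
    by exists [seq (6 * t).+1 | t <- s]%N; rewrite ?all_predT // big_map.
  by exists [seq (6 * t).+4.+1 | t <- s]%N; rewrite ?all_predT // big_map.
have [Na aN] := common _ (or_introl faE); have [Nb bN] := common _ (or_intror fbE).
rewrite def_f (ser_actDr _ (belowW (leq_maxl Na Nb) aN) (belowW (leq_maxr Na Nb) bN)).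
rewrite !heckeD lE //; congr (_ + _); apply: esym.
have T5b : spans ebase xpredT (hecke 5 fb).
  by apply: spans_hecke fbE => t _; apply: hecke5_fbaseT.
(* On W_b the identity is tested after applying T_5, which is injective there, commutes with the
   action and lands in W_a. *)
apply: ser_eqD; apply: hecke5_inj.
  apply: spansD; first exact: spans_fbase_act bN fbE.
  by apply: spans_hecke T5b => t _; apply: hecke5_ebase.
by rewrite heckeD -(hecke5_act _ bN) lE // serDD.
Qed.

(** * The module structure *)

Section DualNumbers.
Variable R : comNzRingType.
Local Notation Q := {poly %/ ('X^2 : {poly R})}.
Implicit Types a b : Q.

Definition dcoef a (i : nat) : R := (val a)`_i.

Lemma mk_monicX2 : mk_monic ('X^2 : {poly R}) = 'X^2.
Proof. by rewrite /mk_monic size_polyXn monicXn. Qed.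

Lemma coef_rmodpX2 (p : {poly R}) i : (i < 2)%N ->
  (Pdiv.Ring.rmodp p (mk_monic 'X^2))`_i = p`_i.
Proof.
move=> li; rewrite mk_monicX2 {2}(Pdiv.RingMonic.rdivp_eq (monicXn _ 2) p).
by rewrite coefD coefMXn li add0r.
Qed.

Lemma dcoefD a b i : dcoef (a + b) i = dcoef a i + dcoef b i.
Proof. exact: coefD. Qed.

Lemma dcoef0M a b : dcoef (a * b) 0 = dcoef a 0 * dcoef b 0.
Proof. by rewrite /dcoef [LHS]coef_rmodpX2 // coef0M. Qed.

Lemma dcoef1M a b :
  dcoef (a * b) 1 = dcoef a 0 * dcoef b 1 + dcoef a 1 * dcoef b 0.
Proof.
by rewrite /dcoef [LHS]coef_rmodpX2 // coefM !big_ord_recl big_ord0 addr0.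
Qed.

Lemma dcoefC (u : R) i : dcoef (qpolyC 'X^2 u) i = if i == 0 then u else 0.
Proof. exact: coefC. Qed.

Lemma dcoefX i : dcoef (qpolyX 'X^2) i = (i == 1)%:R.
Proof.
have qX := @qpolyXE R 'X^2; rewrite size_polyXn monicXn in qX.
rewrite -coefX; exact: (congr1 (fun p : {poly R} => p`_i) (qX isT isT)).
Qed.

Lemma dcoef1 i : dcoef 1 i = (i == 0)%:R.
Proof. exact: coef1. Qed.

Lemma dcoef_eq0 a : dcoef a 0 = 0 -> dcoef a 1 = 0 -> a = 0.
Proof.
move=> a0 a1; apply: val_inj; apply/polyP => i; rewrite coef0.
case: i => [|[|i]] //; apply: nth_default.
apply: leq_trans (size_npoly a) _.
by rewrite mk_monicX2 size_polyXn.
Qed.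

Section DualScale.
Variables (V : zmodType) (act : R -> V -> V) (e : V -> V).
Hypotheses (act1 : left_id 1 act) (actM : forall r s v, act (r * s) v = act r (act s v)).
Hypotheses (actDl : forall r s v, act (r + s) v = act r v + act s v).
Hypotheses (actDr : forall r, {morph act r : v w / v + w}).
Hypotheses (eD : {morph e : v w / v + w}) (ee : forall v, e (e v) = 0).
Hypothesis act_e : forall r v, act r (e v) = e (act r v).

Definition dual_scale a v : V := act (dcoef a 0) v + act (dcoef a 1) (e v).

Let act0 v : act 0 v = 0.
Proof. by apply: (addIr (act 0 v)); rewrite -actDl !add0r. Qed.

Let act0r r : act r 0 = 0.
Proof. by apply: (addIr (act r 0)); rewrite -actDr !add0r. Qed.

Lemma dual_scaleA a b v : dual_scale a (dual_scale b v) = dual_scale (a * b) v.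
Proof.
rewrite /dual_scale dcoef0M dcoef1M actDl !actM eD !actDr -!act_e ee.
by rewrite !act0r addr0 addrA.
Qed.

Lemma dual_scale1 : left_id 1 dual_scale.
Proof. by move=> v; rewrite /dual_scale !dcoef1 act1 act0 addr0. Qed.

Lemma dual_scaleDr : right_distributive dual_scale +%R.
Proof. by move=> a v w; rewrite /dual_scale eD !actDr addrACA. Qed.

Lemma dual_scaleDl v : {morph dual_scale^~ v : a b / a + b}.
Proof. by move=> a b; rewrite /dual_scale !dcoefD !actDl addrACA. Qed.

End DualScale.

End DualNumbers.

Definition ocoef (a : O) (i : nat) : fps2 := @dcoef fps2 a i.

Lemma ocoef_ser u i : ocoef (O_of_ser u) i = if i == 0 then u else 0.
Proof. exact: dcoefC. Qed.

Lemma ocoef_eps i : ocoef eps i = (i == 1)%:R.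
Proof. exact: dcoefX. Qed.

Lemma ocoef_eq0 a : ocoef a 0 = 0 -> ocoef a 1 = 0 -> a = 0.
Proof. exact: dcoef_eq0. Qed.

Section Module.
Variable l : fps2.
Hypothesis l_lambda : is_lambda l.

Definition Wact (u : fps2) (w : W) : W := MkW (ser_act_W u (valP w)).

Definition WT5 (w : W) : W := MkW (@hecke_W 5 _ isT (valP w)).

Lemma W_val_inj : injective W_val.
Proof. exact: val_inj. Qed.

Lemma W_valD (v w : W) : W_val (v + w) = W_val v + W_val w.
Proof. by []. Qed.

Lemma WactD u : {morph Wact u : v w / v + w}.
Proof.
move=> v w; apply: W_val_inj.
have [M vM] := W_below (valP v); have [N wN] := W_below (valP w).
rewrite W_valD; exact: ser_actDr (belowW (leq_maxl M N) vM) (belowW (leq_maxr M N) wN).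
Qed.

Lemma WactDl (u u' : fps2) w : Wact (u + u') w = Wact u w + Wact u' w.
Proof.
by apply: W_val_inj; have [N wN] := W_below (valP w); exact: ser_actDl wN.
Qed.

Lemma WactM (u u' : fps2) w : Wact (u * u') w = Wact u (Wact u' w).
Proof.
by apply: W_val_inj; have [N wN] := W_below (valP w); exact: ser_actM wN.
Qed.

Lemma Wact1 w : Wact 1 w = w.
Proof.
apply: W_val_inj; have [N wN] := W_below (valP w).
exact: (ser_act_delta wN coefXY1).
Qed.

Lemma WactT5 u w : Wact u (WT5 w) = WT5 (Wact u w).
Proof.
by apply: W_val_inj; have [N wN] := W_below (valP w); exact: hecke5_act wN.
Qed.

Lemma WT5D : {morph WT5 : v w / v + w}.
Proof. by move=> v w; apply: W_val_inj; exact: heckeD. Qed.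

Lemma WT5_sqr w : WT5 (WT5 w) = Wact l (Wact l w).
Proof. by apply: W_val_inj; exact: (l_lambda.2 w). Qed.

Lemma W_addvv (w : W) : w + w = 0.
Proof. by apply: W_val_inj; exact: serDD. Qed.

Definition Weps w : W := Wact l w + WT5 w.

Lemma WepsD : {morph Weps : v w / v + w}.
Proof. by move=> v w; rewrite /Weps WactD WT5D addrACA. Qed.

Lemma Wact_eps u w : Wact u (Weps w) = Weps (Wact u w).
Proof. by rewrite /Weps WactD -!WactM mulrC WactT5. Qed.

(** In characteristic 2 the square is lambda^2 + T_5^2, the cross terms cancelling by
    commutation. *)
Lemma Weps_sqr w : Weps (Weps w) = 0.
Proof.
rewrite {1}/Weps {2}/Weps WT5D WT5_sqr -WactT5 {1}/Weps WactD.
by rewrite [X in _ + X]addrC W_addvv.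
Qed.

Definition Wscale (a : O) w : W := dual_scale Wact Weps a w.

Definition Wmodule : W_module :=
  GRing.Zmodule_isLmodule.Build O W
    (dual_scaleA WactM WactDl WactD WepsD Weps_sqr Wact_eps)
    (dual_scale1 _ Wact1 WactDl) (dual_scaleDr WactD WepsD) (dual_scaleDl _ WactDl).

Lemma WmoduleE a w : W_scale Wmodule a w = Wscale a w.
Proof. by []. Qed.

Lemma ebase_W t : ebase t \in W_pred.
Proof.
apply/W_predP; apply: (@spans_base Dpow); rewrite wexpE.
by rewrite (_ : (6 * t).+1 %% 6 = 1)%N //; lia.
Qed.

Lemma spans_fbase_W f : spans fbase xpredT f -> f \in W_pred.
Proof.
move=> fE; apply/W_predP; apply: spans_trans fE => t _.
apply: (@spans_base Dpow wexp (6 * t).+4.+1); rewrite wexpE.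
by rewrite (_ : (6 * t).+4.+1 %% 6 = 5)%N //; lia.
Qed.

Lemma Wscale_val a (w : W) : W_val (Wscale a w) =
  ser_act (ocoef a 0 + ocoef a 1 * l) w + ser_act (ocoef a 1) (hecke 5 w).
Proof.
rewrite /Wscale /dual_scale /Weps WactD addrA.
by rewrite -[Wact (dcoef a 1) (Wact l w)]WactM -WactDl.
Qed.

Lemma Wscale_faithful a : (forall w, Wscale a w = 0) -> a = 0.
Proof.
move=> a_ann; pose u := ocoef a 0 + ocoef a 1 * l; pose v := ocoef a 1.
have {}a_ann f : f \in W_pred -> ser_act u f + ser_act v (hecke 5 f) = 0.
  by move=> fW; have := congr1 W_val (a_ann (MkW fW)); rewrite Wscale_val.
(* If u sends a vector of W_a to D, the T_5 term cannot cancel it: it lies in W_b, whose exponents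
   are 5 modulo 6, and has no coefficient of x. *)
have u0 : u = 0.
  apply: contrapT => /eqP/ser_act_ebase[t tE].
  have := congr1 (fun f => fcoef f 1) (a_ann _ (ebase_W t)).
  have T5t := hecke5_ebase t; have [N tN] := W_below (ebase_W t).
  have bN : below N (hecke 5 (ebase t)).
    by apply: belowW (@hecke_below 5 _ _ isT tN); apply: leq_pred.
  rewrite tE fcoefD fcoef_serD1.
  have [s _ ->] := spans_fbase_act v bN T5t.
  rewrite fcoef_sum big1 ?addr0 // => k _.
  have f6 : supp_mod 6 (6 * k).+4.+1 (fbase k).
    exact: (@supp_mod_dvd _ 6 24 _ _ isT (@serD_exp_supp24 _)).
  by apply: f6; lia.
(* Any vector of W_a is T_5 of a vector of W_b, so a nonzero v would still produce D. *)
have v0 : v = 0.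
  apply: contrapT => /eqP/ser_act_ebase[t tE].
  have [g gE g5] := hecke5_surj (@spans_base ebase xpredT t isT).
  have := a_ann _ (spans_fbase_W gE); rewrite g5 tE u0.
  have [N gN] := W_below (spans_fbase_W gE).
  by rewrite (ser_act0l gN) add0r => D0; have := serD_neq0; rewrite D0 eqxx.
apply: ocoef_eq0; last exact: v0.
by move: u0; rewrite /u -/v v0 mul0r addr0.
Qed.

End Module.

Theorem theorem5p3 :
  (exists l : fps2, is_lambda l) /\
  forall l : fps2, is_lambda l ->
    exists m : W_module,
      [/\ forall w : W, W_val (W_scale m (O_of_ser serX) w) = hecke 7 w,
          forall w : W, W_val (W_scale m (O_of_ser serY) w) = hecke 13 w,
          forall (u : fps2) (w : W),
            W_val (W_scale m (O_of_ser u) w) = ser_act u w,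
          forall w : W, W_val (W_scale m eps w) = ser_act l w + hecke 5 w
        & faithful (W_lmod m)].
Proof.
split; first exact: lambda_exists.
move=> l l_lambda; exists (Wmodule l_lambda).
have serE u w : W_val (W_scale (Wmodule l_lambda) (O_of_ser u) w) = ser_act u w.
  rewrite WmoduleE Wscale_val !ocoef_ser mul0r addr0.
  have [N wN] := W_below (valP w).
  have TN : below N (hecke 5 w).
    by apply: belowW (@hecke_below 5 _ _ isT wN); apply: leq_pred.
  by rewrite (ser_act0l TN) addr0.
split=> // [w|w|w|].
- by rewrite serE; have [N wN] := W_below (valP w); rewrite (ser_act_delta wN coefXY_serX).
- by rewrite serE; have [N wN] := W_below (valP w); rewrite (ser_act_delta wN coefXY_serY).
- rewrite WmoduleE Wscale_val !ocoef_eps add0r mul1r.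
  have TW := @hecke_W 5 _ isT (valP w); have [N TN] := W_below TW.
  by rewrite (ser_act_delta TN coefXY1).
exact: Wscale_faithful.
Qed.
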